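(* Suppose $0<p<\infty$, and let $g\in L^2(\mathbb{R}^l)$ be such that $G(g)=\{e^{2\pi i n\cdot x}g(x-m)\}_{(m,n)\in\mathbb{Z}^{2l}}$ is a Riesz basis for $L^2(\mathbb{R}^l)$ and $g$ is supported in $(-M,M)^l$. Then there exists a constant $C>0$ depending only on the Riesz basis bounds of $G(g)$ such that for any $1\le k\le l$ and any $2\le T\le\infty$ each of the following holds. (i) If $p>1$, then $$\frac{C(1-2^{1/p-1})}{M(1-1/p)}\ \le\ \int_{\mathbb{R}^l}\min(|\xi_k|^p,T)|\widehat g(\xi)|^2\,d\xi .$$ (ii) If $p=1$, then $$\frac{C\log(T)}{M}\ \le\ \int_{\mathbb{R}^l}\min(|\xi_k|,T)|\widehat g(\xi)|^2\,d\xi .$$ (iii) If $p<1$, then $$\frac{C}{M(1/p-1)}\ \le\ \int_{\mathbb{R}^l}|\xi_k|^p|\widehat g(\xi)|^2\,d\xi .$$ This result also holds when $g$ and $\widehat g$ are interchanged (that is, if instead $\widehat g$ is supported in $(-M,M)^l$, the same inequalities hold with $\int_{\mathbb{R}^l}\min(|x_k|^p,T)|g(x)|^2dx$, etc., on the right-hand sides).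
   Context: $\widehat g$ denotes the Fourier transform on $L^2(\mathbb{R}^l)$, normalized as $\widehat g(\xi)=\int_{\mathbb{R}^l}g(x)e^{-2\pi i x\cdot\xi}\,dx$ for $g\in L^1\cap L^2$. For $T=\infty$, $\min(s,T)=s$ and $\log(T)=\infty$. Riesz basis bounds of a Riesz basis $\{h_n\}$ of a Hilbert space $\mathcal{H}$ are constants $0<A\le B<\infty$ with $A\sum_n|c_n|^2\le\|\sum_nc_nh_n\|_{\mathcal H}^2\le B\sum_n|c_n|^2$ for all square-summable scalar sequences $(c_n)$. *)

(* Defs.v *)
From HB Require Import structures.
From mathcomp Require Import all_boot all_order all_algebra finmap.
From mathcomp Require Import all_classical all_reals all_analysis.
From mathcomp Require Import summability complex.

Set Implicit Arguments.
Unset Strict Implicit.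
Unset Printing Implicit Defensive.
Import Order.TTheory GRing.Theory Num.Theory.
Import numFieldNormedType.Exports.
Import Normc.

Local Open Scope classical_set_scope.
Local Open Scope ring_scope.

(* The n-fold power of a sigma-finite measure on n-tuples, obtained from the
   product measure by transport along (a, t) |-> a :: t. *)
Section power_measure.
Context d (T : measurableType d) (R : realType).
Variable mu : {sigma_finite_measure set T -> \bar R}.

Definition tcons {n : nat} (x : T * n.-tuple T) : n.+1.-tuple T :=
  [tuple of x.1 :: x.2].

Lemma measurable_tcons n : measurable_fun [set: _] (@tcons n).
Proof. exact: measurable_cons. Qed.

Lemma product_sigma_finite d' (T' : measurableType d')
    (m : {sigma_finite_measure set T' -> \bar R}) :
  sigma_finite [set: T * T'] (mu \x m)%E.
Proof.
have /sigma_finiteP[F [TF ndF Foo]] := sigma_finiteT mu.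
have /sigma_finiteP[G [TG ndG Goo]] := sigma_finiteT m.
exists (fun n => F n `*` G n).
  rewrite -setXTT TF TG predeqE => -[x y]; split.
    move=> [/= [n _ Fnx] [k _ Gky]]; exists (maxn n k) => //; split.
    - by move: x Fnx; exact/subsetPset/ndF/leq_maxl.
    - by move: y Gky; exact/subsetPset/ndG/leq_maxr.
  by move=> [n _ []/= ? ?]; split; exists n.
move=> k; have [? ?] := Foo k; have [? ?] := Goo k.
split; first exact: measurableX.
by rewrite product_measure1E// lte_mul_pinfty// ge0_fin_numE.
Qed.

Section step.
Variables (n : nat) (m : {sigma_finite_measure set (n.-tuple T) -> \bar R}).

Definition power_step : set (n.+1.-tuple T) -> \bar R :=
  pushforward (mu \x m)%E (@tcons n).

Let power_step0 : power_step set0 = 0%E.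
Proof. by rewrite /power_step /pushforward preimage_set0 measure0. Qed.

Let power_step_ge0 A : (0 <= power_step A)%E.
Proof. by rewrite /power_step /pushforward measure_ge0. Qed.

Let power_step_sigma_additive : semi_sigma_additive power_step.
Proof.
have mt := @measurable_tcons n.
move=> F mF tF mUF; rewrite /power_step /pushforward preimage_bigcup.
apply: measure_semi_sigma_additive.
- by move=> k; rewrite -[X in measurable X]setTI; exact: mt.
- apply/trivIsetP => /= i j _ _ ij; rewrite -preimage_setI.
  by move/trivIsetP : tF => /(_ _ _ _ _ ij) ->//; rewrite preimage_set0.
- by rewrite -preimage_bigcup -[X in measurable X]setTI; exact: mt.
Qed.

HB.instance Definition _ := isMeasure.Build _ _ _ power_step
  power_step0 power_step_ge0 power_step_sigma_additive.

Let power_step_sigma_finite : sigma_finite setT power_step.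
Proof.
pose uncons (t : n.+1.-tuple T) : T * n.-tuple T :=
  (thead t, [tuple of behead t]).
have tconsK : cancel (@tcons n) uncons.
  by case=> a b; rewrite /uncons /tcons theadE; congr pair; exact/val_inj.
have munc : measurable_fun [set: _] uncons.
  apply/measurable_fun_pairP; split; first exact: measurable_tnth.
  exact: measurable_behead.
have [F FT Foo] := product_sigma_finite m.
exists (fun k => uncons @^-1` F k); first by rewrite -preimage_bigcup -FT.
move=> k; have [mF Fk] := Foo k; split.
  by rewrite -[X in measurable X]setTI; exact: munc.
rewrite /power_step /pushforward -comp_preimage.
by rewrite (_ : uncons \o _ = id) //; apply/funext => x; exact: tconsK.
Qed.

HB.instance Definition _ := @Measure_isSigmaFinite.Build _ _ _
  power_step power_step_sigma_finite.
End step.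

Fixpoint power_measure (n : nat) :
    {sigma_finite_measure set (n.-tuple T) -> \bar R} :=
  if n is k.+1 then power_step (power_measure k) else dirac [tuple].

Lemma power_measure_box n (A : 'I_n -> set T) :
  (forall i, measurable (A i)) ->
  power_measure n [set x | forall i, A i (tnth x i)] =
  (\prod_(i < n) mu (A i))%E.
Proof.
elim: n A => [|l IHl] A mA.
  rewrite big_ord0 /= diracE mem_set//= => -[].
  by case.
rewrite big_ord_recl /= /power_step /pushforward.
rewrite (_ : _ @^-1` _ = A ord0 `*`
    [set x | forall i, A (lift ord0 i) (tnth x i)]); last first.
  apply/seteqP; split => [[a b]/= Aab|[a b]/= [Aa Ab] i].
    split; first by have := Aab ord0.
    by move=> i; have := Aab (lift ord0 i); rewrite tnthS.
  by case: (unliftP ord0 i) => [j|] -> //; rewrite tnthS.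
rewrite product_measure1E//; first by congr (_ * _)%E; exact: (IHl (fun i => A (lift ord0 i))).
rewrite (_ : [set x | _] = \big[setI/setT]_(i < l)
    ((@tnth l T)^~ i @^-1` A (lift ord0 i))); last first.
  rewrite -bigcap_seq; apply/seteqP; split => x /= Ax i; first by move=> _; exact: Ax.
  by apply: Ax; rewrite /= mem_index_enum.
apply: bigsetI_measurable => i _; rewrite -[X in measurable X]setTI.
exact: measurable_tnth.
Qed.

End power_measure.

Notation euclid R l := (l.-tuple (measurableTypeR R)).

(* Lebesgue measure on the Borel sets of R^l. *)
Definition lebesgue_euclid (R : realType) (l : nat) :
    {sigma_finite_measure set (euclid R l) -> \bar R} :=
  power_measure (@lebesgue_measure R) l.

Section euclid.
Context {R : realType} {l : nat}.
Local Notation mu := (lebesgue_euclid R l).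
Implicit Types (x xi : euclid R l) (m n : l.-tuple int).
Implicit Types f g h u : euclid R l -> R[i].

Definition ecoord x (k : 'I_l) : R := tnth x k.

Definition dot x xi : R := \sum_(k < l) ecoord x k * ecoord xi k.

Definition intvec m : euclid R l := [tuple ((tnth m k)%:~R : R) | k < l].

Definition subvec x xi : euclid R l := [tuple ecoord x k - ecoord xi k | k < l].

Definition cis (t : R) : R[i] := (cos t +i* sin t)%C.

(* Complex-valued functions are measured and integrated componentwise. *)
Definition cmeasurable f : Prop :=
  measurable_fun [set: euclid R l] (fun x => complex.Re (f x)) /\
  measurable_fun [set: euclid R l] (fun x => complex.Im (f x)).

Definition cintegrable f : Prop :=
  mu.-integrable [set: euclid R l] (fun x => (complex.Re (f x))%:E) /\
  mu.-integrable [set: euclid R l] (fun x => (complex.Im (f x))%:E).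

Definition cintegral f : R[i] :=
  ((\int[mu]_x complex.Re (f x)) +i* (\int[mu]_x complex.Im (f x)))%C.

Definition sqnormL2 f : \bar R := (\int[mu]_x ((normc (f x)) ^+ 2)%:E)%E.

Definition inL2 f : Prop := cmeasurable f /\ (sqnormL2 f < +oo)%E.

Definition fourierL1 u xi : R[i] :=
  cintegral (fun x => u x * cis (- (2 * pi * dot x xi))).

(* h represents the Fourier transform of g in L^2: the pair (g, h) lies in the
   L^2 x L^2 closure of the graph of the integral transform on L^1 `&` L^2,
   i.e. the transform is extended by continuity.  Representatives of h differ
   on null sets only. *)
Definition is_fourierL2 g h : Prop :=
  [/\ inL2 g, inL2 h &
    exists u : nat -> euclid R l -> R[i],
    [/\ forall j, cintegrable (u j) /\ inL2 (u j),
        sqnormL2 (fun x => u j x - g x) @[j --> \oo] --> 0%E &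
        sqnormL2 (fun xi => fourierL1 (u j) xi - h xi) @[j --> \oo] --> 0%E]].

(* Unconditional convergence in L^2 of a series indexed by an arbitrary type. *)
Definition has_sumL2 (I : choiceType) (c : I -> R[i])
    (e : I -> euclid R l -> R[i]) f : Prop :=
  sqnormL2 (fun x => \sum_(i <- enum_fset J) c i * e i x - f x)
    @[J --> totally] --> 0%E.

Definition sqsum (I : choiceType) (c : I -> R[i]) : \bar R :=
  \esum_(i in [set: I]) ((normc (c i)) ^+ 2)%:E.

Definition riesz_bounds (A B : R) (I : choiceType)
    (e : I -> euclid R l -> R[i]) : Prop :=
  [/\ 0 < A, A <= B &
    forall c : I -> R[i], (sqsum c < +oo)%E ->
    exists f, [/\ inL2 f, has_sumL2 c e f,
      (A%:E * sqsum c <= sqnormL2 f)%E & (sqnormL2 f <= B%:E * sqsum c)%E]].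

(* The synthesis map c |-> \sum_i c_i e_i is an isomorphism from l^2(I) onto
   L^2(R^l), i.e. e is the image of an orthonormal basis under a bounded
   bijective operator. *)
Definition riesz_basis (I : choiceType) (e : I -> euclid R l -> R[i]) : Prop :=
  [/\ forall i, inL2 (e i),
      exists A B : R, riesz_bounds A B e &
      forall f, inL2 f -> exists2 c : I -> R[i],
        (sqsum c < +oo)%E & has_sumL2 c e f].

Definition gabor g (mn : l.-tuple int * l.-tuple int) : euclid R l -> R[i] :=
  fun x => cis (2 * pi * dot (intvec mn.2) x) * g (subvec x (intvec mn.1)).

(* As elements of L^2 are classes modulo null sets, the support condition is
   required almost everywhere. *)
Definition supported_in_cube (M : R) g : Prop :=
  {ae mu, forall x, ~ (forall k, - M < ecoord x k < M) -> g x = 0}.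

Definition moment (p : R) (k : 'I_l) f : \bar R :=
  (\int[mu]_x (`|ecoord x k| `^ p * (normc (f x)) ^+ 2)%:E)%E.

Definition trunc_moment (p : R) (T : \bar R) (k : 'I_l) f : \bar R :=
  (\int[mu]_x (mine (`|ecoord x k| `^ p)%:E T * ((normc (f x)) ^+ 2)%:E))%E.

Definition moment_bounds (C M p : R) (T : \bar R) (k : 'I_l) f : Prop :=
  [/\ 1 < p ->
        ((C * (1 - 2 `^ (p^-1 - 1)) / (M * (1 - p^-1)))%:E
          <= trunc_moment p T k f)%E,
      p = 1 -> ((C / M)%:E * lne T <= trunc_moment p T k f)%E &
      p < 1 -> ((C / (M * (p^-1 - 1)))%:E <= moment p k f)%E].

End euclid.

(* Main.v *)
Require Import Defs.
From mathcomp Require Import all_boot all_order all_algebra finmap.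
From mathcomp Require Import all_classical all_reals all_analysis summability complex.
From mathcomp Require Import measurable_realfun.
From mathcomp Require Import ring lra zify.
Set Implicit Arguments.
Unset Strict Implicit.
Unset Printing Implicit Defensive.
Import Order.TTheory GRing.Theory Num.Theory.
Import numFieldNormedType.Exports.
Import Normc.
Local Open Scope classical_set_scope.
Local Open Scope ring_scope.


(* The Zak transform H(x, y) of a window f turns time-frequency shifts into
   multiplication by characters, so the Riesz bounds A and B of the Gabor system
   say that A <= |H|^2 <= B almost everywhere.  Moreover H is quasi-periodic: its
   phase winds once around a unit square in the coordinates (x_k, y_k), hence H
   cannot vary slowly in both of them.  If f is supported in (-M, M)^l, then H is
   a trigonometric polynomial of degree O(M) in y_k and changes little over steps
   of size c/M.  A low-pass filter of H in x_k at frequency N changes little over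
   steps of size c/N.  Therefore, on every grid of O(N) x O(M) points, the
   difference between H and its filter is at least sqrt A / 16 somewhere; averaging
   over all translates of the grid, and using Parseval's identity for the filter,
   the Fourier transform of f has mass at least C / (M N) in |xi_k| >= N, for
   every N >= 1.  Summing this estimate over N = 2^j gives the moment bounds.
   If the Fourier transform of g is compactly supported, the same argument
   applies to it, because its Gabor system is the Fourier image of the one of g. *)

(** * Complex numbers *)

(** The bounds on |H|^2 hold only almost everywhere and H need not be continuous in x, so no
    continuous winding number is available. The argument runs on finite grids instead: for almost
    every base point the bounds hold at all points of the grid at once. For the same reason the
    low-pass filter is a finite combination of translates by multiples of the mesh: its variation
    between neighbours is then controlled by the values of H at grid points alone. The mesh is 1/(q
    N) in x_k and 1/(q N') in y_k, where q is about 256 sqrt(B/A) and N' is of order M; the grid has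
    about q^2 N M points, so C depends on A and B only. Nonvanishing of H forces M > 1/4, hence
    rounding M up to an integer costs only a factor. In the sum over N = 2^j, layer j has weight of
    order 2^(p j) and tail at least C/(M 2^j), so the ratio is 2^(p-1): a geometric series if p < 1,
    and equal terms up to log T if p = 1. If p > 1, the claimed bound is at most a multiple of 1/M,
    and N = 1 alone suffices. *)

Section complex_basics.
Context {R : realType}.
Implicit Types (z w : R[i]) (t s : R).
Local Notation Re := (@complex.Re R).
Local Notation Im := (@complex.Im R).

Lemma sqr_normcE z : normc z ^+ 2 = Re z ^+ 2 + Im z ^+ 2.
Proof. by case: z => a b /=; rewrite sqr_sqrtr ?addr_ge0 ?sqr_ge0. Qed.

Lemma normc_ge0 z : 0 <= normc z.
Proof. by case: z => a b /=; exact: sqrtr_ge0. Qed.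

Lemma normc_opp z : normc (- z) = normc z.
Proof. exact: (@normcN R z). Qed.

Lemma normcD z w : normc (z + w) <= normc z + normc w.
Proof. exact: (@le_normcD R z w). Qed.

Lemma normc_real t : normc t%:C%C = `|t|.
Proof. by rewrite /= expr0n addr0 sqrtr_sqr. Qed.

Lemma normc_conj z : normc (z^*)%C = normc z.
Proof. by case: z => a b /=; rewrite sqrrN. Qed.

Lemma mul_conjc z : z * (z^*)%C = (normc z ^+ 2)%:C%C.
Proof. by rewrite sqr_normcE add_Re2_Im2 sqr_normc. Qed.

Lemma abs_Re_le z : `|Re z| <= normc z.
Proof.
by rewrite -ler_sqr ?nnegrE ?normc_ge0// sqr_normcE real_normK ?num_real// lerDl sqr_ge0.
Qed.

Lemma abs_Im_le z : `|Im z| <= normc z.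
Proof.
by rewrite -ler_sqr ?nnegrE ?normc_ge0// sqr_normcE real_normK ?num_real// lerDr sqr_ge0.
Qed.

Lemma normc_le z : normc z <= `|Re z| + `|Im z|.
Proof.
rewrite -ler_sqr ?nnegrE ?normc_ge0 ?addr_ge0// sqr_normcE sqrrD.
by rewrite !real_normK ?num_real// lerD2r lerDl mulrn_wge0// mulr_ge0.
Qed.

Lemma normc_sum I (r : seq I) (P : pred I) (F : I -> R[i]) :
  normc (\sum_(i <- r | P i) F i) <= \sum_(i <- r | P i) normc (F i).
Proof.
elim/big_rec2: _ => [|i x y _ h]; first by rewrite normc0.
by rewrite (le_trans (normcD _ _))// lerD2l.
Qed.

Lemma cRe_sum I (r : seq I) (P : pred I) (F : I -> R[i]) :
  Re (\sum_(i <- r | P i) F i) = \sum_(i <- r | P i) Re (F i).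
Proof. by elim/big_rec2: _ => [//|i x y _ <-]; case: (F i) y => a b []. Qed.

Lemma cIm_sum I (r : seq I) (P : pred I) (F : I -> R[i]) :
  Im (\sum_(i <- r | P i) F i) = \sum_(i <- r | P i) Im (F i).
Proof. by elim/big_rec2: _ => [//|i x y _ <-]; case: (F i) y => a b []. Qed.

Lemma cReD z w : Re (z + w) = Re z + Re w.
Proof. by case: z w => ? ? []. Qed.
Lemma cImD z w : Im (z + w) = Im z + Im w.
Proof. by case: z w => ? ? []. Qed.
Lemma cReM z w : Re (z * w) = Re z * Re w - Im z * Im w.
Proof. by case: z w => ? ? []. Qed.
Lemma cImM z w : Im (z * w) = Re z * Im w + Im z * Re w.
Proof. by case: z w => ? ? []. Qed.
Lemma cReN z : Re (- z) = - Re z.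
Proof. by case: z. Qed.
Lemma cImN z : Im (- z) = - Im z.
Proof. by case: z. Qed.
Lemma cReJ z : Re (z^*)%C = Re z.
Proof. by case: z. Qed.
Lemma cImJ z : Im (z^*)%C = - Im z.
Proof. by case: z. Qed.

Definition ReImE := (cReD, cImD, cReM, cImM, cReN, cImN, cReJ, cImJ).

Lemma complex_ext z w : Re z = Re w -> Im z = Im w -> z = w.
Proof. by case: z w => a b [c d] /= -> ->. Qed.

Lemma sqr_normcD z w :
  normc (z + w) ^+ 2 = normc z ^+ 2 + 2 * Re (z * (w^*)%C) + normc w ^+ 2.
Proof. by rewrite !sqr_normcE !ReImE; ring. Qed.

Lemma sqr_normcD_le z w :
  normc (z + w) ^+ 2 <= 2 * normc z ^+ 2 + 2 * normc w ^+ 2.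
Proof.
rewrite !sqr_normcE !ReImE -subr_ge0.
rewrite (_ : _ - _ = (Re z - Re w) ^+ 2 + (Im z - Im w) ^+ 2); last by ring.
by rewrite addr_ge0// sqr_ge0.
Qed.

(* Young's inequality: the cross term is at most e |z|^2 + |w|^2 / e. *)
Lemma sqr_normcD_young (e : R) z w : 0 < e ->
  normc (z + w) ^+ 2 <= (1 + e) * normc z ^+ 2 + (1 + e^-1) * normc w ^+ 2.
Proof.
move=> e0; rewrite !sqr_normcE !ReImE -subr_ge0.
rewrite (_ : _ - _ = e^-1 * ((e * Re z - Re w) ^+ 2 + (e * Im z - Im w) ^+ 2)).
  by rewrite mulr_ge0 ?invr_ge0 ?(ltW e0)// addr_ge0// sqr_ge0.
by field; rewrite gt_eqF.
Qed.

Lemma conjcM z w : ((z * w)^*)%C = (z^*)%C * (w^*)%C.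
Proof. by case: z w => a b [c d]; apply: complex_ext; rewrite /=; ring. Qed.

Lemma conjcD z w : ((z + w)^*)%C = (z^*)%C + (w^*)%C.
Proof. by case: z w => a b [c d]; apply: complex_ext; rewrite /=; ring. Qed.

Lemma conjcB z w : ((z - w)^*)%C = (z^*)%C - (w^*)%C.
Proof. by case: z w => a b [c d]; apply: complex_ext; rewrite /=; ring. Qed.

Lemma conjc_sum I (r : seq I) (P : pred I) (F : I -> R[i]) :
  ((\sum_(i <- r | P i) F i)^*)%C = \sum_(i <- r | P i) ((F i)^*)%C.
Proof. by elim/big_rec2: _ => [|i x y _ <-]; rewrite ?conjc0 ?conjcD. Qed.

Lemma sqr_normc_sum I (r : seq I) (F : I -> R[i]) :
  (normc (\sum_(i <- r) F i) ^+ 2)%:C%C =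
  \sum_(i <- r) \sum_(j <- r) F i * ((F j)^*)%C.
Proof.
rewrite -mul_conjc conjc_sum mulr_suml.
by apply: eq_bigr => i _; rewrite mulr_sumr.
Qed.

Lemma cis0 : cis (0 : R) = 1.
Proof. by rewrite /cis cos0 sin0. Qed.

Lemma cisD t s : cis (t + s) = cis t * cis s.
Proof.
apply: complex_ext; rewrite /= ?cosD ?sinD//.
by rewrite addrC.
Qed.

Lemma cisN t : cis (- t) = ((cis t)^*)%C.
Proof. by rewrite /cis cosN sinN. Qed.

Lemma normc_cis t : normc (cis t) = 1.
Proof. by rewrite /= cos2Dsin2 sqrtr1. Qed.

Lemma cis_neq0 t : cis t != 0.
Proof.
by apply/eqP => c0; have := normc_cis t; rewrite c0 normc0 => /eqP; rewrite eq_sym oner_eq0.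
Qed.

Lemma cis_nat (n : nat) : cis (2 * pi * n%:R) = 1 :> R[i].
Proof.
elim: n => [|n ih]; first by rewrite mulr0 cis0.
rewrite -[n.+1]addn1 natrD mulrDr cisD ih mul1r mulr1 mulrC mulr_natr.
by rewrite /cis cos2pi sin2pi.
Qed.

Lemma cis_int (n : int) : cis (2 * pi * n%:~R) = 1 :> R[i].
Proof.
case: n => n; first exact: cis_nat.
by rewrite NegzE mulrNz mulrN cisN cis_nat conjc1.
Qed.

Lemma cisX t n : cis t ^+ n = cis (t * n%:R).
Proof.
elim: n => [|n ih]; first by rewrite mulr0 cis0 expr0.
by rewrite exprS ih -cisD -[n.+1]add1n natrD mulrDr mulr1.
Qed.

Lemma abs_sin_le t : `|sin t| <= `|t|.
Proof.
wlog t0 : t / 0 <= t.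
  move=> h; have [|/ltW t0] := leP 0 t; first exact: h.
  by rewrite -normrN -sinN -[leRHS]normrN h// oppr_ge0.
move: t0; rewrite le_eqVlt => /predU1P[<-|t0]; first by rewrite sin0 normr0.
have [|c _] := @MVT R sin cos 0 t t0 (fun x _ => is_derive_sin x).
  by apply: continuous_subspaceT => x; exact: continuous_sin.
rewrite sin0 !subr0 => ->; rewrite normrM ler_piMl// cos_max//.
Qed.

Lemma normc_cis_sub1_le t : normc (cis t - 1) <= `|t|.
Proof.
rewrite -ler_sqr ?nnegrE ?normc_ge0// sqr_normcE !ReImE /= oppr0 addr0.
have -> : (cos t - 1) ^+ 2 + sin t ^+ 2 = (2 * sin (t / 2)) ^+ 2.
  have h := cos2Dsin2 t; have h2 : cos t = 1 - 2 * sin (t / 2) ^+ 2.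
    rewrite {1}(splitr t) cosD -!expr2 cos2sin2; ring.
  rewrite (_ : sin t ^+ 2 = 1 - cos t ^+ 2); last by rewrite -h; ring.
  by rewrite h2; ring.
rewrite -[leRHS]real_normK ?num_real// normr_id -[leLHS]real_normK ?num_real//.
rewrite ler_sqr ?nnegrE// normrM ger0_norm//.
rewrite (_ : `|t| = 2 * `|t / 2|) ?ler_pM2l ?abs_sin_le//.
by rewrite normrM (ger0_norm (_ : 0 <= 2^-1)) ?invr_ge0// mulrCA mulfV ?mulr1.
Qed.

End complex_basics.

Arguments normc : simpl never.

(** * Winding numbers on a grid *)

Section winding.
Context {R : realType}.
Implicit Types (z w : R[i]).

(** The principal argument on the half-plane [Re z > 0], for which alone it is meant. *)
Definition angle z : R := atan (complex.Im z / complex.Re z).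

Lemma angle_bound z : - (pi / 2) < angle z < pi / 2.
Proof. by rewrite /angle atan_gtNpi2 atan_ltpi2. Qed.

Lemma cis_angle z : 0 < complex.Re z -> z = (normc z)%:C%C * cis (angle z).
Proof.
move=> z0; set t := angle z.
have ct : 0 < cos t by apply: cos_gt0_pihalf; exact: angle_bound.
have tt : sin t = cos t * (complex.Im z / complex.Re z).
  rewrite -[complex.Im z / _]atanK -/(angle z) -/t /tan.
  by rewrite mulrCA mulfV ?mulr1 ?gt_eqF.
have n0 : 0 < normc z by rewrite (lt_le_trans z0)// (le_trans _ (abs_Re_le z))// ler_norm.
have cE : cos t = complex.Re z / normc z.
  apply/eqP; rewrite -(@eqrXn2 _ 2) ?ltW ?divr_gt0//.
  have := cos2Dsin2 t; rewrite tt => h; apply/eqP.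
  have := sqr_normcE z => nE.
  have h1 : cos t ^+ 2 * normc z ^+ 2 = complex.Re z ^+ 2.
    by rewrite nE -[RHS]mul1r -h; field; rewrite gt_eqF.
  by rewrite expr_div_n -h1 mulfK// expf_neq0// gt_eqF.
have sE : sin t = complex.Im z / normc z.
  by rewrite tt cE; field; rewrite !gt_eqF.
by apply: complex_ext; rewrite !ReImE /= cE sE; field; rewrite gt_eqF.
Qed.

(** Identities between angles hold a priori modulo full turns; this removes the ambiguity once both
    sides differ by less than one turn. *)
Lemma cis_eq1 (t : R) : cis t = 1 -> `|t| < pi *+ 2 -> t = 0.
Proof.
move=> [ct st] tpi; apply: contrapT => /eqP t0; suff: cos t <> 1 by []; move=> {ct}.
wlog t1 : t {st} tpi t0 / 0 < t.
  move=> h; have [/h|t1|/eqP] := ltgtP 0 t; [exact| |by rewrite eq_sym (negPf t0)].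
  by rewrite -cosN; apply: h; rewrite ?normrN ?oppr_eq0 ?oppr_gt0.
(* Now [t / 2] lies strictly between 0 and [pi], and [cos t = 1 - 2 sin (t / 2) ^ 2 < 1]. *)
have : 0 < sin (t / 2).
  apply: sin_gt0_pi; rewrite divr_gt0//= ltr_pdivrMr// mulr_natr.
  by rewrite (le_lt_trans (ler_norm _)).
move=> s0; rewrite {1}(splitr t) cosD -!expr2 cos2sin2 => h.
by have s2 : 0 < sin (t / 2) ^+ 2; [exact: exprn_gt0|lra].
Qed.

(** The quotient [w / z] is at distance less than 1 from 1, so it stays in the half-plane where
    [angle] is the argument. *)
Lemma Re_ratio_gt0 (a : R) z w : 0 < a -> a <= normc z ->
  normc (w - z) < a -> 0 < complex.Re (w / z).
Proof.
move=> a0 az wz.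
have n0 : 0 < normc z by exact: lt_le_trans az.
have z0 : z != 0 by apply: contraTneq n0 => ->; rewrite normc0 ltxx.
have : normc (w / z - 1) < 1.
  rewrite (_ : w / z - 1 = (w - z) / z); last by rewrite mulrBl divff.
  by rewrite normcM normcV ltr_pdivrMr// mul1r (lt_le_trans wz).
move=> h; have := le_lt_trans (abs_Re_le _) h; rewrite !ReImE /=.
by rewrite ltr_norml => /andP[]; lra.
Qed.

(** Each angle is less than a quarter turn, so the two sums differ by less than a full turn. The
    four numbers will be the ratios along the edges of a grid cell. *)
Lemma angle_sum4 z1 z2 z3 z4 : 0 < complex.Re z1 -> 0 < complex.Re z2 ->
  0 < complex.Re z3 -> 0 < complex.Re z4 -> z1 * z2 = z3 * z4 ->
  angle z1 + angle z2 = angle z3 + angle z4.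
Proof.
move=> h1 h2 h3 h4 e; apply/eqP; rewrite -subr_eq0; apply/eqP.
have n0 z : 0 < complex.Re z -> 0 < normc z.
  by move=> z0; rewrite (lt_le_trans z0)// (le_trans _ (abs_Re_le z))// ler_norm.
have rc0 (x : R) : x%:C%C = 0 -> x = 0 by case.
apply: cis_eq1; last first.
  have := angle_bound z1; have := angle_bound z2; have := angle_bound z3.
  have := angle_bound z4; rewrite ltr_norml [pi *+ 2]mulr2n.
  by move=> /andP[? ?] /andP[? ?] /andP[? ?] /andP[? ?]; apply/andP; split; lra.
have ne : normc z1 * normc z2 = normc z3 * normc z4 by rewrite -!normcM e.
have E a b : 0 < complex.Re a -> 0 < complex.Re b ->
    (normc a * normc b)%:C%C * cis (angle a + angle b) = a * b.
  by move=> a0 b0; rewrite rmorphM cisD mulrACA -!cis_angle.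
have nz : (normc z3 * normc z4)%:C%C != 0 :> R[i].
  by apply/eqP => /rc0/eqP; rewrite mulf_eq0 !gt_eqF ?n0.
have /(mulfI nz) c12 : (normc z3 * normc z4)%:C%C * cis (angle z1 + angle z2) =
    (normc z3 * normc z4)%:C%C * cis (angle z3 + angle z4).
  by rewrite -{1}ne !E.
by rewrite cisD cisN c12 mul_conjc normc_cis expr1n.
Qed.

Lemma angleM_cis (t : R) z : 0 < complex.Re z -> 0 < complex.Re (cis t * z) ->
  0 <= t -> t < pi -> angle (cis t * z) = t + angle z.
Proof.
move=> h1 h2 t0 tpi; apply/eqP; rewrite -subr_eq0; apply/eqP.
have n0 : normc z != 0.
  by rewrite gt_eqF// (lt_le_trans h1)// (le_trans _ (abs_Re_le z))// ler_norm.
apply: cis_eq1; last first.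
  have := angle_bound z; have := angle_bound (cis t * z).
  rewrite ltr_norml [pi *+ 2]mulr2n.
  by move=> /andP[? ?] /andP[? ?]; apply/andP; split; lra.
have := cis_angle h2; rewrite {1}(cis_angle h1) mulrCA normcM normc_cis mul1r -cisD.
move=> /mulfI e; rewrite cisD cisN -e ?mul_conjc ?normc_cis ?expr1n//.
by apply/eqP => -[] /eqP; rewrite (negPf n0).
Qed.

(* The winding number of the loop [i |-> F j i] does not depend on [j], since
   neighbouring rows stay close, while quasi-periodicity forces it to increase
   by one between the rows [0] and [K]. *)
Lemma quasi_periodic_grid_jump (a y : R) (K N : nat) (F : nat -> nat -> R[i]) :
  0 < a -> (4 <= N)%N ->
  (forall j i, (j <= K)%N -> (i <= N)%N -> a <= normc (F j i)) ->
  (forall j, (j <= K)%N -> F j N = F j 0%N) ->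
  (forall i, (i <= N)%N -> F K i = cis (2 * pi * (y + i%:R / N%:R)) * F 0%N i) ->
  ~ ((forall j i, (j < K)%N -> (i <= N)%N -> normc (F j.+1 i - F j i) < a) /\
     (forall j i, (j <= K)%N -> (i < N)%N -> normc (F j i.+1 - F j i) < a)).
Proof.
move=> a0 N4 aF FN FK [hx hy].
have F0 j i : (j <= K)%N -> (i <= N)%N -> F j i != 0.
  move=> jK iN; apply: contraTneq (aF j i jK iN) => ->.
  by rewrite normc0 -ltNge.
pose w j := \sum_(i < N) angle (F j i.+1 / F j i).
have wS j : (j < K)%N -> w j.+1 = w j.
  move=> jK; pose p i := angle (F j.+1 i / F j i).
  (* The two paths from [F j i] to [F j.+1 i.+1] around a grid cell. *)
  have step (i : 'I_N) : angle (F j.+1 i.+1 / F j.+1 i) + p i =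
      angle (F j i.+1 / F j i) + p i.+1.
    have iN := ltn_ord i; have iN' := ltnW iN; have jK' := ltnW jK.
    apply: angle_sum4.
    - by apply: (Re_ratio_gt0 a0); rewrite ?aF ?hy.
    - by apply: (Re_ratio_gt0 a0); rewrite ?aF ?hx.
    - by apply: (Re_ratio_gt0 a0); rewrite ?aF ?hy.
    - by apply: (Re_ratio_gt0 a0); rewrite ?aF ?hx.
    - by field; rewrite !F0.
  have : w j.+1 + \sum_(i < N) p i = w j + \sum_(i < N) p i.+1.
    by rewrite /w -!big_split/=; apply: eq_bigr => i _; exact: step.
  (* The rows are closed loops, so [p N = p 0]. *)
  have : \sum_(i < N) p i = \sum_(i < N) p i.+1.
    case: N N4 FN {w step aF FK hx hy F0} => // N _ FN.
    rewrite big_ord_recl big_ord_recr/= addrC; congr (_ + _).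
    by rewrite /p !FN ?(ltnW jK).
  by move=> -> /addIr.
have wK : w K = w 0%N.
  have : forall j, (j <= K)%N -> w j = w 0%N.
    by elim=> // j ih jK; rewrite wS// ih// ltnW.
  exact.
have N0 : N%:R != 0 :> R by rewrite pnatr_eq0 -lt0n; exact: leq_trans N4.
(* Each step along row [K] turns by [2 pi / N] more than along row [0]; this is less than [pi]
   because [4 <= N], so that [angleM_cis] applies. *)
have ratio (i : 'I_N) : F K i.+1 / F K i =
    cis (2 * pi / N%:R) * (F 0%N i.+1 / F 0%N i).
  have iN := ltn_ord i; have iN' := ltnW iN.
  rewrite !FK// (_ : _ * (y + i.+1%:R / _) =
     2 * pi / N%:R + 2 * pi * (y + i%:R / N%:R)).
    by rewrite cisD; field; rewrite F0// cis_neq0.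
  by rewrite -[i.+1]addn1 natrD; field.
have : w K = 2 * pi + w 0%N.
  rewrite (_ : 2 * pi = \sum_(i < N) (2 * pi / N%:R)).
    rewrite /w -big_split/=; apply: eq_bigr => i _.
    have iN := ltn_ord i; have iN' := ltnW iN.
    rewrite ratio; apply: angleM_cis.
    - by apply: (Re_ratio_gt0 a0); rewrite ?aF ?hy.
    - by rewrite -ratio; apply: (Re_ratio_gt0 a0); rewrite ?aF ?hy.
    - by rewrite divr_ge0// mulr_ge0// pi_ge0.
    - rewrite ltr_pdivrMr ?ltr0n ?(leq_trans _ N4)// mulrC ltr_pM2l ?pi_gt0//.
      by rewrite ltr_nat (leq_trans _ N4).
  by rewrite sumr_const card_ord -[RHS]mulr_natr divfK.
by rewrite wK; have := pi_gt0 R; lra.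
Qed.

End winding.

(** * A discrete low-pass kernel *)

Section discrete_kernel.
Context {R : realType}.
Variables Q N : nat.
Hypothesis Q0 : (0 < Q)%N.

Let Qr0 : Q%:R != 0 :> R.
Proof. by rewrite pnatr_eq0 -lt0n. Qed.

Lemma root_unity_sum (m : int) :
  \sum_(q < Q) cis (2 * pi * (m%:~R * q%:R / Q%:R)) =
  (Q%:R * (Q %| m)%Z%:R) :> R[i].
Proof.
pose z : R[i] := cis (2 * pi * (m%:~R / Q%:R)).
have -> : \sum_(q < Q) cis (2 * pi * (m%:~R * q%:R / Q%:R)) = \sum_(q < Q) z ^+ q.
  by apply: eq_bigr => q _; rewrite cisX; congr cis; ring.
have zQ : z ^+ Q = 1.
  by rewrite cisX -[RHS](cis_int m); congr cis; field.
have [z1|z1] := eqVneq z 1.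
  rewrite z1; under eq_bigr do rewrite expr1n.
  rewrite sumr_const card_ord; case: (boolP (Q %| m)%Z) => [_|Qm]; first by rewrite mulr1.
  (* Otherwise [2 pi (m mod Q) / Q] would be an angle strictly between 0 and a full turn at which
     [cis] is 1. *)
  exfalso; move: z1; rewrite /z {1}(divz_eq m Q) rmorphD rmorphM/= -[Q%:~R]/(Q%:R).
  rewrite [X in cis (_ * X)]mulrDl mulfK// mulrDr cisD cis_int mul1r => /cis_eq1 e.
  have Qz : Q%:Z != 0 by rewrite eqz_nat -lt0n.
  have r0 : 0 < (m %% Q)%Z.
    by rewrite lt_neqAle modz_ge0// andbT eq_sym; apply: contraNneq Qm => h; apply/dvdz_mod0P.
  have rQ : (m %% Q)%Z < Q by rewrite ltz_pmod// ltz_nat.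
  have Qp : 0 < Q%:R :> R by rewrite ltr0n.
  have x0 : 0 < 2 * pi * ((m %% Q)%Z%:~R / Q%:R) :> R.
    by rewrite !mulr_gt0 ?invr_gt0 ?pi_gt0 ?ltr0z.
  move: (x0); rewrite e ?ltxx//.
  have -> : pi *+ 2 = 2 * pi * 1 :> R by rewrite mulr1 mulr_natl.
  rewrite gtr0_norm// ltr_pM2l ?mulr_gt0 ?pi_gt0//.
  by rewrite ltr_pdivrMr// mul1r -[Q%:R]/(Q%:~R) ltr_int.
have : (z - 1) * \sum_(q < Q) z ^+ q = 0 by rewrite -subrX1 zQ subrr.
move=> /eqP; rewrite mulf_eq0 subr_eq0 (negPf z1)/= => /eqP ->.
case: (boolP (Q %| m)%Z) => [/dvdzP[k mk]|_]; last by rewrite mulr0.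
exfalso; move/eqP: z1; apply; rewrite /z mk rmorphM/= -[Q%:~R]/(Q%:R) mulfK//.
exact: cis_int.
Qed.

(** [n <= Q] keeps the frequencies distinct modulo [Q]; the common shift [s] cancels in each product
    of a term with a conjugate one. *)
Lemma discrete_parseval (n : nat) (c : nat -> R[i]) (s : R) : (n <= Q)%N ->
  \sum_(q < Q) normc (\sum_(j < n) c j * cis (2 * pi * ((j%:R + s) * q%:R / Q%:R))) ^+ 2 =
  Q%:R * \sum_(j < n) normc (c j) ^+ 2.
Proof.
move=> nQ; apply: (@complexI R); rewrite rmorphM !rmorph_sum/= rmorph_nat.
under eq_bigr => q _.
  rewrite sqr_normc_sum.
  under eq_bigr => i _.
    under eq_bigr => j _.
      rewrite conjcM -cisN mulrACA -cisD.
      rewrite (_ : _ + - _ = 2 * pi * ((i%:Z - j%:Z)%:~R * q%:R / Q%:R)); last first.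
        by rewrite rmorphB/= -!pmulrn; ring.
      over.
    over.
  over.
rewrite exchange_big/=.
rewrite mulr_sumr; apply: eq_bigr => i _.
rewrite exchange_big/= (bigD1 i)//= [X in _ + X]big1 => [|j ji].
  rewrite addr0 -mulr_sumr root_unity_sum subrr dvdz0 mulr1 mul_conjc mulrC.
  by [].
rewrite -mulr_sumr root_unity_sum.
case: (boolP (Q %| _)%Z) => [d|_]; last by rewrite !mulr0.
exfalso; move: d; rewrite dvdzE/= => d.
have ji' : `|i - j|%N != 0%N.
  by rewrite absz_eq0 subr_eq0 eqz_nat; apply: contra ji => /eqP e; apply/eqP/val_inj.
move: d; rewrite gtnNdvd ?lt0n//.
have := ltn_ord i; have := ltn_ord j; lia.
Qed.

(* De la Vallee Poussin type kernel: the convolution of the indicator functions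
   of [[-N, 2N)] and [(-N, 0]], divided by [N], is one on [[-N, N]]; it is here
   the family of frequencies, all shifted by [s], and time is sampled at [q/Q]. *)
Definition vdp (s : R) (q : nat) : R[i] :=
  (N%:R^-1)%:C%C * \sum_(i < N) \sum_(j < 3 * N)
    cis (2 * pi * ((j%:R - N%:R - i%:R + s) * q%:R / Q%:R)).

(** The Fourier multiplier of the kernel. Sampling at [q / Q] sees frequencies only modulo [Q], so
    the convolution of the two indicators is counted modulo [Q]. *)
Definition vdp_mult (n : int) : R :=
  N%:R^-1 * \sum_(i < N) \sum_(j < 3 * N) (Q %| j%:Z - N%:Z - i%:Z - n)%Z%:R.

Lemma vdpP (s : R) (n : int) :
  (Q%:R^-1)%:C%C * \sum_(q < Q) vdp s q * cis (- (2 * pi * ((n%:~R + s) * q%:R / Q%:R)))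
  = (vdp_mult n)%:C%C.
Proof.
under eq_bigr => q _.
  rewrite /vdp -mulrA mulr_suml.
  under eq_bigr => i _.
    rewrite mulr_suml.
    under eq_bigr => j _.
      rewrite -cisD (_ : _ + - _ =
         2 * pi * ((j%:Z - N%:Z - i%:Z - n)%:~R * q%:R / Q%:R)); last first.
        by rewrite !rmorphB/= -!pmulrn; ring.
      over.
    over.
  over.
rewrite -mulr_sumr mulrCA /vdp_mult rmorphM/= rmorph_sum/=; congr (_ * _).
rewrite exchange_big/= mulr_sumr; apply: eq_bigr => i _.
rewrite exchange_big/= mulr_sumr rmorph_sum/=; apply: eq_bigr => j _.
rewrite root_unity_sum mulrA -[(Q%:R : R[i])](rmorph_nat (real_complex R)).
by rewrite -rmorphM/= mulVf// mul1r rmorph_nat.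
Qed.

Hypothesis N0 : (0 < N)%N.
Hypothesis NQ : (3 * N <= Q)%N.

Lemma dvdz_small (m : int) : (Q %| m)%Z -> (`|m| < Q)%N -> m = 0.
Proof.
rewrite dvdzE/= => d h; apply/eqP; rewrite -absz_eq0; apply/eqP.
by case: (posnP `|m|%N) => // m0; move: d; rewrite gtnNdvd.
Qed.

Lemma vdp_mult_ge0 n : 0 <= vdp_mult n.
Proof. by rewrite mulr_ge0 ?invr_ge0// sumr_ge0// => i _; rewrite sumr_ge0. Qed.

(** As [3 N <= Q], an interval of [3 N] consecutive integers meets a residue class modulo [Q] at
    most once. *)
Lemma vdp_mult_inner (n : int) (i : 'I_N) :
  \sum_(j < 3 * N) (Q %| j%:Z - N%:Z - i%:Z - n)%Z%:R <= 1 :> R.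
Proof.
have [[j0 j0P]|h] := pselect (exists j : 'I_(3 * N), (Q %| j%:Z - N%:Z - i%:Z - n)%Z).
  rewrite (bigD1 j0)//= [X in _ + X]big1 ?addr0 ?lern1 ?leq_b1// => j jj0.
  case: (boolP (Q %| _)%Z) => // jP; exfalso; move/eqP: jj0; apply; apply: val_inj => /=.
  have := rpredB j0P jP.
  move/dvdz_small => e; have := ltn_ord j; have := ltn_ord j0; lia.
rewrite big1 ?ler01// => j _; case: (boolP (Q %| _)%Z) => // jP.
by exfalso; apply: h; exists j.
Qed.

Lemma vdp_mult_le1 n : vdp_mult n <= 1.
Proof.
rewrite /vdp_mult -ler_pdivlMl ?invr_gt0 ?ltr0n// invrK mulr1.
rewrite (le_trans (ler_sum _ (fun i _ => vdp_mult_inner n i)))//.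
by rewrite sumr_const card_ord.
Qed.

Lemma vdp_mult1 (n : int) : (`|n| <= N)%N -> vdp_mult n = 1.
Proof.
move=> nN; apply/eqP; rewrite eq_le vdp_mult_le1 /vdp_mult -ler_pdivrMl ?invr_gt0 ?ltr0n//.
rewrite invrK mulr1.
rewrite (le_trans _ (ler_sum _ (_ : forall i : 'I_N, true -> 1 <= _)))//.
  by rewrite sumr_const card_ord.
move=> i _.
(* The index of the frequency [i + n], which lies in [[-N, 2N)]. *)
have jP : (absz (N%:Z + i%:Z + n)%R < 3 * N)%N by have := ltn_ord i; lia.
rewrite (bigD1 (Ordinal jP))//= (_ : _ - _ = 0); last by have := ltn_ord i; lia.
by rewrite dvdz0 lerDl sumr_ge0.
Qed.

Let Np : 0 < N%:R :> R. Proof. by rewrite ltr0n. Qed.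
Let Qp : 0 < Q%:R :> R. Proof. by rewrite ltr0n. Qed.

(** The kernel factors into two Dirichlet sums, of lengths [N] and [3 N]. Their mean squares are
    known from Parseval, which bounds the variation of the product without a logarithmic loss. *)
Let dirA (q : nat) : R[i] :=
  \sum_(i < N) cis (2 * pi * ((i%:R + 0) * q%:R / Q%:R)).
Let dirB (s : R) (q : nat) : R[i] :=
  \sum_(j < 3 * N) cis (2 * pi * ((j%:R + (s - N%:R)) * q%:R / Q%:R)).

Let vdpE s q : vdp s q = (N%:R^-1)%:C%C * (((dirA q)^*)%C * dirB s q).
Proof.
rewrite /vdp /dirA /dirB conjc_sum mulr_suml; congr (_ * _).
apply: eq_bigr => i _; rewrite mulr_sumr; apply: eq_bigr => j _.
by rewrite -cisN -cisD; congr cis; ring.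
Qed.

Lemma vdp_period s : vdp s Q = cis (2 * pi * s) * vdp s 0.
Proof.
rewrite /vdp mulrCA; congr (_ * _); rewrite mulr_sumr; apply: eq_bigr => i _.
rewrite mulr_sumr; apply: eq_bigr => j _.
rewrite mulr0 mul0r mulr0 cis0 mulr1 mulfK// mulrDr cisD.
by rewrite -[N%:R]/(N%:~R) -[i%:R]/(i%:~R) -[j%:R]/(j%:~R) -!rmorphB/= cis_int mul1r.
Qed.

Let pi4 : pi < 4 :> R. Proof. by have := @pihalf_lt2 R; lra. Qed.

(** A time step multiplies the coefficient at frequency [j + t] by a phase, which moves it by at
    most [2 pi h / Q <= 8 h / Q]; Parseval does the rest. *)
Let dir_diff (n : nat) (t : R) (h : R) : (n <= Q)%N -> 0 <= h ->
  (forall j, (j < n)%N -> `|j%:R + t| <= h) ->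
  \sum_(q < Q) normc (\sum_(j < n) cis (2 * pi * ((j%:R + t) * q.+1%:R / Q%:R))
     - \sum_(j < n) cis (2 * pi * ((j%:R + t) * q%:R / Q%:R))) ^+ 2 <=
  n%:R * (8 * h) ^+ 2 / Q%:R.
Proof.
move=> nQ h0 jh.
pose c (j : nat) : R[i] := cis (2 * pi * ((j%:R + t) / Q%:R)) - 1.
under eq_bigr => q _.
  rewrite -sumrB.
  under eq_bigr => j _.
    rewrite (_ : _ - _ = c j * cis (2 * pi * ((j%:R + t) * q%:R / Q%:R))); last first.
      rewrite /c mulrBl mul1r -cisD; congr (cis _ - _).
      by rewrite -[q.+1]addn1 natrD; ring.
    over.
  over.
rewrite discrete_parseval//.
rewrite -ler_pdivlMl// (le_trans (y := \sum_(j < n) (8 * h / Q%:R) ^+ 2))//; last first.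
  by rewrite sumr_const card_ord -mulr_natl le_eqVlt; apply/orP; left; apply/eqP; field.
apply: ler_sum => j _; rewrite ler_sqr ?nnegrE ?normc_ge0//; last first.
  by rewrite divr_ge0// mulr_ge0.
rewrite (le_trans (normc_cis_sub1_le _))// !normrM [X in _ * (_ * X)]ger0_norm ?invr_ge0//.
rewrite mulrA ler_pM2r ?invr_gt0// ler_pM ?mulr_ge0 ?jh//.
rewrite !ger0_norm ?pi_ge0//; move: pi4; lra.
Qed.

(** Shifting time only changes the phases of the coefficients, which Parseval does not see. *)
Let dirA_le q0 : (q0 = 0 \/ q0 = 1)%N ->
  \sum_(q < Q) normc (dirA (q + q0)) ^+ 2 <= N%:R * Q%:R.
Proof.
move=> _; under eq_bigr => q _.
  rewrite /dirA; under eq_bigr => i _.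
    rewrite (_ : cis _ = cis (2 * pi * (i%:R * q0%:R / Q%:R)) *
       cis (2 * pi * ((i%:R + 0) * q%:R / Q%:R))); last first.
      by rewrite -cisD; congr cis; rewrite natrD; ring.
    over.
  over.
rewrite (@discrete_parseval N (fun i => cis (2 * pi * (i%:R * q0%:R / Q%:R)))); last lia.
under eq_bigr do rewrite normc_cis expr1n.
by rewrite sumr_const card_ord mulrC.
Qed.

Let dirB_le s q0 : (q0 = 0 \/ q0 = 1)%N ->
  \sum_(q < Q) normc (dirB s (q + q0)) ^+ 2 <= 3 * N%:R * Q%:R.
Proof.
move=> _; under eq_bigr => q _.
  rewrite /dirB; under eq_bigr => i _.
    rewrite (_ : cis _ = cis (2 * pi * ((i%:R + (s - N%:R)) * q0%:R / Q%:R)) *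
       cis (2 * pi * ((i%:R + (s - N%:R)) * q%:R / Q%:R))); last first.
      by rewrite -cisD; congr cis; rewrite natrD; ring.
    over.
  over.
rewrite (@discrete_parseval (3 * N)
  (fun i => cis (2 * pi * ((i%:R + (s - N%:R)) * q0%:R / Q%:R))))//.
under eq_bigr do rewrite normc_cis expr1n.
by rewrite sumr_const card_ord mulrC natrM.
Qed.

Let amgm (t u v : R) : 0 < t -> u * v <= (t * u ^+ 2 + t^-1 * v ^+ 2) / 2.
Proof.
move=> t0; rewrite -subr_ge0.
rewrite (_ : _ - _ = t^-1 / 2 * (t * u - v) ^+ 2); last by field; rewrite gt_eqF.
by rewrite mulr_ge0 ?sqr_ge0// divr_ge0// invr_ge0 ltW.
Qed.

(** The product rule for differences puts the increment on one Dirichlet sum at a time; each product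
    is then split by [amgm], a weighted form of the Cauchy-Schwarz inequality. *)
Lemma vdp_variation s : 0 <= s <= 1 ->
  \sum_(q < Q) normc (vdp s q.+1 - vdp s q) <= 64 * N%:R.
Proof.
move=> /andP[s0 s1].
pose dA (q : nat) := normc (dirA q.+1 - dirA q).
pose dB (q : nat) := normc (dirB s q.+1 - dirB s q).
have hA : \sum_(q < Q) dA q ^+ 2 <= N%:R * (8 * N%:R) ^+ 2 / Q%:R.
  apply: dir_diff; rewrite ?ler0n//; first lia.
  by move=> j jN; rewrite addr0 ger0_norm// ler_nat ltnW.
have hB : \sum_(q < Q) dB q ^+ 2 <= (3 * N)%:R * (8 * (3 * N%:R)) ^+ 2 / Q%:R.
  apply: dir_diff; rewrite ?mulr_ge0//.
  move=> j; rewrite -(ltr_nat R) natrM => jN.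
  have N1 : 1 <= N%:R :> R by rewrite ler1n.
  have j0 : 0 <= j%:R :> R by [].
  by rewrite ler_norml; apply/andP; split; lra.
(* With these weights the four sums over [q] are at most 8, 24, 24 and 72 times [N ^ 2], and half of
   their total is [64 N ^ 2]. *)
have step (q : 'I_Q) : normc (vdp s q.+1 - vdp s q) <=
   N%:R^-1 * (((Q%:R / (8 * N%:R)) * dA q ^+ 2 +
                 (Q%:R / (8 * N%:R))^-1 * normc (dirB s (q + 1)) ^+ 2) / 2 +
              ((24 * N%:R / Q%:R) * normc (dirA (q + 0)) ^+ 2 +
                 (24 * N%:R / Q%:R)^-1 * dB q ^+ 2) / 2).
  rewrite !vdpE -mulrBr normcM normc_real ger0_norm ?invr_ge0//.
  rewrite ler_pM2l ?invr_gt0// addn1 addn0.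
  rewrite (_ : _ - _ = ((dirA q.+1 - dirA q)^*)%C * dirB s q.+1 +
     ((dirA q)^*)%C * (dirB s q.+1 - dirB s q)); last by rewrite conjcB; ring.
  rewrite (le_trans (normcD _ _))// !normcM !normc_conj.
  by rewrite lerD// amgm// ?divr_gt0 ?mulr_gt0.
rewrite (le_trans (ler_sum _ (fun q _ => step q)))//.
rewrite -mulr_sumr big_split/= -!mulr_suml !big_split/= -!mulr_sumr.
have hA1 := dirA_le (or_introl erefl); have hB1 := dirB_le s (or_intror erefl).
rewrite -ler_pdivlMl ?invr_gt0// invrK.
have e1 : Q%:R / (8 * N%:R) * \sum_(i < Q) dA i ^+ 2 <= 8 * N%:R ^+ 2.
  rewrite -ler_pdivlMl ?divr_gt0 ?mulr_gt0//.
  by rewrite (le_trans hA)// le_eqVlt; apply/orP; left; apply/eqP; field; rewrite ?pnatr_eq0 -?lt0n ?N0.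
have e2 : (Q%:R / (8 * N%:R))^-1 * \sum_(i < Q) normc (dirB s (i + 1)) ^+ 2 <= 24 * N%:R ^+ 2.
  rewrite -ler_pdivlMl ?invr_gt0 ?divr_gt0 ?mulr_gt0// invrK.
  by rewrite (le_trans hB1)// le_eqVlt; apply/orP; left; apply/eqP; field; rewrite ?pnatr_eq0 -?lt0n ?N0.
have e3 : 24 * N%:R / Q%:R * \sum_(i < Q) normc (dirA (i + 0)) ^+ 2 <= 24 * N%:R ^+ 2.
  rewrite -ler_pdivlMl ?divr_gt0 ?mulr_gt0//.
  by rewrite (le_trans hA1)// le_eqVlt; apply/orP; left; apply/eqP; field; rewrite ?pnatr_eq0 -?lt0n ?N0 ?Q0.
have e4 : (24 * N%:R / Q%:R)^-1 * \sum_(i < Q) dB i ^+ 2 <= 72 * N%:R ^+ 2.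
  rewrite -ler_pdivlMl ?invr_gt0 ?divr_gt0 ?mulr_gt0// invrK.
  by rewrite (le_trans hB)// natrM le_eqVlt; apply/orP; left; apply/eqP; field; rewrite ?pnatr_eq0 -?lt0n ?N0 ?Q0.
move: e1 e2 e3 e4; lra.
Qed.

(** Summation by parts: the increment passes from [F], of which only a bound is known, to the
    kernel, whose total variation is [O(N)]. *)
Lemma vdp_smooth_step (s b : R) (F : nat -> R[i]) : 0 <= s <= 1 ->
  (forall q, (q <= Q)%N -> normc (F q) <= b) ->
  F Q = cis (- (2 * pi * s)) * F 0%N ->
  normc ((Q%:R^-1)%:C%C * (\sum_(q < Q) vdp s q * F q)
       - (Q%:R^-1)%:C%C * (\sum_(q < Q) vdp s q * F q.+1)) <= 64 * b * N%:R / Q%:R.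
Proof.
move=> s01 Fb FQ; rewrite -mulrBr normcM normc_real ger0_norm ?invr_ge0//.
rewrite mulrC ler_pM2r ?invr_gt0//.
(* Over one period the boundary terms agree, since the phases [cis (2 pi s)] of the kernel and
   [cis (- (2 pi s))] of [F] cancel. *)
have -> : \sum_(q < Q) vdp s q * F q = \sum_(q < Q) vdp s q.+1 * F q.+1.
  have e : vdp s 0 * F 0%N = vdp s Q * F Q.
    rewrite FQ vdp_period mulrACA -cisD subrr cis0 mul1r //.
  have : \sum_(q < Q) vdp s q * F q + vdp s Q * F Q =
      vdp s 0 * F 0%N + \sum_(q < Q) vdp s q.+1 * F q.+1.
    transitivity (\sum_(q < Q.+1) vdp s q * F q); first by rewrite big_ord_recr.
    by rewrite big_ord_recl.
  by rewrite e [RHS]addrC => /addIr.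
have b0 : 0 <= b by rewrite (le_trans (normc_ge0 _) (Fb 0%N _)).
rewrite -sumrB (le_trans (normc_sum _ _ _))//.
rewrite (le_trans (y := \sum_(q < Q) normc (vdp s q.+1 - vdp s q) * b))//.
  by apply: ler_sum => q _; rewrite -mulrBl normcM ler_wpM2l ?normc_ge0 ?Fb.
by rewrite -mulr_suml [64 * _]mulrC -mulrA mulrC ler_wpM2l// vdp_variation.
Qed.

End discrete_kernel.

(** * Integrals of complex functions *)

Section complex_integral.
Context d {T : measurableType d} {R : realType}.
Variable mu : {measure set T -> \bar R}.
Implicit Types (F G H : T -> R[i]) (c : R[i]).
Local Notation Re := (@complex.Re R).
Local Notation Im := (@complex.Im R).

Let integrable_scale (r : R) (f : T -> R) : mu.-integrable setT (fun x => (f x)%:E) ->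
  mu.-integrable setT (fun x => (r * f x)%:E).
Proof.
by move=> /(integrableZl measurableT r); apply: eq_integrable.
Qed.

(** Versions over an arbitrary measure of the notions of the statement, to which they unfold for
    Lebesgue measure; the same theory then serves for the unit cube and for the product of two
    cubes. *)
Definition cmeas F : Prop :=
  measurable_fun setT (fun x => Re (F x)) /\ measurable_fun setT (fun x => Im (F x)).

Definition cL1 F : Prop :=
  mu.-integrable setT (fun x => (Re (F x))%:E) /\
  mu.-integrable setT (fun x => (Im (F x))%:E).

Definition cint F : R[i] := ((\int[mu]_x Re (F x)) +i* (\int[mu]_x Im (F x)))%C.

Definition sql2 F : \bar R := (\int[mu]_x ((normc (F x)) ^+ 2)%:E)%E.

Definition cL2 F : Prop := cmeas F /\ (sql2 F < +oo)%E.

(** A real number, for use in algebraic identities; it is faithful under [cL2], as [fine] sends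
    [+oo] to 0. *)
Definition n2 F : R := fine (sql2 F).

Definition ip F G : R[i] := cint (fun x => F x * ((G x)^*)%C).

Lemma cmeas_cst c : cmeas (fun=> c).
Proof. by split; exact: measurable_cst. Qed.

Lemma cmeas_real (f : T -> R) : measurable_fun setT f -> cmeas (fun x => (f x)%:C%C).
Proof. by move=> mf; split=> //=; exact: measurable_cst. Qed.

Lemma cmeasD F G : cmeas F -> cmeas G -> cmeas (fun x => F x + G x).
Proof.
move=> [? ?] [? ?]; split.
- by under eq_fun do rewrite cReD; exact: measurable_funD.
- by under eq_fun do rewrite cImD; exact: measurable_funD.
Qed.

Lemma cmeasN F : cmeas F -> cmeas (fun x => - F x).
Proof.
move=> [? ?]; split.
- by under eq_fun do rewrite cReN; exact: measurable_funN.
- by under eq_fun do rewrite cImN; exact: measurable_funN.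
Qed.

Lemma cmeasB F G : cmeas F -> cmeas G -> cmeas (fun x => F x - G x).
Proof. by move=> mF mG; apply: cmeasD => //; exact: cmeasN. Qed.

Lemma cmeasJ F : cmeas F -> cmeas (fun x => ((F x)^*)%C).
Proof.
move=> [? ?]; split.
- by under eq_fun do rewrite cReJ.
- by under eq_fun do rewrite cImJ; exact: measurable_funN.
Qed.

Lemma cmeasM F G : cmeas F -> cmeas G -> cmeas (fun x => F x * G x).
Proof.
move=> [? ?] [? ?]; split.
- by under eq_fun do rewrite cReM; apply: measurable_funB; exact: measurable_funM.
- by under eq_fun do rewrite cImM; apply: measurable_funD; exact: measurable_funM.
Qed.

Lemma cmeas_sum I (r : seq I) (F : I -> T -> R[i]) :
  (forall i, cmeas (F i)) -> cmeas (fun x => \sum_(i <- r) F i x).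
Proof.
move=> mF; elim: r => [|i r ih].
  by under eq_fun do rewrite big_nil; exact: cmeas_cst.
by under eq_fun do rewrite big_cons; exact: cmeasD.
Qed.

Lemma measurable_sqr_normc F : cmeas F -> measurable_fun setT (fun x => normc (F x) ^+ 2).
Proof.
move=> [mr mi]; under eq_fun do rewrite sqr_normcE.
by apply: measurable_funD; exact: measurable_funX.
Qed.

Lemma measurable_normc F : cmeas F -> measurable_fun setT (fun x => normc (F x)).
Proof.
move=> mF; rewrite (_ : (fun _ => _) = fun x => Num.sqrt (normc (F x) ^+ 2)).
  apply: (measurableT_comp (f := @Num.sqrt R)); last exact: measurable_sqr_normc.
  by apply: continuous_measurable_fun => x; exact: sqrt_continuous.
by apply/funext => x; rewrite sqrtr_sqr ger0_norm ?normc_ge0.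
Qed.

Lemma cmeas_cis (f : T -> R) : measurable_fun setT f -> cmeas (fun x => cis (f x)).
Proof.
move=> mf; split; rewrite /=.
- apply: (measurableT_comp (f := @cos R)) => //.
  by apply: continuous_measurable_fun => x; exact: continuous_cos.
- apply: (measurableT_comp (f := @sin R)) => //.
  by apply: continuous_measurable_fun => x; exact: continuous_sin.
Qed.

Lemma cL1_meas F : cL1 F -> cmeas F.
Proof. by move=> [/measurable_int/measurable_EFinP ? /measurable_int/measurable_EFinP ?]. Qed.

Lemma cL1_bound F (g : T -> R) : cmeas F -> mu.-integrable setT (EFin \o g) ->
  (forall x, normc (F x) <= g x) -> cL1 F.
Proof.
move=> [mr mi] ig Fg; split.
- apply: (le_integrable measurableT _ _ ig); first exact/measurable_EFinP.
  move=> x _; rewrite /= lee_fin (le_trans (abs_Re_le _))//.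
  by rewrite (le_trans (Fg x))// ler_norm.
- apply: (le_integrable measurableT _ _ ig); first exact/measurable_EFinP.
  move=> x _; rewrite /= lee_fin (le_trans (abs_Im_le _))//.
  by rewrite (le_trans (Fg x))// ler_norm.
Qed.

Lemma cL1_normc F : cL1 F -> mu.-integrable setT (fun x => (normc (F x))%:E).
Proof.
move=> L; have [ir ii] := L.
apply: (le_integrable measurableT (g := fun x => (`|Re (F x)| + `|Im (F x)|)%:E)).
- by apply/measurable_EFinP; exact/measurable_normc/cL1_meas.
- move=> x _; rewrite /= lee_fin [leLHS]ger0_norm ?normc_ge0//.
  by rewrite (le_trans (normc_le _))// ler_norm.
- apply: eq_integrable (integrableD measurableT (integrable_abse ir) (integrable_abse ii)) => //.
Qed.

Lemma cL1P F : cmeas F -> (\int[mu]_x (normc (F x))%:E < +oo)%E -> cL1 F.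
Proof.
move=> mF Foo; apply: (@cL1_bound F (fun x => normc (F x))) => //.
apply/integrableP; split; first exact/measurable_EFinP/measurable_normc.
rewrite (eq_integral (fun x => (normc (F x))%:E))// => x _.
by rewrite /= ger0_norm ?normc_ge0.
Qed.

Lemma cL1_cond F G : cmeas F -> (forall x, normc (F x) <= normc (G x)) -> cL1 G -> cL1 F.
Proof. by move=> mF FG /cL1_normc iG; exact: cL1_bound iG FG. Qed.

Lemma cL1D F G : cL1 F -> cL1 G -> cL1 (fun x => F x + G x).
Proof.
move=> [Fr Fi] [Gr Gi]; split.
- by under eq_fun do rewrite cReD EFinD; exact: integrableD.
- by under eq_fun do rewrite cImD EFinD; exact: integrableD.
Qed.

Lemma cL1N F : cL1 F -> cL1 (fun x => - F x).
Proof.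
move=> [Fr Fi]; split.
- by under eq_fun do rewrite cReN EFinN; exact: integrableN.
- by under eq_fun do rewrite cImN EFinN; exact: integrableN.
Qed.

Lemma cL1B F G : cL1 F -> cL1 G -> cL1 (fun x => F x - G x).
Proof. by move=> iF iG; apply: cL1D => //; exact: cL1N. Qed.

Lemma cL1J F : cL1 F -> cL1 (fun x => ((F x)^*)%C).
Proof.
move=> [Fr Fi]; split; first by under eq_fun do rewrite cReJ.
by under eq_fun do rewrite cImJ EFinN; exact: integrableN.
Qed.

Lemma cL1Z c F : cL1 F -> cL1 (fun x => c * F x).
Proof.
move=> [Fr Fi]; split.
- under eq_fun do rewrite cReM EFinB !EFinM.
  by apply: integrableB => //; exact: integrableZl.
- under eq_fun do rewrite cImM EFinD !EFinM.
  by apply: integrableD => //; exact: integrableZl.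
Qed.

Lemma cL1_0 : cL1 (fun=> 0).
Proof. by split; exact: integrable0. Qed.

Lemma cL1_sum I (r : seq I) (F : I -> T -> R[i]) :
  (forall i, cL1 (F i)) -> cL1 (fun x => \sum_(i <- r) F i x).
Proof.
move=> mF; elim: r => [|i r ih].
  by under eq_fun do rewrite big_nil; exact: cL1_0.
by under eq_fun do rewrite big_cons; exact: cL1D.
Qed.

Lemma cintD F G : cL1 F -> cL1 G -> cint (fun x => F x + G x) = cint F + cint G.
Proof.
move=> [Fr Fi] [Gr Gi]; apply: complex_ext; rewrite !ReImE /=.
- by under eq_Rintegral do rewrite cReD; exact: RintegralD.
- by under eq_Rintegral do rewrite cImD; exact: RintegralD.
Qed.

Lemma cintZ c F : cL1 F -> cint (fun x => c * F x) = c * cint F.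
Proof.
move=> [Fr Fi]; apply: complex_ext; rewrite !ReImE /=.
- under eq_Rintegral do rewrite cReM.
  by rewrite RintegralB ?RintegralZl//; exact: integrable_scale.
- under eq_Rintegral do rewrite cImM.
  by rewrite RintegralD ?RintegralZl//; exact: integrable_scale.
Qed.

Lemma cintN F : cL1 F -> cint (fun x => - F x) = - cint F.
Proof.
by move=> iF; rewrite -mulN1r -cintZ//; congr cint; apply/funext => x; rewrite mulN1r.
Qed.

Lemma cintB F G : cL1 F -> cL1 G -> cint (fun x => F x - G x) = cint F - cint G.
Proof. by move=> iF iG; rewrite cintD ?cintN//; exact: cL1N. Qed.

Lemma cintJ F : cL1 F -> cint (fun x => ((F x)^*)%C) = ((cint F)^*)%C.
Proof.
move=> [Fr Fi]; apply: complex_ext; rewrite !ReImE /=.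
- by under eq_Rintegral do rewrite cReJ.
- under eq_Rintegral do rewrite cImJ -mulN1r.
  by rewrite RintegralZl// mulN1r.
Qed.

Lemma cint0 : cint (fun=> 0) = 0.
Proof. by apply: complex_ext; rewrite /= /Rintegral integral0. Qed.

Lemma cint_sum I (r : seq I) (F : I -> T -> R[i]) : (forall i, cL1 (F i)) ->
  cint (fun x => \sum_(i <- r) F i x) = \sum_(i <- r) cint (F i).
Proof.
move=> iF; elim: r => [|i r ih].
  by under eq_fun do rewrite big_nil; rewrite big_nil cint0.
under eq_fun do rewrite big_cons; rewrite big_cons cintD ?ih//.
exact: cL1_sum.
Qed.

Lemma sql2_ge0 F : (0 <= sql2 F)%E.
Proof. by apply: integral_ge0 => x _; rewrite lee_fin sqr_ge0. Qed.

Lemma n2_ge0 F : 0 <= n2 F.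
Proof. by rewrite fine_ge0// sql2_ge0. Qed.

Lemma cL2_meas F : cL2 F -> cmeas F. Proof. by case. Qed.

Lemma sql2E F : cL2 F -> sql2 F = (n2 F)%:E.
Proof. by move=> [_ Foo]; rewrite fineK// ge0_fin_numE// sql2_ge0. Qed.

Lemma cL2_int F : cL2 F -> mu.-integrable setT (fun x => (normc (F x) ^+ 2)%:E).
Proof.
move=> [mF Foo]; apply/integrableP; split.
  exact/measurable_EFinP/measurable_sqr_normc.
rewrite (eq_integral (fun x => (normc (F x) ^+ 2)%:E))// => x _.
by rewrite /= ger0_norm ?sqr_ge0.
Qed.

Lemma cL2_bound F (g : T -> R) : cmeas F -> mu.-integrable setT (EFin \o g) ->
  (forall x, normc (F x) ^+ 2 <= g x) -> cL2 F.
Proof.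
move=> mF /integrableP[mg goo] Fg; split=> //.
apply: le_lt_trans goo; apply: ge0_le_integral => //.
- by move=> x _; rewrite lee_fin sqr_ge0.
- exact/measurable_EFinP/measurable_sqr_normc.
- exact: measurableT_comp.
- by move=> x _; rewrite /= lee_fin (le_trans (Fg x))// ler_norm.
Qed.

Lemma cL2_cond F G : cmeas F -> (forall x, normc (F x) <= normc (G x)) -> cL2 G -> cL2 F.
Proof.
move=> mF FG /cL2_int iG; apply: (cL2_bound mF iG) => x /=.
by rewrite ler_sqr ?nnegrE ?normc_ge0.
Qed.

Lemma cL2D F G : cL2 F -> cL2 G -> cL2 (fun x => F x + G x).
Proof.
move=> LF LG; apply: (@cL2_bound _ (fun x => 2 * normc (F x) ^+ 2 + 2 * normc (G x) ^+ 2)).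
- by apply: cmeasD; exact: cL2_meas.
- apply: eq_integrable (integrableD measurableT
    (integrable_scale 2 (cL2_int LF)) (integrable_scale 2 (cL2_int LG))) => //.
- by move=> x; exact: sqr_normcD_le.
Qed.

Lemma cL2Z c F : cL2 F -> cL2 (fun x => c * F x).
Proof.
move=> LF; apply: (@cL2_bound _ (fun x => normc c ^+ 2 * normc (F x) ^+ 2)).
- by apply: cmeasM; [exact: cmeas_cst|exact: cL2_meas].
- exact: integrable_scale (cL2_int LF).
- by move=> x; rewrite normcM exprMn.
Qed.

Lemma cL2N F : cL2 F -> cL2 (fun x => - F x).
Proof.
by move=> /(@cL2Z (-1)); rewrite (_ : (fun _ => _) = fun x => - F x)//;
  apply/funext => x; rewrite mulN1r.
Qed.

Lemma cL2B F G : cL2 F -> cL2 G -> cL2 (fun x => F x - G x).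
Proof. by move=> LF LG; apply: cL2D => //; exact: cL2N. Qed.

Lemma cL2_0 : cL2 (fun=> 0).
Proof.
split; first exact: cmeas_cst.
by rewrite /sql2 integral0_eq// => x _; rewrite normc0 expr0n.
Qed.

Lemma cL2_sum I (r : seq I) (F : I -> T -> R[i]) :
  (forall i, cL2 (F i)) -> cL2 (fun x => \sum_(i <- r) F i x).
Proof.
move=> mF; elim: r => [|i r ih].
  by under eq_fun do rewrite big_nil; exact: cL2_0.
by under eq_fun do rewrite big_cons; exact: cL2D.
Qed.

Lemma cL2_mul F G : cL2 F -> cL2 G -> cL1 (fun x => F x * ((G x)^*)%C).
Proof.
move=> LF LG; apply: (@cL1_bound _ (fun x => normc (F x) ^+ 2 + normc (G x) ^+ 2)).
- by apply: cmeasM; [|apply: cmeasJ]; exact: cL2_meas.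
- exact: eq_integrable (integrableD measurableT (cL2_int LF) (cL2_int LG)).
- move=> x; rewrite normcM normc_conj.
  by have := sqr_ge0 (normc (F x) - normc (G x));
    have := sqr_ge0 (normc (F x)); have := sqr_ge0 (normc (G x)); nra.
Qed.

Lemma n2E F : n2 F = \int[mu]_x (normc (F x) ^+ 2).
Proof. by []. Qed.

Lemma n2D F G : cL2 F -> cL2 G ->
  n2 (fun x => F x + G x) = n2 F + 2 * Re (ip F G) + n2 G.
Proof.
move=> LF LG; rewrite !n2E; have [iR iI] := cL2_mul LF LG.
have iF := cL2_int LF; have iG := cL2_int LG.
under eq_Rintegral do rewrite sqr_normcD.
have i2 := integrable_scale 2 iR.
rewrite RintegralD//; last exact: eq_integrable (integrableD measurableT iF i2).
by rewrite RintegralD// RintegralZl.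
Qed.

Lemma ipZl c F G : cL2 F -> cL2 G -> ip (fun x => c * F x) G = c * ip F G.
Proof.
move=> LF LG; rewrite /ip -cintZ; last exact: cL2_mul.
by congr cint; apply/funext => x; rewrite mulrA.
Qed.

Lemma ipC F G : cL2 F -> cL2 G -> ip G F = ((ip F G)^*)%C.
Proof.
move=> LF LG; rewrite /ip -cintJ; last exact: cL2_mul.
by congr cint; apply/funext => x; rewrite conjcM conjcK mulrC.
Qed.

Lemma ip_suml I (r : seq I) (F : I -> T -> R[i]) G : (forall i, cL2 (F i)) -> cL2 G ->
  ip (fun x => \sum_(i <- r) F i x) G = \sum_(i <- r) ip (F i) G.
Proof.
move=> LF LG; rewrite /ip -cint_sum; last by move=> i; exact: cL2_mul.
by congr cint; apply/funext => x; rewrite mulr_suml.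
Qed.

Lemma n2B F G : cL2 F -> cL2 G ->
  n2 (fun x => F x - G x) = n2 F - 2 * Re (ip F G) + n2 G.
Proof.
move=> LF LG; have LN := cL2N LG; rewrite n2D// ipC// -/(ip _ _).
have -> : (fun x => - G x) = (fun x => -1 * G x) by apply/funext => x; rewrite mulN1r.
rewrite ipZl// mulN1r cReJ cReN [ip G F]ipC// cReJ mulrN.
congr (_ + _); rewrite !n2E; apply: eq_Rintegral => x _.
by rewrite mulN1r normc_opp.
Qed.

Lemma ip_sumr I (r : seq I) (G : I -> T -> R[i]) F : (forall i, cL2 (G i)) -> cL2 F ->
  ip F (fun x => \sum_(i <- r) G i x) = \sum_(i <- r) ip F (G i).
Proof.
move=> LG LF; rewrite ipC//; last exact: cL2_sum.
by rewrite ip_suml// conjc_sum; apply: eq_bigr => i _; rewrite ipC// conjcK.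
Qed.

Lemma ipZr c F G : cL2 F -> cL2 G -> ip F (fun x => c * G x) = (c^*)%C * ip F G.
Proof.
move=> LF LG; rewrite ipC//; last exact: cL2Z.
by rewrite ipZl// conjcM -ipC.
Qed.

Lemma ipxx F : cL2 F -> ip F F = (n2 F)%:C%C.
Proof.
move=> LF; apply: complex_ext; rewrite /ip /=.
- by rewrite n2E; apply: eq_Rintegral => x _; rewrite mul_conjc.
- rewrite -[RHS](_ : \int[mu]_(x in setT) 0 = 0); last by rewrite /Rintegral integral0.
  by apply: eq_Rintegral => x _; rewrite mul_conjc.
Qed.

Lemma eq_sql2 F G : (forall x, normc (F x) = normc (G x)) -> sql2 F = sql2 G.
Proof. by move=> FG; apply: eq_integral => x _; rewrite FG. Qed.

Lemma sql2_eq0 F : cmeas F -> sql2 F = 0%E -> {ae mu, forall x, F x = 0}.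
Proof.
move=> mF F0; have /ae_eq_integral_abs : measurable_fun setT (fun x => (normc (F x) ^+ 2)%:E).
  exact/measurable_EFinP/measurable_sqr_normc.
move=> /(_ mu measurableT)[+ _] => /(_ _)/= h.
have : (\int[mu]_x `|(normc (F x) ^+ 2)%:E|)%E = 0%E.
  by rewrite -[RHS]F0; apply: eq_integral => x _; rewrite gee0_abs// lee_fin sqr_ge0.
move/h; apply: filterS => x /(_ Logic.I)/= [] /eqP.
by rewrite sqrf_eq0 => /eqP/eq0_normc.
Qed.

Lemma ae_eq_sql2 F G : cmeas F -> cmeas G ->
  {ae mu, forall x, F x = G x} -> sql2 F = sql2 G.
Proof.
move=> mF mG FG; apply: ge0_ae_eq_integral => //.
- exact/measurable_EFinP/measurable_sqr_normc.
- exact/measurable_EFinP/measurable_sqr_normc.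
- by move=> x _; rewrite lee_fin sqr_ge0.
- by move=> x _; rewrite lee_fin sqr_ge0.
- by apply: filterS FG => x -> _.
Qed.

Lemma ae_eq_cint F G : cmeas F -> cmeas G ->
  {ae mu, forall x, F x = G x} -> cint F = cint G.
Proof.
move=> [Fr Fi] [Gr Gi] FG; apply: complex_ext; rewrite /= /Rintegral; congr fine.
- apply: ae_eq_integral => //; try exact/measurable_EFinP.
  by apply: filterS FG => x -> _.
- apply: ae_eq_integral => //; try exact/measurable_EFinP.
  by apply: filterS FG => x -> _.
Qed.

(** The factor of [sql2 F] can be taken as close to 1 as desired, at the expense of a perturbation
    [G] that can be made small afterwards. *)
Lemma sql2_young (e : R) F G : 0 < e -> cmeas F -> cmeas G ->
  (sql2 (fun x => F x + G x)%R <= (1 + e)%:E * sql2 F + (1 + e^-1)%:E * sql2 G)%E.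
Proof.
move=> e0 mF mG.
have e1 : 0 <= e^-1 by rewrite invr_ge0 ltW.
have mF2 := measurable_sqr_normc mF; have mG2 := measurable_sqr_normc mG.
have m1 : measurable_fun setT (fun x => (normc (F x) ^+ 2)%:E) by exact/measurable_EFinP.
have m2 : measurable_fun setT (fun x => (normc (G x) ^+ 2)%:E) by exact/measurable_EFinP.
rewrite /sql2 -!ge0_integralZl//=; try by [rewrite lee_fin addr_ge0// ltW|move=> x _; rewrite lee_fin sqr_ge0].
rewrite -ge0_integralD//; try by
  [move=> x _; rewrite -EFinM lee_fin mulr_ge0 ?sqr_ge0 ?addr_ge0 ?(ltW e0)|
   exact: measurable_funeM].
apply: ge0_le_integral => //.
- by move=> x _; rewrite lee_fin sqr_ge0.
- by apply/measurable_EFinP/measurable_sqr_normc/cmeasD.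
- by apply: emeasurable_funD; exact: measurable_funeM.
- by move=> x _; rewrite -!EFinM -EFinD lee_fin sqr_normcD_young.
Qed.

End complex_integral.

Arguments cint : simpl never.
Arguments ip : simpl never.

(** * Density of trigonometric polynomials *)

Lemma cvge_eventually_lt (R : realType) (u : nat -> \bar R) : u @ \oo --> 0%E ->
  forall e : R, 0 < e -> \forall n \near \oo, (u n < e%:E)%E.
Proof.
move=> /fine_cvgP[fu /cvgrPdist_lt cu] e e0.
near=> n; have fn : u n \is a fin_num by near: n.
rewrite -(fineK fn) lte_fin (le_lt_trans (ler_norm _))//.
have : `|0 - fine (u n)| < e by near: n; exact: cu.
by rewrite sub0r normrN.
Unshelve. all: by end_near. Qed.

Section sign_approximation.
Context {R : realType}.

(* Newton's iteration for the sign function. *)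
Fixpoint sgn_iter (n : nat) (r : R) : R :=
  if n is m.+1 then sgn_iter m r * (3 - sgn_iter m r ^+ 2) / 2 else r.

(** The squared factor makes the limit at [r = 0] equal to 0 instead of 1/2, so that the limit is
    the indicator of [0 < r]. As a polynomial in [r], it stays in any algebra that contains [r] and
    the constants. *)
Definition step_iter (n : nat) (r : R) : R := (1 + sgn_iter n r) / 2 * sgn_iter n r ^+ 2.

Lemma sgn_iter_bound n r : `|r| <= 1 -> `|sgn_iter n r| <= 1.
Proof.
move=> r1; elim: n => //= n; set s := sgn_iter n r; rewrite !ler_norml => /andP[s1 s2].
(* These are twice the distances of the next iterate from [-1] and from 1. *)
have q1 : 0 <= (1 + s) ^+ 2 * (2 - s).
  by rewrite mulr_ge0 ?sqr_ge0//; lra.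
have q2 : 0 <= (1 - s) ^+ 2 * (2 + s).
  by rewrite mulr_ge0 ?sqr_ge0//; lra.
by apply/andP; split; lra.
Qed.

Lemma sgn_iter0 n : sgn_iter n 0 = 0.
Proof. by elim: n => //= n ->; rewrite mul0r mul0r. Qed.

Lemma sgn_iterN n r : sgn_iter n (- r) = - sgn_iter n r.
Proof. by elim: n => //= n ->; rewrite sqrrN; ring. Qed.

(** On [(0, 1]] the iterates increase, and 1 is the only positive fixed point. *)
Lemma cvg_sgn_iter_pos r : 0 < r -> r <= 1 -> (sgn_iter n r @[n --> \oo] --> (1 : R)).
Proof.
move=> r0 r1.
have b n : 0 < sgn_iter n r <= 1.
  elim: n => /= [|n]; first by rewrite r0 r1.
  set s := sgn_iter n r => /andP[s0 s1].
  have : `|s * (3 - s ^+ 2) / 2| <= 1.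
    by have := @sgn_iter_bound n.+1 r; rewrite /= -/s; apply; rewrite ger0_norm// ltW.
  rewrite ler_norml => /andP[_ ->]; rewrite andbT divr_gt0// mulr_gt0//.
  have : s ^+ 2 <= 1 by rewrite expr_le1// ltW.
  lra.
have nd : nondecreasing_seq (fun n => sgn_iter n r).
  apply/nondecreasing_seqP => n /=; set s := sgn_iter n r.
  have /andP[s0 s1] := b n; rewrite -/s in s0 s1.
  have : s ^+ 2 <= 1 by rewrite expr_le1// ltW.
  move=> s2; rewrite -mulrA ler_peMr//; [exact: ltW|lra].
have cv : cvgn (fun n => sgn_iter n r).
  apply: nondecreasing_is_cvgn => //; exists 1 => _ [n _ <-].
  by have /andP[] := b n.
set L := limn (fun n => sgn_iter n r).
have Lr : r <= L by exact: (nondecreasing_cvgn_le nd cv 0).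
have e : L = L * (3 - L ^+ 2) / 2.
  apply: (@cvg_unique _ (@Rhausdorff R) (sgn_iter n.+1 r @[n --> \oo])).
    by have := cv; rewrite -(cvg_shiftS (fun n => sgn_iter n r)).
  rewrite /=; apply: cvgMl; apply: cvgM => //.
  by apply: cvgB; [exact: cvg_cst|rewrite expr2; under eq_fun do rewrite expr2; apply: cvgM].
have L0 : 0 < L by exact: lt_le_trans Lr.
have L1 : L = 1.
  have : L * (L - 1) * (L + 1) = 0 by move: e; lra.
  move/eqP; rewrite !mulf_eq0 (gt_eqF L0)/= subr_eq0 => /orP[/eqP//|].
  by rewrite gt_eqF// addr_gt0.
by rewrite -L1.
Qed.

Lemma step_iter_bound n r : `|r| <= 1 -> 0 <= step_iter n r <= 1.
Proof.
move=> /(@sgn_iter_bound n); rewrite /step_iter; set s := sgn_iter n r.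
rewrite ler_norml => /andP[s1 s2].
have : 0 <= (1 - s) * (1 + s) by rewrite mulr_ge0//; lra.
have := sqr_ge0 s => h0 h1; apply/andP; split; first by rewrite mulr_ge0//; lra.
by rewrite mulr_ile1 ?sqr_ge0//; lra.
Qed.

Lemma cvg_step_iter r : `|r| <= 1 ->
  (step_iter n r @[n --> \oo] --> ((0 < r)%R%:R : R)).
Proof.
rewrite ler_norml => /andP[r1 r2].
have h (s : R) : (sgn_iter n r @[n --> \oo] --> s) ->
    (step_iter n r @[n --> \oo] --> (1 + s) / 2 * s ^+ 2).
  move=> c; apply: cvgM.
    by apply: cvgMl; apply: cvgD => //; exact: cvg_cst.
  by rewrite expr2; under eq_fun do rewrite expr2; apply: cvgM.
have [r0|r0|r0] := ltgtP 0 r.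
- have /h := cvg_sgn_iter_pos r0 r2.
  by rewrite (_ : (1 + 1) / 2 * 1 ^+ 2 = 1)//; rewrite expr1n mulr1 divff.
- have /h : sgn_iter n r @[n --> \oo] --> (- 1 : R).
    rewrite (_ : (fun n => _) = fun n => - sgn_iter n (- r)); last first.
      by apply/funext => n; rewrite sgn_iterN opprK.
    by apply: cvgN; apply: cvg_sgn_iter_pos; lra.
  by rewrite subrr !mul0r.
- have /h : sgn_iter n r @[n --> \oo] --> (0 : R).
    by apply: cvg_near_cst; apply: nearW => n; rewrite -r0 sgn_iter0.
  by rewrite expr0n mulr0.
Qed.

End sign_approximation.

Section density.
Context d (X : measurableType d) (R : realType).
Variable mu : {measure set X -> \bar R}.
Variable w : X -> R.
Hypothesis w0 : forall x, 0 <= w x.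
Hypothesis iw : mu.-integrable setT (EFin \o w).
Variable (I : finType) (xi : I -> X -> R).

(** A pi-system; the bound [+oo] leaves a coordinate free. *)
Definition lower_boxes : set (set X) :=
  [set B | exists b : I -> \bar R, B = [set x | forall i, ((xi i x)%:E <= b i)%E]].

Hypothesis gen : @measurable _ X = <<s lower_boxes >>.
Hypothesis wD : forall x, w x != 0 -> forall i, 0 <= xi i x < 1.

Variable P : set (X -> R[i]).
Hypothesis P_meas : forall p, P p -> cmeas p.
Hypothesis P_cst : forall c : R[i], P (fun=> c).
Hypothesis P_add : forall p q, P p -> P q -> P (fun x => p x + q x).
Hypothesis P_mul : forall p q, P p -> P q -> P (fun x => p x * q x).
Hypothesis P_cis : forall i (s : R), (s = 1 \/ s = -1) -> P (fun x => cis (s * (2 * pi * xi i x))).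

Let W (f : X -> R[i]) : \bar R := (\int[mu]_x (normc (f x) ^+ 2 * w x)%:E)%E.

(** Membership in the closure of the algebra [P] in [L^2(w)]. The weight is integrable and carried
    by a fundamental domain [0 <= xi i < 1], on which the characters determine the coordinates.
    Indicators of boxes are limits of polynomials in the characters; the pi-lambda theorem then
    gives all measurable sets, and simple functions give the rest. *)
Definition approximable (f : X -> R[i]) : Prop :=
  cmeas f /\ forall e : R, 0 < e -> exists2 p, P p & (W (fun x => f x - p x)%R < e%:E)%E.

Let mw : measurable_fun setT w.
Proof. by apply/measurable_EFinP; exact: measurable_int iw. Qed.

Let mW f : cmeas f -> measurable_fun setT (fun x => (normc (f x) ^+ 2 * w x)%:E).
Proof.
by move=> mf; apply/measurable_EFinP/measurable_funM => //; exact: measurable_sqr_normc.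
Qed.

Let W_ge0 f x : (0 <= (normc (f x) ^+ 2 * w x)%:E)%E.
Proof. by rewrite lee_fin mulr_ge0 ?sqr_ge0. Qed.

Let W_D f g : cmeas f -> cmeas g ->
  (W (fun x => f x + g x)%R <= 2%:E * W f + 2%:E * W g)%E.
Proof.
move=> mf mg; rewrite /W -!ge0_integralZl//=; try exact: mW.
rewrite -ge0_integralD//; try by [move=> x _; rewrite mule_ge0|apply: measurable_funeM; exact: mW].
apply: ge0_le_integral => //.
- by move=> x _; rewrite lee_fin mulr_ge0 ?sqr_ge0.
- exact: mW (cmeasD mf mg).
- by apply: emeasurable_funD; apply: measurable_funeM; exact: mW.
- move=> x _; rewrite -!EFinM -EFinD lee_fin.
  apply: (le_trans (ler_wpM2r (w0 x) (sqr_normcD_le (f x) (g x)))).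
  by rewrite mulrDl !mulrA.
Qed.

Lemma approximable_lim (f : X -> R[i]) : cmeas f ->
  (forall e : R, 0 < e -> exists2 g, approximable g & (W (fun x => f x - g x)%R < e%:E)%E) ->
  approximable f.
Proof.
move=> mf h; split=> // e e0.
have e4 : 0 < e / 4 by rewrite divr_gt0.
have [g [mg ag] fg] := h _ e4; have [p Pp gp] := ag _ e4; exists p => //.
have mp := P_meas Pp.
rewrite (_ : (fun x => f x - p x) = fun x => (f x - g x) + (g x - p x)); last first.
  by apply/funext => x; rewrite addrA subrK.
rewrite (le_lt_trans (W_D _ _))//; try exact: cmeasB.
rewrite (_ : e%:E = 2%:E * (e / 4)%:E + 2%:E * (e / 4)%:E)%E; last first.
  by rewrite -!EFinM -EFinD; congr EFin; field.
by rewrite lteD// lte_pmul2l.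
Qed.

Lemma approximable_P p : P p -> approximable p.
Proof.
move=> Pp; split; first exact: P_meas.
move=> e e0; exists p => //; rewrite /W integral0_eq ?lte_fin// => x _.
by rewrite subrr normc0 expr0n mul0r.
Qed.

Lemma approximableD f g : approximable f -> approximable g ->
  approximable (fun x => f x + g x).
Proof.
move=> [mf af] [mg ag]; split; first exact: cmeasD.
move=> e e0; have e4 : 0 < e / 4 by rewrite divr_gt0.
have [p Pp fp] := af _ e4; have [q Pq gq] := ag _ e4.
exists (fun x => p x + q x); first exact: P_add.
have mp := P_meas Pp; have mq := P_meas Pq.
rewrite (_ : (fun x => _ - _) = fun x => (f x - p x) + (g x - q x)); last first.
  by apply/funext => x; rewrite addrACA opprD.
rewrite (le_lt_trans (W_D _ _))//; try exact: cmeasB.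
rewrite (_ : e%:E = 2%:E * (e / 4)%:E + 2%:E * (e / 4)%:E)%E; last first.
  by rewrite -!EFinM -EFinD; congr EFin; field.
by rewrite lteD// lte_pmul2l.
Qed.

Lemma approximableZ c f : approximable f -> approximable (fun x => c * f x).
Proof.
move=> [mf af]; split; first by apply: cmeasM => //; exact: cmeas_cst.
move=> e e0; have k0 : 0 < normc c ^+ 2 + 1 by rewrite ltr_wpDl ?sqr_ge0.
have [p Pp fp] := af (e / (normc c ^+ 2 + 1)) (divr_gt0 e0 k0).
exists (fun x => c * p x); first exact: P_mul.
have mp := P_meas Pp.
apply: (@le_lt_trans _ _ ((normc c ^+ 2 + 1)%:E * W (fun x => f x - p x)%R)%E).
  rewrite /W -ge0_integralZl//=; try exact: mW (cmeasB mf mp); last 2 first.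
    by move=> x _; rewrite lee_fin mulr_ge0 ?sqr_ge0.
    by rewrite lee_fin ltW.
  apply: ge0_le_integral => //.
  - by move=> x _; rewrite lee_fin mulr_ge0 ?sqr_ge0.
  - exact: mW (cmeasB (cmeasM (cmeas_cst c) mf) (cmeasM (cmeas_cst c) mp)).
  - exact: measurable_funeM (mW (cmeasB mf mp)).
  - move=> x _; rewrite -EFinM lee_fin -mulrBr normcM exprMn -mulrA.
    by apply: ler_wpM2r; rewrite ?lerDl// mulr_ge0 ?sqr_ge0.
by rewrite -lte_pdivlMl// -EFinM mulrC.
Qed.

Lemma approximable_sum J (r : seq J) (f : J -> X -> R[i]) :
  (forall j, approximable (f j)) -> approximable (fun x => \sum_(j <- r) f j x).
Proof.
move=> af; elim: r => [|j r ih].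
  by under eq_fun do rewrite big_nil; exact: approximable_P.
by under eq_fun do rewrite big_cons; exact: approximableD.
Qed.

(* Dominated convergence with respect to the weight. *)
Lemma approximable_cvg (f : nat -> X -> R[i]) (g : X -> R[i]) (h : X -> R) :
  (forall n, approximable (f n)) -> cmeas g ->
  mu.-integrable setT (fun x => (h x * w x)%:E) ->
  (forall n x, w x != 0 -> normc (g x - f n x) ^+ 2 <= h x) ->
  (forall x, w x != 0 -> normc (g x - f n x) ^+ 2 @[n --> \oo] --> (0 : R)) ->
  approximable g.
Proof.
move=> af mg ih fh fg; apply: approximable_lim => // e e0.
have mf n : cmeas (f n) by case: (af n).
have : W (fun x => g x - f n x) @[n --> \oo] --> 0%E.
  rewrite -(integral0 mu setT) /W; apply: (dominated_cvg measurableT _ _ _ ih).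
  - by move=> n; exact: mW (cmeasB mg (mf n)).
  - move=> x _; have [->|wx] := eqVneq (w x) 0.
      by under eq_fun do rewrite mulr0; exact: cvg_cst.
    apply: cvg_EFin; first exact: nearW.
    rewrite -[X in _ --> X](mul0r (w x)); apply: cvgMl; exact: fg.
  - by move=> x _.
  - move=> n x _; rewrite gee0_abs; last by rewrite lee_fin mulr_ge0 ?sqr_ge0.
    rewrite lee_fin; have [->|wx] := eqVneq (w x) 0; first by rewrite !mulr0.
    by apply: ler_wpM2r; [exact: w0|exact: fh].
move=> /cvge_eventually_lt /(_ e e0)[n _ /(_ n (leqnn n))/= h1].
by exists (f n).
Qed.

Let cst_approx c : approximable (fun=> c).
Proof. exact: approximable_P. Qed.

(* On [0 <= xi i < 1] this function is positive exactly where [s < xi i]. *)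
Let arc i (s : R) (x : X) : R := sin (pi * (xi i x - s)) * sin (pi * (1 - xi i x)).

(** A product of two sines is half the difference of two cosines, here [cos (t - a)] and the
    constant [cos b]. *)
Let arc_P i s : P (fun x => (arc i s x)%:C%C).
Proof.
pose a := pi * (1 + s); pose b := pi * (1 - s).
rewrite (_ : (fun x => _) = fun x => ((4^-1)%:C%C * cis (- a)) * cis (1 * (2 * pi * xi i x)) +
   ((4^-1)%:C%C * cis a) * cis (-1 * (2 * pi * xi i x)) + (- (cos b / 2))%:C%C); last first.
  apply/funext => x; set t := 2 * pi * xi i x.
  have -> : arc i s x = (cos (t - a) - cos b) / 2.
    rewrite /arc; set u := pi * (xi i x - s); set v := pi * (1 - xi i x).
    have -> : t - a = u - v by rewrite /t /a /u /v; ring.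
    have -> : b = u + v by rewrite /b /u /v; ring.
    by rewrite cosB cosD; field.
  rewrite mul1r mulN1r -!mulrA -!cisD.
  apply: complex_ext; rewrite !(cReD, cImD, cReM, cImM) /= [- a + t]addrC.
    by rewrite -[a - t]opprB cosN; field.
  by rewrite -[a - t]opprB sinN; field.
apply: P_add => //; apply: P_add; apply: P_mul => //; apply: P_cis; by [left|right].
Qed.

Let arc_le1 i s x : `|arc i s x| <= 1.
Proof. by rewrite normrM mulr_ile1 ?sin_max. Qed.

Let arc_gt0 i (s : R) x : w x != 0 -> 0 <= s < 1 -> (0 < arc i s x) = (s < xi i x).
Proof.
move=> /wD /(_ i) /andP[x0 x1] /andP[s0 s1].
have v0 : 0 < xi i x -> 0 < sin (pi * (1 - xi i x)).
  move=> xi0; apply: sin_gt0_pi; rewrite mulr_gt0 ?pi_gt0 ?subr_gt0//=.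
  by rewrite -[ltRHS]mulr1 ltr_pM2l ?pi_gt0// gtrBl.
have v1 : 0 <= sin (pi * (1 - xi i x)).
  have [->|xn0] := eqVneq (xi i x) 0; first by rewrite subr0 mulr1 sinpi.
  by rewrite ltW// v0// lt_neqAle eq_sym xn0.
have [sx|xs] := ltP s (xi i x).
  apply: mulr_gt0; last by apply: v0; exact: le_lt_trans sx.
  apply: sin_gt0_pi.
  rewrite mulr_gt0 ?pi_gt0 ?subr_gt0//= -[ltRHS]mulr1 ltr_pM2l ?pi_gt0//.
  by rewrite ltrBlDr (lt_le_trans x1)// lerDl.
apply/negbTE; rewrite -leNgt mulr_le0_ge0//.
rewrite -[pi * _]opprK sinN oppr_le0 -mulrN opprB sin_ge0_pi//.
rewrite mulr_ge0 ?pi_ge0 ?subr_ge0//= -[leRHS]mulr1 ler_pM2l ?pi_gt0//.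
by rewrite lerBlDr (le_trans (ltW s1))// lerDl.
Qed.

Let step_P n r : P (fun x => (r x)%:C%C) -> P (fun x => (step_iter n (r x))%:C%C).
Proof.
move=> Pr; have Ps m : P (fun x => (sgn_iter m (r x))%:C%C).
  elim: m => //= m ih.
  rewrite (_ : (fun x => _) = fun x => ((sgn_iter m (r x))%:C%C *
    ((3 : R)%:C%C + (-1 : R)%:C%C * ((sgn_iter m (r x))%:C%C * (sgn_iter m (r x))%:C%C)))
      * (2^-1 : R)%:C%C); last first.
    apply/funext => x; set s := sgn_iter m (r x).
    by apply: complex_ext; rewrite !(cReD, cImD, cReM, cImM) /=; field.
  apply: P_mul => //; apply: P_mul => //; apply: P_add => //.
  by apply: P_mul => //; apply: P_mul.
rewrite (_ : (fun x => _) = fun x => ((1 : R)%:C%C + (sgn_iter n (r x))%:C%C) *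
   (2^-1 : R)%:C%C * ((sgn_iter n (r x))%:C%C * (sgn_iter n (r x))%:C%C)); last first.
  apply/funext => x; rewrite /step_iter; set s := sgn_iter n (r x).
  by apply: complex_ext; rewrite !(cReD, cImD, cReM, cImM) /=; field.
apply: P_mul; last exact: P_mul.
by apply: P_mul; [exact: P_add|exact: P_cst].
Qed.

(** A bound outside [[0, 1)] decides the comparison on the whole support of [w], so a constant
    serves there. *)
Let ray i (b : \bar R) : exists r : X -> R, [/\ P (fun x => (r x)%:C%C),
  forall x, `|r x| <= 1 & forall x, w x != 0 -> (0 < r x) = (b < (xi i x)%:E)%E].
Proof.
case: b => [s| |].
- have [s0|s0] := ltP s 0.
    exists (fun=> 1); split=> // [_|x /wD/(_ i)/andP[x0 _]]; first by rewrite normr1.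
    by rewrite lte_fin ltr01 (lt_le_trans s0 x0).
  have [s1|s1] := leP 1 s.
    exists (fun=> 0); split=> // [_|x /wD/(_ i)/andP[_ x1]]; first by rewrite normr0.
    by rewrite lte_fin ltxx; apply/esym/negbTE; rewrite -leNgt (le_trans (ltW x1)).
  by exists (arc i s); split => // x wx; rewrite lte_fin arc_gt0// s0 s1.
- by exists (fun=> 0); split=> // *; rewrite ?normr0 ?ltxx.
- by exists (fun=> 1); split=> // *; rewrite ?normr1 ?ltr01 ?ltNyr.
Qed.

Let P_prod (r : seq I) (f : I -> X -> R[i]) : (forall i, P (f i)) ->
  P (fun x => \prod_(i <- r) f i x).
Proof.
move=> Pf; elim: r => [|i r ih]; first by under eq_fun do rewrite big_nil.
by under eq_fun do rewrite big_cons; exact: P_mul.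
Qed.

Let cmeas_indic (E : set X) : measurable E -> cmeas (fun x => (\1_E x : R)%:C%C).
Proof. by move=> mE; apply: cmeas_real. Qed.

Let lower_box_measurable B : lower_boxes B -> measurable B.
Proof. by move=> lB; rewrite gen; exact: sub_sigma_algebra. Qed.

(** On the support of [w] the box is the set where no [r i] is positive, so its indicator is the
    bounded limit of the products of [1 - step_iter n (r i)]. *)
Let lower_box_approx B : lower_boxes B -> approximable (fun x => (\1_B x : R)%:C%C).
Proof.
move=> lB; have mB := lower_box_measurable lB.
case: lB => b BE.
pose r i := projT1 (cid (ray i (b i))).
have rP i : P (fun x => (r i x)%:C%C) by rewrite /r; case: cid => f [].
have r1 i x : `|r i x| <= 1 by rewrite /r; case: cid => f [].
have rb i x : w x != 0 -> (0 < r i x) = (b i < (xi i x)%:E)%E.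
  by rewrite /r; case: cid => f [] /= _ _; exact.
pose q n x : R := \prod_(i : I) (1 - step_iter n (r i x)).
have q01 n x : 0 <= q n x <= 1.
  have h i : 0 <= 1 - step_iter n (r i x) <= 1.
    by have /andP[? ?] := step_iter_bound n (r1 i x); apply/andP; split; lra.
  rewrite prodr_ge0 => [|i _]; last by have /andP[] := h i.
  by rewrite prodr_ile1// => i _; exact: h.
have fE n x : (q n x)%:C%C = \prod_(i <- index_enum I)
    ((1 : R)%:C%C + (-1 : R)%:C%C * (step_iter n (r i x))%:C%C).
  rewrite /q rmorph_prod; apply: eq_bigr => i _.
  by apply: complex_ext; rewrite !(cReD, cImD, cReM, cImM) /=; ring.
have d1 n x : normc ((\1_B x)%:C%C - (q n x)%:C%C) ^+ 2 = (\1_B x - q n x) ^+ 2.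
  by rewrite -rmorphB normc_real real_normK ?num_real.
apply: (@approximable_cvg (fun n x => (q n x)%:C%C) _ (fun=> 1)).
- move=> n; apply: approximable_P; under eq_fun do rewrite fE.
  by apply: P_prod => i; apply: P_add => //; apply: P_mul => //; exact: step_P.
- exact: cmeas_indic.
- by under eq_fun do rewrite mul1r.
- move=> n x _; rewrite d1; have /andP[q0 q1] := q01 n x.
  rewrite -[leRHS](expr1n _ 2) -[leLHS]real_normK ?num_real// ler_sqr ?nnegrE//.
  rewrite indicE; case: (x \in B); rewrite /= ?mulr0n ?mulr1n ler_norml; apply/andP; split; lra.
- move=> x wx; under eq_fun do rewrite d1.
  have -> : (\1_B x : R) = \prod_(i : I) (1 - (0 < r i x)%R%:R).
    rewrite indicE; have [xB|xB] := boolP (x \in B).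
      rewrite big1// => i _; rewrite rb//.
      have : (b i < (xi i x)%:E)%E = false.
        by apply/negbTE; rewrite -leNgt; move: xB; rewrite inE BE; exact.
      by move=> ->; rewrite subr0.
    have [i bi] : exists i, (b i < (xi i x)%:E)%E.
      apply: contrapT => h; move/negP: xB; apply; rewrite inE BE => i /=.
      by rewrite leNgt; apply/negP => bi; apply: h; exists i.
    by rewrite (bigD1 i)//= rb// bi subrr mul0r.
  have cq : q n x @[n --> \oo] --> (\prod_(i : I) (1 - (0 < r i x)%R%:R) : R).
    rewrite /q; elim: (index_enum I) => [|i s ih].
      by under eq_fun do rewrite big_nil; rewrite big_nil; exact: cvg_cst.
    under eq_fun do rewrite big_cons; rewrite big_cons; apply: cvgM => //.
    by apply: cvgB; [exact: cvg_cst|exact: cvg_step_iter].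
  set l := \prod_(i : I) _ in cq *.
  have : (l - q n x) ^+ 2 @[n --> \oo] --> (l - l) ^+ 2.
    rewrite expr2; under eq_fun do rewrite expr2.
    by apply: cvgM; apply: cvgB => //; exact: cvg_cst.
  by rewrite subrr expr0n.
Qed.

Lemma approximable_indic E : measurable E -> approximable (fun x => (\1_E x : R)%:C%C).
Proof.
suff h : measurable `<=` [set E | measurable E /\ approximable (fun x => (\1_E x : R)%:C%C)].
  by move=> mE; have [] := h E mE.
rewrite [X in X `<=` _]gen; apply: (@lambda_system_subset _ lower_boxes) => //.
- move=> _ _ [a ->] [b ->]; exists (fun i => Order.min (a i) (b i)).
  apply/seteqP; split => x /=.
    by move=> [ha hb] i; rewrite le_min ha hb.
  by move=> h; split => i; have := h i; rewrite le_min => /andP[].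
- split => //.
  + split => //; rewrite (_ : (fun x => _) = fun=> 1)//.
    by apply/funext => x; rewrite indicT.
  + move=> A B BA [mA aA] [mB aB]; split; first exact: measurableD.
    rewrite (_ : (fun x => _) = fun x => (\1_A x : R)%:C%C + (-1) * (\1_B x : R)%:C%C).
      by apply: approximableD => //; exact: approximableZ.
    apply/funext => x; rewrite mulN1r -rmorphB; congr (_%:C%C).
    rewrite !indicE in_setD; have [xB|xB] := boolP (x \in B); rewrite ?andbF ?andbT ?subr0//.
    by rewrite mem_set ?subrr//; apply: BA; rewrite inE in xB.
  + move=> F ndF HF.
    have mU : measurable (\bigcup_k F k) by apply: bigcup_measurable => k _; case: (HF k).
    split => //; apply: (@approximable_cvg (fun n x => (\1_(F n) x : R)%:C%C) _ (fun=> 1)).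
    * by move=> n; case: (HF n).
    * exact: cmeas_indic.
    * by under eq_fun do rewrite mul1r.
    * by move=> n x _; rewrite -rmorphB normc_real real_normK ?num_real// !indicE.
    * move=> x _; apply: cvg_near_cst.
      have [[k _ Fkx]|nF] := pselect ((\bigcup_k F k) x).
        exists k => // n kn.
        have Fnx : F n x by move: Fkx; exact/subsetPset/ndF.
        have FUx : (\bigcup_i F i) x by exists n.
        by rewrite !indicE !mem_set// subrr normc0 expr0n.
      apply: nearW => n; have nFn : ~ F n x by move=> Fnx; apply: nF; exists n.
      by rewrite !indicE !memNset// subrr normc0 expr0n.
- move=> B lB; split; first exact: lower_box_measurable.
  exact: lower_box_approx.
Qed.

Import HBNNSimple.

Let approximable_nnsfun (h : {nnsfun X >-> R}) : approximable (fun x => (h x)%:C%C).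
Proof.
rewrite (_ : (fun x => _) = fun x => \sum_(y <- fset_set (range h))
    y%:C%C * (\1_(h @^-1` [set y]) x : R)%:C%C).
  apply: approximable_sum => y; apply: approximableZ; apply: approximable_indic.
  by rewrite -[X in measurable X]setTI; exact: measurable_funP.
apply/funext => x; rewrite [in LHS](fimfunE h x) fsbig_finite//= rmorph_sum.
by apply: eq_bigr => y _; rewrite rmorphM.
Qed.

Let approximable_ge0 (f : X -> R) : measurable_fun setT f -> (forall x, 0 <= f x) ->
  mu.-integrable setT (fun x => (f x ^+ 2 * w x)%:E) -> approximable (fun x => (f x)%:C%C).
Proof.
move=> mf f0 iF.
have mfe : measurable_fun setT (EFin \o f) by exact/measurable_EFinP.
pose h := nnsfun_approx measurableT mfe.
have f0e x : setT x -> (0 <= (EFin \o f) x)%E by move=> _; rewrite lee_fin.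
have hf n x : h n x <= f x.
  have c : h ^~ x @ \oo --> f x by have /fine_cvgP[] := cvg_nnsfun_approx measurableT mfe f0e (x:=x) Logic.I.
  rewrite -(cvg_lim (@Rhausdorff R) c).
  apply: nondecreasing_cvgn_le; last by apply/cvg_ex; exists (f x).
  by move=> a b ab; have /lefP := nd_nnsfun_approx measurableT mfe ab; exact.
apply: (@approximable_cvg (fun n x => (h n x)%:C%C) _ (fun x => f x ^+ 2)) => //.
- move=> n x _; rewrite -rmorphB normc_real real_normK ?num_real//.
  by rewrite ler_sqr ?nnegrE ?subr_ge0// lerBlDr lerDl.
- move=> x _; under eq_fun do rewrite -rmorphB normc_real real_normK ?num_real//.
  have c : h ^~ x @ \oo --> f x by have /fine_cvgP[] := cvg_nnsfun_approx measurableT mfe f0e (x:=x) Logic.I.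
  rewrite -(_ : (f x - f x) * (f x - f x) = 0); last by rewrite subrr mul0r.
  by under eq_fun do rewrite expr2; apply: cvgM; apply: cvgB => //; exact: cvg_cst.
Qed.

Lemma approximable_L2 (f : X -> R[i]) : cmeas f ->
  mu.-integrable setT (fun x => (normc (f x) ^+ 2 * w x)%:E) -> approximable f.
Proof.
move=> mf iF; have [mr mi] := mf.
have part (g : X -> R) : measurable_fun setT g -> (forall x, 0 <= g x <= normc (f x)) ->
    approximable (fun x => (g x)%:C%C).
  move=> mg gf; apply: approximable_ge0 => //; first by move=> x; have /andP[] := gf x.
  apply: (le_integrable measurableT _ _ iF).
    by apply/measurable_EFinP/measurable_funM => //; exact: measurable_funX.
  move=> x _; have p1 : 0 <= g x ^+ 2 * w x by apply: mulr_ge0; [exact: sqr_ge0|].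
  have p2 : 0 <= normc (f x) ^+ 2 * w x by apply: mulr_ge0; [exact: sqr_ge0|].
  rewrite /= lee_fin (ger0_norm p1) (ger0_norm p2).
  by have /andP[g0 gfx] := gf x; apply: ler_wpM2r => //; rewrite ler_sqr ?nnegrE ?normc_ge0.
have absn (a : R) (z : R[i]) : `|a| <= normc z -> 0 <= Num.max a 0 <= normc z.
  move=> az; rewrite le_max lexx orbT/= ge_max normc_ge0 andbT.
  exact: le_trans (ler_norm _) az.
have max0 (a : R) : a = Num.max a 0 - Num.max (- a) 0.
  have [a0|a0] := leP 0 a.
    have h : - a <= 0 by rewrite oppr_le0.
    by rewrite (max_idPr h) subr0.
  have h : 0 <= - a by rewrite oppr_ge0 ltW.
  by rewrite (max_idPl h) opprK add0r.
rewrite (_ : f = fun x =>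
   ((Num.max (complex.Re (f x)) 0)%:C%C + (-1) * (Num.max (- complex.Re (f x)) 0)%:C%C) +
   'i%C * ((Num.max (complex.Im (f x)) 0)%:C%C + (-1) * (Num.max (- complex.Im (f x)) 0)%:C%C)).
  apply: approximableD; [|apply: approximableZ]; (apply: approximableD; [|apply: approximableZ]).
  - apply: part; first by apply: measurable_maxr => //; exact: measurable_cst.
    by move=> x; apply/absn/abs_Re_le.
  - apply: part; first by apply: measurable_maxr; [exact: measurable_funN|exact: measurable_cst].
    by move=> x; apply/absn; rewrite normrN abs_Re_le.
  - apply: part; first by apply: measurable_maxr => //; exact: measurable_cst.
    by move=> x; apply/absn/abs_Im_le.
  - apply: part; first by apply: measurable_maxr; [exact: measurable_funN|exact: measurable_cst].
    by move=> x; apply/absn; rewrite normrN abs_Im_le.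
apply/funext => x; rewrite !mulN1r -!rmorphB -!max0.
exact: complexE.
Qed.

End density.

(** * Euclidean space and the unit cube *)

Lemma lower_boxes_preimage d (X : measurableType d) (R : realType) (I : finType)
    (xi : I -> X -> R) (i : I) (B : set (measurableTypeR R)) :
  measurable B -> <<s lower_boxes xi >> (xi i @^-1` B).
Proof.
rewrite [X in X _ -> _](RGenOInfty.measurableE R).
suff : <<s (@RGenOInfty.G R) >> `<=` [set B | <<s lower_boxes xi >> (xi i @^-1` B)] by exact.
apply: smallest_sub.
  split => /=.
  - by rewrite preimage_set0; exact: sigma_algebra0.
  - by move=> A sA; rewrite setTD preimage_setC; exact: sigma_algebraC.
  - by move=> F sF; rewrite preimage_bigcup; exact: sigma_algebra_bigcup.
move=> _ [a ->] /=.
rewrite (_ : _ @^-1` _ = ~` [set x | forall j, ((xi j x)%:E <= if j == i then a%:E else +oo)%E]).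
  by apply: sigma_algebraC; apply: sub_sigma_algebra; exists (fun j => if j == i then a%:E else +oo%E).
apply/seteqP; split => x /=; rewrite in_itv/= andbT.
  by move=> ax /(_ i); rewrite eqxx lee_fin leNgt ax.
move=> h; rewrite ltNge; apply/negP => xa; apply: h => j.
by have [->|_] := eqVneq j i; rewrite ?lee_fin ?leey.
Qed.

Section euclid_vectors.
Context {R : realType} {l : nat}.
Implicit Types (x y s xi : euclid R l) (m n : l.-tuple int) (k : 'I_l).

Definition vadd x s : euclid R l := [tuple ecoord x i + ecoord s i | i < l].
Definition vopp x : euclid R l := [tuple - ecoord x i | i < l].
Definition kvec k (t : R) : euclid R l := [tuple if i == k then t else 0 | i < l].
Definition addz m n : l.-tuple int := [tuple tnth m i + tnth n i | i < l].
Definition oppz m : l.-tuple int := [tuple - tnth m i | i < l].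

Lemma euclid_ext x y : (forall i, ecoord x i = ecoord y i) -> x = y.
Proof. by move=> xy; exact: eq_from_tnth. Qed.

Lemma intvec_ext m n : (forall i, tnth m i = tnth n i) -> m = n.
Proof. by move=> xy; exact: eq_from_tnth. Qed.

Lemma ecoord_vadd x s i : ecoord (vadd x s) i = ecoord x i + ecoord s i.
Proof. by rewrite /ecoord tnth_mktuple. Qed.
Lemma ecoord_vopp x i : ecoord (vopp x) i = - ecoord x i.
Proof. by rewrite /ecoord tnth_mktuple. Qed.
Lemma ecoord_subvec x s i : ecoord (subvec x s) i = ecoord x i - ecoord s i.
Proof. by rewrite /ecoord tnth_mktuple. Qed.
Lemma ecoord_kvec k t i : ecoord (kvec k t) i = if i == k then t else 0.
Proof. by rewrite /ecoord tnth_mktuple. Qed.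
Lemma ecoord_intvec m i : ecoord (intvec m) i = (tnth m i)%:~R :> R.
Proof. by rewrite /ecoord tnth_mktuple. Qed.
Lemma tnth_addz m n i : tnth (addz m n) i = tnth m i + tnth n i.
Proof. by rewrite tnth_mktuple. Qed.
Lemma tnth_oppz m i : tnth (oppz m) i = - tnth m i.
Proof. by rewrite tnth_mktuple. Qed.

Definition ecoordE := (ecoord_vadd, ecoord_vopp, ecoord_subvec, ecoord_kvec,
  ecoord_intvec, tnth_addz, tnth_oppz).

Lemma dotDl x y xi : dot (vadd x y) xi = dot x xi + dot y xi.
Proof. by rewrite /dot -big_split/=; apply: eq_bigr => i _; rewrite ecoordE mulrDl. Qed.
Lemma dotDr x y xi : dot xi (vadd x y) = dot xi x + dot xi y.
Proof. by rewrite /dot -big_split/=; apply: eq_bigr => i _; rewrite ecoordE mulrDr. Qed.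
Lemma dotNl x xi : dot (vopp x) xi = - dot x xi.
Proof. by rewrite /dot -sumrN; apply: eq_bigr => i _; rewrite ecoordE mulNr. Qed.
Lemma dotNr x xi : dot xi (vopp x) = - dot xi x.
Proof. by rewrite /dot -sumrN; apply: eq_bigr => i _; rewrite ecoordE mulrN. Qed.
Lemma dotC x xi : dot x xi = dot xi x.
Proof. by apply: eq_bigr => i _; rewrite mulrC. Qed.
Lemma dot_kvecl k t xi : dot (kvec k t) xi = t * ecoord xi k.
Proof.
rewrite /dot (bigD1 k)//= big1 ?addr0 ?ecoordE ?eqxx// => i /negPf ik.
by rewrite ecoordE ik mul0r.
Qed.
Lemma dot_kvecr k t xi : dot xi (kvec k t) = t * ecoord xi k.
Proof. by rewrite dotC dot_kvecl. Qed.

Lemma intvecD m n : intvec (addz m n) = vadd (intvec m) (intvec n) :> euclid R l.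
Proof. by apply: euclid_ext => i; rewrite !ecoordE intrD. Qed.
Lemma intvecN m : intvec (oppz m) = vopp (intvec m) :> euclid R l.
Proof. by apply: euclid_ext => i; rewrite !ecoordE rmorphN. Qed.

Lemma cis_dot_intvec m n : cis (2 * pi * dot (intvec m) (intvec n)) = 1 :> R[i].
Proof.
rewrite (_ : dot _ _ = (\sum_(i < l) tnth m i * tnth n i)%:~R) ?cis_int//.
by rewrite rmorph_sum/=; apply: eq_bigr => i _; rewrite !ecoordE intrM.
Qed.

Lemma vaddAC x y z : vadd (vadd x y) z = vadd (vadd x z) y.
Proof. by apply: euclid_ext => i; rewrite !ecoordE addrAC. Qed.
Lemma vaddK x y : vadd (vadd x y) (vopp y) = x.
Proof. by apply: euclid_ext => i; rewrite !ecoordE addrK. Qed.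
Lemma subvecE x y : subvec x y = vadd x (vopp y).
Proof. by apply: euclid_ext => i; rewrite !ecoordE. Qed.

End euclid_vectors.

Section euclid_measure.
Context {R : realType} {l : nat}.
Local Notation mu := (lebesgue_euclid R l).
Implicit Types (x y s xi : euclid R l) (m n : l.-tuple int) (k : 'I_l).

Lemma measurable_ecoord k : measurable_fun setT (fun x => ecoord x k).
Proof. exact: measurable_tnth. Qed.

Lemma measurable_euclid d (X : measurableType d) (f : X -> euclid R l) :
  (forall i, measurable_fun setT (fun z => ecoord (f z) i)) -> measurable_fun setT f.
Proof. by move=> mf; apply/measurable_fun_tnthP. Qed.

Lemma euclid_gen_lower_boxes :
  @measurable _ (euclid R l) = <<s lower_boxes (fun i x => ecoord x i) >>.
Proof.
apply/seteqP; split; last first.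
  apply: smallest_sub; first exact: sigma_algebra_measurable.
  move=> _ [b ->]; rewrite (_ : [set x | _] = \big[setI/setT]_(i < l)
      [set x | ((ecoord x i)%:E <= b i)%E]).
    apply: bigsetI_measurable => i _.
    rewrite -[X in measurable X]setTI; apply: emeasurable_fun_le => //.
    by apply/measurable_EFinP; exact: measurable_ecoord.
  rewrite -bigcap_seq; apply/seteqP; split => x /= Ax i; first by move=> _; exact: Ax.
  by apply: Ax; rewrite /= mem_index_enum.
apply: smallest_sub; first exact: smallest_sigma_algebra.
rewrite -bigcup_seq => A [i _ [B mB <-]]; rewrite setTI.
exact: (@lower_boxes_preimage _ _ _ _ (fun i x => ecoord x i) i B mB).
Qed.

Definition preserving (f : euclid R l -> euclid R l) :=
  measurable_fun setT f /\ forall A, measurable A -> mu (f @^-1` A) = mu A.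

Definition mboxes : set (set (euclid R l)) :=
  [set A | exists2 B : 'I_l -> set (measurableTypeR R), (forall i, measurable (B i)) &
     A = [set x | forall i, B i (ecoord x i)]].

Lemma mbox_measurable (B : 'I_l -> set (measurableTypeR R)) :
  (forall i, measurable (B i)) -> measurable [set x | forall i, B i (ecoord x i)].
Proof.
move=> mB; rewrite (_ : [set x | _] = \big[setI/setT]_(i < l)
    ((fun x => tnth x i) @^-1` B i)).
  apply: bigsetI_measurable => i _; rewrite -[X in measurable X]setTI.
  exact: measurable_tnth.
rewrite -bigcap_seq; apply/seteqP; split => x /= Ax i; first by move=> _; exact: Ax.
by apply: Ax; rewrite /= mem_index_enum.
Qed.

Lemma euclid_gen_mboxes : @measurable _ (euclid R l) = <<s mboxes >>.
Proof.
apply/seteqP; split; last first.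
  apply: smallest_sub; first exact: sigma_algebra_measurable.
  by move=> _ [B mB ->]; exact: mbox_measurable.
apply: smallest_sub; first exact: smallest_sigma_algebra.
rewrite -bigcup_seq => A [i _ [B mB <-]]; rewrite setTI; apply: sub_sigma_algebra.
exists (fun j => if j == i then B else setT) => [j|]; first by case: ifP.
apply/seteqP; split => x /=.
  by move=> Bx j; have [->|] := eqVneq j i.
by move=> /(_ i); rewrite eqxx.
Qed.

(** The product formula gives equality on boxes, which form a pi-system, and bounded boxes exhaust
    the space with finite measure; the uniqueness theorem for measures applies. *)
Lemma coordwise_preserving (phi : 'I_l -> measurableTypeR R -> measurableTypeR R) :
  (forall i, measurable_fun setT (phi i)) ->
  (forall i (A : set (measurableTypeR R)), measurable A ->
     lebesgue_measure (phi i @^-1` A) = lebesgue_measure A) ->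
  preserving (fun x => [tuple phi i (ecoord x i) | i < l]).
Proof.
move=> mphi phiP.
pose f : euclid R l -> euclid R l := fun x => [tuple phi i (ecoord x i) | i < l].
rewrite -/f.
have mf : measurable_fun setT f.
  apply: measurable_euclid => i; rewrite (_ : (fun x => _) = phi i \o (fun x => ecoord x i)).
    exact: (measurableT_comp (mphi i) (@measurable_tnth _ (measurableTypeR R) l i)).
  by apply/funext => x; rewrite /f /ecoord tnth_mktuple.
split=> // A mA.
pose g (n : nat) : set (euclid R l) :=
  [set x | forall i, (`](- n%:R : R), n%:R]%classic : set (measurableTypeR R)) (ecoord x i)].
pose m2 : {measure set (euclid R l) -> \bar R} := pushforward mu f.
rewrite -[LHS]/(m2 mf A); apply/esym; apply: (measure_unique mboxes g) => //.
- exact: euclid_gen_mboxes.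
- move=> _ _ [B mB ->] [C mC ->]; exists (fun i => B i `&` C i).
    by move=> i; exact: measurableI.
  apply/seteqP; split => x /=; first by move=> [Bx Cx] i; split.
  by move=> h; split => i; have [] := h i.
- by move=> n; exists (fun=> `](- n%:R : R), n%:R]%classic).
- apply/seteqP; split => // x _.
  have [n nP] : exists n : nat, forall i, `|ecoord x i| < n%:R.
    pose M := \sum_(i < l) `|ecoord x i|.
    have M0 : 0 <= M by exact: sumr_ge0.
    exists (Num.truncn M).+1 => i.
    rewrite (le_lt_trans _ (truncnS_gt M))//.
    by rewrite /M (bigD1 i)//= lerDl sumr_ge0.
  exists n => // i /=; rewrite in_itv/=.
  by have := nP i; rewrite ltr_norml => /andP[-> /ltW].
- move=> _ [B mB ->].
  rewrite /= /pushforward (_ : f @^-1` _ = [set x | forall i, (phi i @^-1` B i) (ecoord x i)]).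
    have mpB i : measurable (phi i @^-1` B i).
      by rewrite -[X in measurable X]setTI; exact: mphi.
    rewrite /lebesgue_euclid (power_measure_box _ mpB) (power_measure_box _ mB).
    by apply: eq_bigr => i _; exact/esym/(phiP _ _ (mB i)).
  by apply/seteqP; split => x /= h i; have := h i; rewrite /f /ecoord tnth_mktuple.
- move=> n; pose I : set (measurableTypeR R) := `](- n%:R : R), n%:R]%classic.
  have e : mu (g n) = (\prod_(i < l) (@lebesgue_measure R) I)%E.
    by apply: (power_measure_box (@lebesgue_measure R) (A := fun=> I)) => i; exact: measurable_itv.
  change (mu (g n) < +oo)%E; rewrite e {e}.
  rewrite (_ : (\prod_(i < l) _)%E = (\prod_(i < l) ((n%:R + n%:R : R)%R%:E))%E).
    by rewrite prodEFin ltry.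
  apply: eq_bigr => i _; rewrite lebesgue_measure_itv/= lte_fin.
  have [_|] := ltP; first by rewrite -EFinD opprK.
  move=> nn; have n0 : n%:R <= 0 :> R by lra.
  by rewrite (_ : n%:R = 0 :> R) ?addr0//; apply/eqP; rewrite eq_le n0 ler0n.
Qed.

Lemma preserving_integral f (F : euclid R l -> \bar R) : preserving f ->
  measurable_fun setT F -> (forall x, (0 <= F x)%E) ->
  (\int[mu]_x F (f x) = \int[mu]_x F x)%E.
Proof.
move=> [mf fP] mF F0.
rewrite -[LHS](@ge0_integral_pushforward _ _ _ _ _ _ mf mu setT)//.
by apply: eq_measure_integral => A mA _; exact: fP.
Qed.

Lemma preserving_translation s : preserving (vadd ^~ s).
Proof.
apply: (@coordwise_preserving (fun i t => t + ecoord s i)).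
  by move=> i; apply: measurable_funD => //; exact: measurable_cst.
move=> i A mA; set a := ecoord s i.
have ma : measurable_fun setT (fun t : measurableTypeR R => t + a : measurableTypeR R).
  by apply: measurable_funD => //; exact: measurable_cst.
pose tr (t : measurableTypeR R) : measurableTypeR R := t + a.
pose m2 : {measure set (measurableTypeR R) -> \bar R} := pushforward (@lebesgue_measure R) tr.
rewrite -[LHS]/(m2 ma A); apply/esym/lebesgue_measure_unique => //.
move=> _ [[b c]/= _ <-]; rewrite /pushforward.
rewrite (_ : tr @^-1` _ = `]b - a, c - a]%classic); last first.
  apply/seteqP; split => t /=; rewrite !in_itv/=.
    by move=> /andP[bt tc]; rewrite ltrBlDr lerBrDr bt.
  by rewrite ltrBlDr lerBrDr.
rewrite !lebesgue_measure_itv/= !lte_fin ltrD2r.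
by case: ifP => // _; rewrite -!EFinB; congr EFin; ring.
Qed.

Lemma preserving_vopp : preserving vopp.
Proof.
apply: (@coordwise_preserving (fun i t => - t)); first by move=> i; exact: measurable_funN.
by move=> i A mA; exact: lebesgue_measureN.
Qed.

Lemma preserving_ae f (P : euclid R l -> Prop) : preserving f ->
  {ae mu, forall x, P x} -> {ae mu, forall x, P (f x)}.
Proof.
move=> [mf fP] [N [mN N0 PN]]; exists (f @^-1` N); split.
- by rewrite -[X in measurable X]setTI; exact: mf.
- by rewrite fP.
- by move=> x /= nP; apply: PN.
Qed.

Definition cube : set (euclid R l) := [set x | forall i, 0 <= ecoord x i < 1].

Lemma cubeE : cube = [set x | forall i, (`[0, 1[%classic : set (measurableTypeR R)) (ecoord x i)].
Proof. by apply/seteqP; split => x /= h i; have := h i; rewrite in_itv. Qed.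

Lemma cube_measurable : measurable cube.
Proof.
rewrite cubeE; apply: (@mbox_measurable (fun=> (`[0, 1[%classic : set (measurableTypeR R)))) => i.
exact: measurable_itv.
Qed.

Lemma cube_measure : mu cube = 1%E.
Proof.
pose I : set (measurableTypeR R) := `[0, 1[%classic.
have -> : mu cube = (\prod_(i < l) (@lebesgue_measure R) I)%E.
  by rewrite cubeE; apply: (power_measure_box (@lebesgue_measure R) (A := fun=> I)) => i;
    exact: measurable_itv.
rewrite big1// => i _.
by rewrite lebesgue_measure_itv/= lte_fin ltr01 oppr0 adde0.
Qed.

Let cube_fin : (mu cube < +oo)%E. Proof. by rewrite cube_measure ltry. Qed.

(** A measure on the whole space, so that integrals over the torus need no domain: periodic
    functions are integrated over one period. *)
Definition cube_measure_restr : {finite_measure set (euclid R l) -> \bar R} :=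
  mfrestr cube_measurable cube_fin.
Local Notation nu := cube_measure_restr.

Lemma cube_integral (F : euclid R l -> \bar R) : measurable_fun setT F ->
  (forall x, (0 <= F x)%E) -> (\int[nu]_x F x = \int[mu]_x (F x * (\1_cube x)%:E))%E.
Proof.
move=> mF F0.
have mc := cube_measurable.
transitivity (\int[nu]_(x in cube) F x)%E.
  rewrite (ge0_negligible_integral (N := ~` cube))//.
  - by rewrite setTD setCK.
  - exact: measurableC.
  - by rewrite -[LHS]/(mu (~` cube `&` cube)) setICl measure0.
transitivity (\int[mu]_(x in cube) F x)%E.
  by apply: eq_measure_integral => A mA Ac; rewrite -[LHS]/(mu (A `&` cube)) setIidl.
rewrite integral_mkcond; apply: eq_integral => x _.
by rewrite patchE indicE; case: ifPn => _; rewrite ?mule1 ?mule0.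
Qed.

Lemma cube_ae (P : euclid R l -> Prop) :
  {ae nu, forall x, P x} <-> {ae mu, forall x, cube x -> P x}.
Proof.
have mc := cube_measurable.
split=> -[N [mN N0 PN]].
- exists (N `&` cube); split => //; first exact: measurableI.
  by move=> x /= /not_implyP[cx nP]; split => //; exact: PN.
- exists (N `|` ~` cube); split.
  + by apply: measurableU => //; exact: measurableC.
  + rewrite -[LHS]/(mu ((N `|` ~` cube) `&` cube)); apply/eqP; rewrite -measure_le0 -N0 le_measure ?inE//.
      by apply: measurableI => //; apply: measurableU => //; exact: measurableC.
    by move=> x [[]].
  + move=> x /= nP; have [cx|] := pselect (cube x); last by right.
    by left; apply: PN => /(_ cx).
Qed.

End euclid_measure.

(** Unordered sums become series, to which monotone convergence applies; indices that encode no
    element contribute 0. *)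
Lemma esum_pickle (R : realType) (I : countType) (F : I -> \bar R) :
  (forall i, 0 <= F i)%E ->
  (\esum_(i in [set: I]) F i = \sum_(0 <= j <oo) oapp F 0%E (@pickle_inv I j))%E.
Proof.
move=> F0; set a := fun j => oapp F 0%E (@pickle_inv I j).
have a0 j : (0 <= a j)%E by rewrite /a; case: pickle_inv => /=.
have aE (i : I) : a (@choice.pickle I i) = F i by rewrite /a pickleK_inv.
pose p : I -> nat := @choice.pickle I.
pose J : set nat := [set j | exists i, p i = j].
transitivity (\esum_(j in J) a j)%E.
  rewrite (@reindex_esum _ _ _ setT J p).
    by apply: eq_esum => i _; rewrite aE.
  split; first by move=> i _; exists i.
    by move=> i j _ _; exact: (pcan_inj choice.pickleK).
  by move=> j [i ij]; exists i.
rewrite nneseries_esumT// esum_mkcond; apply: eq_esum => j _.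
case: ifPn => // /negP nj; rewrite /a; case E : (pickle_inv j) => [i|]//=.
exfalso; apply: nj; rewrite inE; exists i.
by have := @pickle_invK I j; rewrite /ocancel E.
Qed.

Lemma integral_esum d (X : measurableType d) (R : realType) (mu : {measure set X -> \bar R})
    (I : countType) (f : I -> X -> \bar R) :
  (forall i, measurable_fun setT (f i)) -> (forall i x, 0 <= f i x)%E ->
  (\int[mu]_x (\esum_(i in [set: I]) f i x) = \esum_(i in [set: I]) \int[mu]_x f i x)%E.
Proof.
move=> mf f0; rewrite esum_pickle; last by move=> i; exact: integral_ge0.
under eq_integral => x _ do rewrite esum_pickle//.
rewrite integral_nneseries//.
- apply: eq_eseriesr => j _; case: (pickle_inv j) => [i|]//=.
  by rewrite integral0.
- by move=> j; case: (pickle_inv j) => [i|] //=; exact: measurable_cst.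
- by move=> j x _; case: (pickle_inv j) => [i|] /=.
Qed.

Lemma esum_single (R : realType) (I : choiceType) (i0 : I) (a : \bar R) (F : I -> \bar R) :
  (0 <= a)%E -> (forall i, F i = if i == i0 then a else 0%E) ->
  \esum_(i in [set: I]) F i = a.
Proof.
move=> a0 FE; rewrite -[RHS](@esum_set1 R I i0 (fun=> a))// [RHS]esum_mkcond.
apply: eq_esum => i _; rewrite FE.
by have [->|ii0] := eqVneq i i0; [rewrite mem_set|rewrite memNset//= => /eqP; rewrite (negPf ii0)].
Qed.

Section cells.
Context {R : realType} {l : nat}.
Local Notation mu := (lebesgue_euclid R l).
Local Notation nu := (@cube_measure_restr R l).
Local Notation cube := (@cube R l).
Implicit Types (x y s xi : euclid R l) (m n : l.-tuple int) (k : 'I_l).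

Lemma cube_total : nu setT = 1%E.
Proof. by rewrite -[LHS]/(mu (setT `&` cube)) setTI cube_measure. Qed.

Definition floorv x : l.-tuple int := [tuple Num.floor (ecoord x i) | i < l].

Lemma cube_subz x m : cube (vadd x (vopp (intvec m))) <-> m = floorv x.
Proof.
split=> [cx|->].
  apply: intvec_ext => i; have := cx i; rewrite !ecoordE tnth_mktuple => /andP[h1 h2].
  by apply/esym/Num.Theory.floor_def; rewrite intrD; move: h1 h2; lra.
move=> i; rewrite !ecoordE tnth_mktuple.
have := floor_le_tmp (ecoord x i); have := floorD1_gt (ecoord x i).
by rewrite intrD => h1 h2; apply/andP; split; lra.
Qed.

Lemma cube_addz x m : cube (vadd x (intvec m)) <-> m = oppz (floorv x).
Proof.
have -> : intvec m = vopp (intvec (oppz m)) :> euclid R l.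
  by apply: euclid_ext => i; rewrite !ecoordE rmorphN opprK.
split; first by move=> /cube_subz <-; apply: intvec_ext => i; rewrite !ecoordE opprK.
by move=> ->; apply/cube_subz; apply: intvec_ext => i; rewrite !ecoordE opprK.
Qed.

Lemma measurable_vadd s : measurable_fun setT (vadd ^~ s : euclid R l -> euclid R l).
Proof. by have [] := preserving_translation s. Qed.

Let mcomp (F : euclid R l -> \bar R) (f : euclid R l -> euclid R l) :
  measurable_fun setT F -> measurable_fun setT f -> measurable_fun setT (fun x => F (f x)).
Proof. exact: measurableT_comp. Qed.

Let mcubeF (F : euclid R l -> \bar R) s : measurable_fun setT F ->
  measurable_fun setT (fun x => F x * (\1_cube (vadd x s))%:E)%E.
Proof.
move=> mF; apply: emeasurable_funM => //; apply/measurable_EFinP.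
apply: (measurableT_comp (f := \1_cube : euclid R l -> R)); last exact: measurable_vadd.
by apply: measurable_indic; exact: cube_measurable.
Qed.

Let indic_ge0 (F : euclid R l -> \bar R) y x : (0 <= F x)%E ->
  (0 <= F x * (\1_cube y)%:E)%E.
Proof. by move=> F0; rewrite mule_ge0// lee_fin indicE. Qed.

Lemma integral_cells (F : euclid R l -> \bar R) : measurable_fun setT F ->
  (forall x, 0 <= F x)%E ->
  (\int[mu]_x F x = \esum_(m in [set: l.-tuple int]) \int[nu]_x F (vadd x (intvec m)))%E.
Proof.
move=> mF F0.
transitivity (\int[mu]_x \esum_(m in [set: l.-tuple int])
   (F x * (\1_cube (vadd x (vopp (intvec m))))%:E))%E.
  apply: eq_integral => x _; apply/esym.
  apply: (@esum_single _ _ (floorv x)) => // m; rewrite indicE.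
  have [/cube_subz cm|nm] := eqVneq m (floorv x); first by rewrite mem_set ?mule1.
  by rewrite memNset ?mule0// => /cube_subz/eqP; rewrite (negPf nm).
rewrite integral_esum; last 2 first.
- by move=> m; exact: mcubeF.
- by move=> m x; exact: indic_ge0.
apply: eq_esum => m _.
rewrite -(preserving_integral (preserving_translation (intvec m))); last 2 first.
- exact: mcubeF.
- by move=> x; exact: indic_ge0.
rewrite cube_integral//; last exact: mcomp (measurable_vadd _).
by apply: eq_integral => x _; rewrite vaddK.
Qed.

(** The translated cube is cut along the integer cells; periodicity moves the pieces back, and they
    tile the unit cube. *)
Lemma integral_periodic_shift (F : euclid R l -> \bar R) s : measurable_fun setT F ->
  (forall x, 0 <= F x)%E -> (forall m x, F (vadd x (intvec m)) = F x) ->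
  (\int[nu]_x F (vadd x s) = \int[nu]_x F x)%E.
Proof.
move=> mF F0 Fp.
rewrite cube_integral//; last exact: mcomp (measurable_vadd _).
transitivity (\int[mu]_x (F x * (\1_cube (vadd x (vopp s)))%:E))%E.
  rewrite -[RHS](preserving_integral (preserving_translation s)).
  - by apply: eq_integral => x _; rewrite vaddK.
  - exact: mcubeF.
  - by move=> x; exact: indic_ge0.
rewrite integral_cells; last 2 first.
- exact: mcubeF.
- by move=> x; exact: indic_ge0.
under eq_esum => m _.
  under eq_integral => x _ do rewrite Fp vaddAC.
  over.
rewrite -integral_esum; last 2 first.
- move=> m; apply: emeasurable_funM => //; apply/measurable_EFinP.
  apply: (measurableT_comp (f := \1_cube : euclid R l -> R)).
    by apply: measurable_indic; exact: cube_measurable.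
  exact: (measurableT_comp (measurable_vadd _) (measurable_vadd _)).
- by move=> m x; exact: indic_ge0.
apply: eq_integral => x _.
apply: (@esum_single _ _ (oppz (floorv (vadd x (vopp s))))) => // m; rewrite indicE.
have [/cube_addz cm|nm] := eqVneq m _; first by rewrite mem_set ?mule1.
by rewrite memNset ?mule0// => /cube_addz/eqP; rewrite (negPf nm).
Qed.

Lemma cint_periodic_shift (F : euclid R l -> R[i]) s : cmeas F ->
  (forall m x, F (vadd x (intvec m)) = F x) ->
  cint nu (fun x => F (vadd x s)) = cint nu F.
Proof.
move=> [mr mi] Fp.
have h (f : euclid R l -> R) : measurable_fun setT f ->
    (forall m x, f (vadd x (intvec m)) = f x) ->
    \int[nu]_x f (vadd x s) = \int[nu]_x f x.
  move=> mf fp; rewrite /Rintegral; congr fine.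
  have mfe : measurable_fun setT (EFin \o f) by exact/measurable_EFinP.
  rewrite integralE [RHS]integralE; congr (_ - _)%E.
  - transitivity (\int[nu]_x ((EFin \o f)^\+ (vadd x s)))%E.
      by apply: eq_integral => x _; rewrite !funeposE.
    rewrite integral_periodic_shift//; first exact: measurable_funepos.
    by move=> m x; rewrite !funeposE/= fp.
  - transitivity (\int[nu]_x ((EFin \o f)^\- (vadd x s)))%E.
      by apply: eq_integral => x _; rewrite !funenegE.
    rewrite integral_periodic_shift//; first exact: measurable_funeneg.
    by move=> m x; rewrite !funenegE/= fp.
apply: complex_ext.
- by apply: (h (fun x => complex.Re (F x))) => // m x; rewrite Fp.
- by apply: (h (fun x => complex.Im (F x))) => // m x; rewrite Fp.
Qed.

Definition chr n x : R[i] := cis (2 * pi * dot (intvec n) x).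

Lemma chr_periodic n m x : chr n (vadd x (intvec m)) = chr n x.
Proof. by rewrite /chr dotDr mulrDr cisD cis_dot_intvec mulr1. Qed.

Lemma measurable_dot d (X : measurableType d) (f : X -> euclid R l) xi :
  measurable_fun setT f -> measurable_fun setT (fun z => dot xi (f z)).
Proof.
move=> mf; apply: measurable_sum => i; apply: measurable_funM; first exact: measurable_cst.
exact: (measurableT_comp (measurable_ecoord i) mf).
Qed.

Lemma chr_meas n : cmeas (chr n).
Proof.
apply: cmeas_cis; apply: measurable_funM; first exact: measurable_cst.
by apply: measurable_dot; exact: measurable_id.
Qed.

Lemma normc_chr n x : normc (chr n x) = 1.
Proof. exact: normc_cis. Qed.

Lemma cint_cst (c : R[i]) : cint nu (fun=> c) = c.
Proof.
have h (r : R) : \int[nu]_x r = r.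
  rewrite Rintegral_cst//; transitivity (r * fine (nu setT)) => //.
  by rewrite cube_total mulr1.
by apply: complex_ext; rewrite /cint /= h.
Qed.

Lemma cint_chr n : cint nu (chr n) = (n == [tuple 0 | i < l])%:R.
Proof.
have [->|n0] := eqVneq.
  rewrite (_ : chr _ = fun=> 1) ?cint_cst//.
  apply/funext => x; rewrite /chr (_ : dot _ _ = 0) ?mulr0 ?cis0//.
  by apply: big1 => i _; rewrite !ecoordE tnth_mktuple mul0r.
have [k nk] : exists k, tnth n k != 0.
  apply: contrapT => h; move/eqP: n0; apply; apply: intvec_ext => i.
  by rewrite tnth_mktuple; apply: contrapT => /eqP ni; apply: h; exists i.
have nkR : (tnth n k)%:~R != 0 :> R by rewrite intr_eq0.
set c := cint nu (chr n).
have : c = - c.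
  (* A shift by half a period along a coordinate with [n_k] nonzero changes the sign of the
     character. *)
  rewrite {1}/c -(@cint_periodic_shift _ (kvec k (1 / (2 * (tnth n k)%:~R)))).
  - rewrite (_ : (fun x => _) = fun x => - 1 * chr n x).
      rewrite cintZ ?mulN1r//; apply: cL1P; first exact: chr_meas.
      under eq_integral do rewrite normc_chr.
      rewrite integral_cst// (_ : (_ * _)%E = (1 * nu setT)%E)//.
      by rewrite cube_total mule1 ltry.
    apply/funext => x; rewrite /chr dotDr mulrDr cisD mulrC; congr (_ * _).
    rewrite dot_kvecr !ecoordE (_ : 2 * pi * _ = pi); last by field.
    by rewrite /cis cospi sinpi; apply: complex_ext; rewrite /= ?oppr0.
  - exact: chr_meas.
  - by move=> m x; exact: chr_periodic.
by move=> cN; have /eqP := subrr c; rewrite {2}cN opprK -mulr2n mulrn_eq0 => /eqP.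
Qed.

End cells.

Section complex_fubini.
Context d1 d2 (X : measurableType d1) (Y : measurableType d2) (R : realType).
Variable m1 : {sigma_finite_measure set X -> \bar R}.
Variable m2 : {sigma_finite_measure set Y -> \bar R}.

Let fubini_real (f : X * Y -> R) : (m1 \x m2)%E.-integrable setT (EFin \o f) ->
  \int[(m1 \x m2)%E]_z f z = \int[m1]_x \int[m2]_y f (x, y).
Proof.
move=> iF; rewrite /Rintegral -(integral12_prod_meas1 iF); congr fine.
have iFF := integrable_fubini_F iF.
apply: ae_eq_integral => //.
- exact: measurable_fubini_F iF.
- apply/measurable_EFinP; apply: (measurableT_comp (f := fine)) => //.
  exact: measurable_fubini_F iF.
- have := integrable_ae measurableT iFF; apply: filterS => x /(_ Logic.I) h _.
  by rewrite /fubini_F/= fineK.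
Qed.

Let fubini_real2 (f : X * Y -> R) : (m1 \x m2)%E.-integrable setT (EFin \o f) ->
  \int[(m1 \x m2)%E]_z f z = \int[m2]_y \int[m1]_x f (x, y).
Proof.
move=> iF; rewrite /Rintegral -(integral21_prod_meas1 iF); congr fine.
have mG := measurable_fubini_G iF.
apply: ae_eq_integral => //.
- apply/measurable_EFinP; apply: (measurableT_comp (f := fine)) => //.
- have := ae_integrable2 iF; apply: filterS => y iy _.
  by rewrite /fubini_G/= fineK//; exact: integrable_fin_num.
Qed.

Lemma cint_fubini1 (F : X * Y -> R[i]) : cL1 (m1 \x m2)%E F ->
  cint (m1 \x m2)%E F = cint m1 (fun x => cint m2 (fun y => F (x, y))).
Proof. by move=> [ir ii]; apply: complex_ext; rewrite /cint /= fubini_real. Qed.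

Lemma cint_fubini2 (F : X * Y -> R[i]) : cL1 (m1 \x m2)%E F ->
  cint (m1 \x m2)%E F = cint m2 (fun y => cint m1 (fun x => F (x, y))).
Proof. by move=> [ir ii]; apply: complex_ext; rewrite /cint /= fubini_real2. Qed.

End complex_fubini.

(** * Orthonormal expansions on the cube *)

Section orthonormal.
Context d (X : measurableType d) (R : realType) (mu : {measure set X -> \bar R}).
Variables (I : eqType) (E : I -> X -> R[i]).
Hypothesis LE : forall i, cL2 mu (E i).
Hypothesis orthE : forall i j, ip mu (E i) (E j) = (i == j)%:R.
Implicit Types (h : X -> R[i]) (c : I -> R[i]) (J : seq I).

Let LcE c J : cL2 mu (fun x => \sum_(i <- J) c i * E i x).
Proof. by apply: cL2_sum => i; exact: cL2Z. Qed.

Lemma n2_lincomb c J : uniq J ->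
  n2 mu (fun x => \sum_(i <- J) c i * E i x) = \sum_(i <- J) normc (c i) ^+ 2.
Proof.
move=> uJ; apply: (@complexI R); rewrite -ipxx// rmorph_sum/=.
rewrite ip_suml//; last by move=> i; exact: cL2Z.
apply: eq_big_seq => i iJ.
rewrite ip_sumr//; [|by move=> j; exact: cL2Z|exact: cL2Z].
rewrite (bigD1_seq i)//= big1 ?addr0 => [|j /negPf ji].
  by rewrite ipZl ?ipZr ?orthE ?eqxx ?mulr1 ?mul_conjc//; exact: cL2Z.
by rewrite ipZl ?ipZr ?orthE 1?eq_sym ?ji ?mulr0//; exact: cL2Z.
Qed.

(** Completing the square separates the distance of [h] to the span from the error of the
    coefficients; Bessel's inequality and the optimality of the Fourier coefficients both follow. *)
Lemma n2_sub_lincomb h c J : uniq J -> cL2 mu h ->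
  n2 mu (fun x => h x - \sum_(i <- J) c i * E i x) =
  n2 mu h - \sum_(i <- J) normc (ip mu h (E i)) ^+ 2
    + \sum_(i <- J) normc (c i - ip mu h (E i)) ^+ 2.
Proof.
move=> uJ Lh; rewrite n2B// n2_lincomb// ip_sumr//; last by move=> i; exact: cL2Z.
under eq_bigr do rewrite ipZr//.
rewrite cRe_sum -!addrA; congr (_ + _).
rewrite mulr_sumr -!sumrN -!big_split/=; apply: eq_bigr => i _.
by rewrite !sqr_normcE !(cReM, cImM, cReD, cImD, cReN, cImN, cReJ, cImJ); ring.
Qed.

Lemma bessel h J : uniq J -> cL2 mu h ->
  \sum_(i <- J) normc (ip mu h (E i)) ^+ 2 <= n2 mu h.
Proof.
move=> uJ Lh; have := n2_ge0 mu (fun x => h x - \sum_(i <- J) ip mu h (E i) * E i x).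
rewrite (n2_sub_lincomb (fun i => ip mu h (E i)))//.
rewrite [X in _ + X]big1 ?addr0 ?subr_ge0// => i _.
by rewrite subrr normc0 expr0n.
Qed.

End orthonormal.

(** Products of trigonometric polynomials repeat frequencies, whereas orthonormality is applied to
    sums over distinct ones. *)
Lemma sum_collect (I : eqType) (V : comPzRingType) (s : seq (V * I)) (E : I -> V) :
  \sum_(a <- s) a.1 * E a.2 =
  \sum_(i <- undup [seq a.2 | a <- s]) (\sum_(a <- s | a.2 == i) a.1) * E i.
Proof.
under [RHS]eq_bigr do rewrite mulr_suml big_mkcond.
rewrite exchange_big/=; apply: eq_big_seq => a aS.
rewrite (bigD1_seq a.2) ?undup_uniq//=; last by rewrite mem_undup map_f.
by rewrite eqxx big1 ?addr0// => i; rewrite eq_sym => /negPf ->.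
Qed.

Section character_density.
Context d (X : measurableType d) (R : realType).
Variable mu : {measure set X -> \bar R}.
Variable w : X -> R.
Hypothesis w0 : forall x, 0 <= w x.
Hypothesis iw : mu.-integrable setT (EFin \o w).
Variable (I : finType) (xi : I -> X -> R).
Hypothesis gen : @measurable _ X = <<s lower_boxes xi >>.
Hypothesis wD : forall x, w x != 0 -> forall i, 0 <= xi i x < 1.
Variables (K : eqType) (E : K -> X -> R[i]) (one : K) (op : K -> K -> K) (u : I -> bool -> K).
Hypothesis mE : forall k, cmeas (E k).
Hypothesis E1 : forall x, E one x = 1.
Hypothesis EM : forall k j x, E (op k j) x = E k x * E j x.
Hypothesis Eu : forall i b x, E (u i b) x = cis ((-1) ^+ b * (2 * pi * xi i x)).

Let span : set (X -> R[i]) :=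
  [set p | exists s : seq (R[i] * K), p = fun x => \sum_(a <- s) a.1 * E a.2 x].

Lemma character_dense (f : X -> R[i]) : cmeas f ->
  mu.-integrable setT (fun x => (normc (f x) ^+ 2 * w x)%:E) ->
  forall e : R, 0 < e -> exists J (c : K -> R[i]), uniq J /\
    (\int[mu]_x (normc (f x - \sum_(k <- J) c k * E k x) ^+ 2 * w x)%:E < e%:E)%E.
Proof.
move=> mf fw e e0.
have [] := @approximable_L2 _ X R mu w w0 iw I xi gen wD span _ _ _ _ _ f mf fw.
- by move=> _ [s ->]; apply: cmeas_sum => a; apply: cmeasM => //; exact: cmeas_cst.
- move=> c; exists [:: (c, one)]; apply/funext => x.
  by rewrite big_seq1 E1 mulr1.
- move=> _ _ [s ->] [t ->]; exists (s ++ t); apply/funext => x.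
  by rewrite big_cat.
- move=> _ _ [s ->] [t ->].
  exists [seq (a.1 * b.1, op a.2 b.2) | a <- s, b <- t]; apply/funext => x.
  rewrite big_allpairs_dep mulr_suml; apply: eq_bigr => a _.
  by rewrite mulr_sumr; apply: eq_bigr => b _; rewrite EM mulrACA.
- move=> i s [->|->]; [exists [:: (1, u i false)]|exists [:: (1, u i true)]];
    by apply/funext => x; rewrite big_seq1 /= Eu ?expr0 ?expr1 !mul1r.
move=> _ /(_ e e0)[_ [s ->] hs].
exists (undup [seq a.2 | a <- s]), (fun k => \sum_(a <- s | a.2 == k) a.1).
split; first exact: undup_uniq.
by under eq_integral => x _ do rewrite -(sum_collect s (fun k => E k x)).
Qed.

End character_density.

Section parseval.
Context {R : realType} {l : nat}.
Local Notation nu := (@cube_measure_restr R l).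
Local Notation cube := (@cube R l).
Local Notation ZZ := (l.-tuple int).
Implicit Types (x y s xi : euclid R l) (m n : ZZ) (k : 'I_l).

Definition zeroz : ZZ := [tuple 0 | i < l].
Definition unitz k (b : bool) : ZZ := [tuple if i == k then (-1) ^+ b else 0 | i < l].

Lemma chr0 x : chr zeroz x = 1.
Proof.
rewrite /chr (_ : dot _ _ = 0) ?mulr0 ?cis0//.
by apply: big1 => i _; rewrite !ecoordE tnth_mktuple mul0r.
Qed.

Lemma chrD m n x : chr (addz m n) x = chr m x * chr n x.
Proof. by rewrite /chr intvecD dotDl mulrDr cisD. Qed.

Lemma chrN m x : chr (oppz m) x = ((chr m x)^*)%C.
Proof. by rewrite /chr intvecN dotNl mulrN cisN. Qed.

Lemma chr_unit k b x : chr (unitz k b) x = cis ((-1) ^+ b * (2 * pi * ecoord x k)).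
Proof.
rewrite /chr (_ : dot _ _ = (-1) ^+ b * ecoord x k); first by congr cis; ring.
rewrite /dot (bigD1 k)//= big1 ?addr0 => [|i /negPf ik].
  by rewrite !ecoordE tnth_mktuple eqxx rmorphXn/= rmorphN.
by rewrite !ecoordE tnth_mktuple ik mul0r.
Qed.

Lemma cL2_bounded (F : euclid R l -> R[i]) (b : R) : cmeas F ->
  (forall x, normc (F x) <= b) -> cL2 nu F.
Proof.
move=> mF Fb; apply: (@cL2_bound _ _ _ nu F (fun=> b ^+ 2)) => //.
  by apply: finite_measure_integrable_cst.
move=> x; rewrite ler_sqr ?nnegrE ?normc_ge0// (le_trans (normc_ge0 _) (Fb x))//.
Qed.

Lemma chr_L2 n : cL2 nu (chr n).
Proof. by apply: (@cL2_bounded _ 1); [exact: chr_meas|move=> x; rewrite normc_chr]. Qed.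

Lemma chr_orth m n : ip nu (chr m) (chr n) = (m == n)%:R.
Proof.
rewrite /ip (_ : (fun x => _) = chr (addz m (oppz n))); last first.
  by apply/funext => x; rewrite chrD chrN.
rewrite cint_chr; congr ((nat_of_bool _)%:R); apply/eqP/eqP => [h|->].
  apply: intvec_ext => i; have := congr1 (fun t : ZZ => tnth t i) h.
  by rewrite !ecoordE tnth_mktuple => /eqP; rewrite subr_eq0 => /eqP.
by apply: intvec_ext => i; rewrite !ecoordE tnth_mktuple subrr.
Qed.

Lemma cube_weight (F : euclid R l -> R[i]) : cmeas F ->
  (\int[nu]_x (normc (F x) ^+ 2 * \1_cube x)%:E = sql2 nu F)%E.
Proof.
move=> mF; have mF2 := measurable_sqr_normc mF.
apply: ge0_ae_eq_integral => //.
- apply/measurable_EFinP; apply: measurable_funM => //.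
  by apply: measurable_indic; exact: cube_measurable.
- exact/measurable_EFinP.
- by move=> x _; rewrite lee_fin mulr_ge0 ?sqr_ge0// indicE.
- by move=> x _; rewrite lee_fin sqr_ge0.
- apply/cube_ae; apply: aeW => x cx _.
  by rewrite indicE mem_set// mulr1.
Qed.

Lemma chr_dense (h : euclid R l -> R[i]) (e : R) : cL2 nu h -> 0 < e ->
  exists J (c : ZZ -> R[i]), uniq J /\
    (sql2 nu (fun x => h x - \sum_(n <- J) c n * chr n x)%R < e%:E)%E.
Proof.
move=> Lh e0; have mh := cL2_meas Lh.
have iw : nu.-integrable setT (EFin \o (\1_cube : euclid R l -> R)).
  by apply: integrable_indic => //; exact: cube_measurable.
have := @character_dense _ (euclid R l) R nu \1_cube _ iw 'I_l
  (fun i x => ecoord x i) euclid_gen_lower_boxes _ ZZ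
  chr zeroz addz unitz (@chr_meas R l) chr0 _ chr_unit h mh.
case/(_ _ _ _ _ e e0).
- by move=> x; rewrite indicE.
- by move=> x; rewrite indicE; case: (boolP (x \in cube)); rewrite ?inE ?eqxx.
- by move=> k j x; exact: chrD.
- have ih := cL2_int Lh.
  apply: (le_integrable measurableT _ _ ih).
    apply/measurable_EFinP/measurable_funM; first exact: measurable_sqr_normc.
    by apply: measurable_indic; exact: cube_measurable.
  move=> x _; rewrite /= lee_fin normrM ler_piMr// indicE.
  by case: (x \in cube); rewrite ?normr1 ?normr0.
move=> J [c [uJ]]; rewrite cube_weight => [hJ|]; first by exists J, c.
apply: cmeasB => //; apply: cmeas_sum => n; apply: cmeasM; first exact: cmeas_cst.
exact: chr_meas.
Qed.

(** Bessel's inequality in one direction. In the other, a trigonometric polynomial close to [h] is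
    at least as far from it as the Fourier sum over the same frequencies. *)
Lemma parseval (h : euclid R l -> R[i]) : cL2 nu h ->
  (\esum_(n in [set: ZZ]) (normc (ip nu h (chr n)) ^+ 2)%:E = sql2 nu h)%E.
Proof.
move=> Lh; have LE := chr_L2; have oE := chr_orth.
apply/eqP; rewrite eq_le; apply/andP; split.
  apply: ge_ereal_sup => _ [F [finF _] <-].
  rewrite fsbig_finite//= sumEFin sql2E// lee_fin.
  exact: (bessel LE oE (fset_uniq _) Lh).
apply/lee_addgt0Pr => e e0; have [J [c [uJ hJ]]] := chr_dense Lh e0.
apply: (@le_trans _ _ ((\sum_(n <- J) normc (ip nu h (chr n)) ^+ 2)%:E + e%:E)%E).
  move: hJ; rewrite !sql2E//; last first.
    by apply: cL2B => //; apply: cL2_sum => n; exact: cL2Z.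
  rewrite (n2_sub_lincomb LE oE)// -EFinD lte_fin lee_fin => hJ.
  have : 0 <= \sum_(i <- J) normc (c i - ip nu h (chr i)) ^+ 2.
    by apply: sumr_ge0 => i _; exact: sqr_ge0.
  lra.
rewrite leeD2r//; apply: esum_ge; exists [set` J]; first by split => //; exact: finite_seq.
by rewrite -fsbig_seq// sumEFin.
Qed.

End parseval.

(** * The Zak transform *)

Section parametric_integral.
Context d1 d2 (X : measurableType d1) (Y : measurableType d2) (R : realType).
Variable m1 : {sigma_finite_measure set X -> \bar R}.

Let mreal (f : X * Y -> R) : measurable_fun setT f ->
  measurable_fun setT (fun y => \int[m1]_x f (x, y)).
Proof.
move=> mf; have mfe : measurable_fun setT (EFin \o f) by exact/measurable_EFinP.
apply: (measurableT_comp (f := fine)) => //.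
rewrite (_ : (fun y => _) = fun y => (\int[m1]_x ((EFin \o f)^\+ (x, y)) -
    \int[m1]_x ((EFin \o f)^\- (x, y)))%E); last first.
  apply/funext => y; rewrite integralE; congr (_ - _)%E.
  - by apply: eq_integral => x _; rewrite !funeposE.
  - by apply: eq_integral => x _; rewrite !funenegE.
apply: emeasurable_funB.
- apply: (measurable_fun_fubini_tonelli_G ((EFin \o f)^\+)%E) => //.
  exact: measurable_funepos.
- apply: (measurable_fun_fubini_tonelli_G ((EFin \o f)^\-)%E) => //.
  exact: measurable_funeneg.
Qed.

(** Tonelli's theorem makes the integrals of positive and negative parts measurable in the
    parameter, also where they are infinite. *)
Lemma cmeas_cint (F : X * Y -> R[i]) : cmeas F -> cmeas (fun y => cint m1 (fun x => F (x, y))).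
Proof.
move=> [mr mi]; split; first exact: (mreal (f := fun z => complex.Re (F z)) mr).
exact: (mreal (f := fun z => complex.Im (F z)) mi).
Qed.

End parametric_integral.

Section compact_support.
Context {R : realType} {l : nat}.
Local Notation mu := (lebesgue_euclid R l).
Local Notation nu := (@cube_measure_restr R l).
Local Notation cube := (@cube R l).
Local Notation ZZ := (l.-tuple int).
Implicit Types (x y s xi : euclid R l) (m n : ZZ) (k : 'I_l) (f g : euclid R l -> R[i]).

(** Imposed at every point, so that the sums over [Z^l] below are finite everywhere and not only
    almost everywhere. *)
Definition bsupp (D : nat) f : Prop := forall x, f x != 0 -> forall i, `|ecoord x i| <= D%:R.

Definition boxz (N : nat) : seq ZZ :=
  map (fun t : l.-tuple 'I_(2 * N).+1 => [tuple (tnth t i : nat)%:Z - N%:Z | i < l] : ZZ)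
    (enum {: l.-tuple 'I_(2 * N).+1}).

Lemma boxz_uniq N : uniq (boxz N).
Proof.
rewrite map_inj_uniq ?enum_uniq// => s t st; apply: eq_from_tnth => i.
have := congr1 (fun u : ZZ => tnth u i) st; rewrite !tnth_mktuple => /addIr [].
by move=> /val_inj.
Qed.

Lemma mem_boxz N m : (m \in boxz N) = [forall i, (`|tnth m i| <= N)%N].
Proof.
apply/mapP/forallP => [[t _ ->] i|h].
  rewrite tnth_mktuple; move: (nat_of_ord (tnth t i)) (ltn_ord (tnth t i)) => a.
  by lia.
have h2 i : (absz (tnth m i + N%:Z)%R < (2 * N).+1)%N by have := h i; move: (tnth m i) => a; lia.
exists [tuple Ordinal (h2 i) | i < l]; first by rewrite mem_enum.
apply: intvec_ext => i; rewrite !tnth_mktuple/=.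
by have := h i; move: (tnth m i) => a; lia.
Qed.

Lemma bsupp_boxz D r f x m : bsupp D f -> (forall i, `|ecoord x i| <= r%:R) ->
  m \notin boxz (D + r) -> f (vadd x (intvec m)) = 0.
Proof.
move=> fD xr; rewrite mem_boxz => /forallPn [j]; rewrite -ltnNge => mj.
apply/eqP; apply: contraTT mj => /fD /(_ j); rewrite !ecoordE -leqNgt => h.
rewrite -(ler_nat R) natrD.
have -> : (`|tnth m j|%N)%:R = `|(tnth m j)%:~R : R|.
  by rewrite -intr_norm -[RHS]/(`|tnth m j|%:~R) -abszE -pmulrn.
rewrite (_ : (tnth m j)%:~R = (ecoord x j + (tnth m j)%:~R) - ecoord x j); last by ring.
by rewrite (le_trans (ler_normB _ _))// lerD.
Qed.

Lemma cube_bound x : cube x -> forall i, `|ecoord x i| <= (1%N)%:R.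
Proof. by move=> cx i; have /andP[h1 h2] := cx i; rewrite ger0_norm// ltW. Qed.

(* A sum over the support of its terms: it is finite when [f] has bounded
   support, and has the junk value 0 when infinitely many terms are nonzero. *)
Definition zak f x y : R[i] :=
  \sum_(m \in [set: ZZ]) f (vadd x (intvec m)) * ((chr m y)^*)%C.

Lemma zakE D r N f x y : bsupp D f -> (forall i, `|ecoord x i| <= r%:R) -> (D + r <= N)%N ->
  zak f x y = \sum_(m <- boxz N) f (vadd x (intvec m)) * ((chr m y)^*)%C.
Proof.
move=> fD xr DN; rewrite fsbig_seq ?boxz_uniq//; apply/esym/fsbig_widen => //.
move=> m [_ /= /negP mN]; rewrite (bsupp_boxz fD xr) ?mul0r//.
apply: contra mN; rewrite !mem_boxz => /forallP h; apply/forallP => i.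
exact: leq_trans (h i) DN.
Qed.

(** This phase is the source of the winding in [grid_err]. *)
Lemma zak_shiftx f x y n : zak f (vadd x (intvec n)) y = chr n y * zak f x y.
Proof.
rewrite /zak mulr_fsumr (reindex_fsbigT (fun m => addz m (oppz n))).
  apply: eq_fsbigr => m _; rewrite chrD chrN conjcM conjcK.
  rewrite (_ : vadd (vadd x _) _ = vadd x (intvec m)); first by ring.
  by apply: euclid_ext => i; rewrite !ecoordE intrD rmorphN/=; ring.
exists (fun m => addz m n) => m; apply: intvec_ext => i; rewrite !ecoordE; ring.
Qed.

Lemma zak_shifty f x y n : zak f x (vadd y (intvec n)) = zak f x y.
Proof. by apply: eq_fsbigr => m _; rewrite chr_periodic. Qed.

Lemma nat_bound x : exists r : nat, forall i, `|ecoord x i| <= r%:R.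
Proof.
pose M := \sum_(i < l) `|ecoord x i|.
have M0 : 0 <= M by exact: sumr_ge0.
exists (Num.truncn M).+1 => i.
rewrite (le_trans _ (ltW (truncnS_gt M)))//.
by rewrite /M (bigD1 i)//= lerDl sumr_ge0.
Qed.

Lemma cmeas_comp d d' (X : measurableType d) (Y : measurableType d') (F : Y -> R[i]) (h : X -> Y) :
  cmeas F -> measurable_fun setT h -> cmeas (fun z => F (h z)).
Proof. by move=> [mr mi] mh; split; [exact: (measurableT_comp mr mh)|exact: (measurableT_comp mi mh)]. Qed.

(** At each point, the finite sums over [boxz N] are eventually equal to [zak f]. *)
Lemma zak_meas D f : cmeas f -> bsupp D f ->
  cmeas (fun z : euclid R l * euclid R l => zak f z.1 z.2).
Proof.
move=> mf fD.
pose F (N : nat) (z : euclid R l * euclid R l) :=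
  \sum_(m <- boxz N) f (vadd z.1 (intvec m)) * ((chr m z.2)^*)%C.
have mF N : cmeas (F N).
  apply: cmeas_sum => m; apply: cmeasM.
    exact: (cmeas_comp (h := fun z => vadd z.1 (intvec m)) mf
      (measurableT_comp (measurable_vadd _) measurable_fst)).
  by apply: cmeasJ; exact: (cmeas_comp (h := snd) (chr_meas m) measurable_snd).
have FE z : \forall N \near \oo, zak f z.1 z.2 = F N z.
  have [r zr] := nat_bound z.1; exists (D + r)%N => // N /= DN.
  exact: zakE fD zr DN.
split.
- apply: (@measurable_fun_cvg _ _ _ _ (fun N z => complex.Re (F N z))).
    by move=> N; case: (mF N).
  by move=> z _; apply: cvg_near_cst; apply: filterS (FE z) => N ->.
- apply: (@measurable_fun_cvg _ _ _ _ (fun N z => complex.Im (F N z))).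
    by move=> N; case: (mF N).
  by move=> z _; apply: cvg_near_cst; apply: filterS (FE z) => N ->.
Qed.

Lemma zak_meas1 D f y : cmeas f -> bsupp D f -> cmeas (fun x => zak f x y).
Proof.
move=> mf fD; apply: (cmeas_comp (h := fun x => (x, y)) (zak_meas mf fD)).
by apply: measurable_fun_pair => //; exact: measurable_cst.
Qed.

Lemma conj_chr_orth m n :
  ip nu (fun x => ((chr m x)^*)%C) (fun x => ((chr n x)^*)%C) = (m == n)%:R.
Proof.
by rewrite eq_sym -(@chr_orth R l n m); congr cint; apply/funext => x; rewrite conjcK mulrC.
Qed.

Lemma conj_chr_L2 m : cL2 nu (fun x => ((chr m x)^*)%C).
Proof.
apply: (@cL2_bounded _ _ _ 1); first by apply: cmeasJ; exact: chr_meas.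
by move=> x; rewrite normc_conj normc_chr.
Qed.

Lemma zak_fiber D f x : bsupp D f -> cube x ->
  sql2 nu (fun y => zak f x y) =
  (\sum_(m <- boxz D.+1) normc (f (vadd x (intvec m))) ^+ 2)%:E.
Proof.
move=> fD cx; rewrite -(n2_lincomb conj_chr_L2) ?boxz_uniq//; last first.
  by move=> i j; rewrite conj_chr_orth.
rewrite -sql2E; last first.
  by apply: cL2_sum => m; apply: cL2Z; exact: conj_chr_L2.
by apply: eq_sql2 => y; rewrite (zakE _ fD (cube_bound cx) (leqnn _)) addn1.
Qed.

Lemma esum_boxz (N : nat) (a : ZZ -> \bar R) : (forall m, 0 <= a m)%E ->
  (forall m, m \notin boxz N -> a m = 0%E) ->
  (\esum_(m in [set: ZZ]) a m = \sum_(m <- boxz N) a m)%E.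
Proof.
move=> a0 aN; rewrite fsbig_seq ?boxz_uniq// -esum_fset; [|exact: finite_seq|by move=> m _; exact: a0].
rewrite [RHS]esum_mkcond; apply: eq_esum => m _.
by case: ifPn => // /negP mN; rewrite aN//; apply/negP => h; apply: mN; rewrite inE.
Qed.

Lemma sql2_cells f : cmeas f ->
  (sql2 mu f = \esum_(m in [set: ZZ]) sql2 nu (fun x => f (vadd x (intvec m))))%E.
Proof.
move=> mf; apply: integral_cells; first exact/measurable_EFinP/measurable_sqr_normc.
by move=> x; rewrite lee_fin sqr_ge0.
Qed.

Lemma cL2_cell f m : cL2 mu f -> cL2 nu (fun x => f (vadd x (intvec m))).
Proof.
move=> [mf foo]; split; first exact: cmeas_comp mf (measurable_vadd _).
apply: le_lt_trans foo; rewrite sql2_cells//; apply: esum_ge.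
exists [set m]; first by split => //; exact: finite_set1.
by rewrite fsbig_set1.
Qed.

Lemma cube_sql2_0 f : cmeas f -> (forall x, cube x -> f x = 0) -> sql2 nu f = 0%E.
Proof.
move=> mf f0; have m0 : cmeas (fun _ : euclid R l => 0 : R[i]) by exact: cmeas_cst.
rewrite (ae_eq_sql2 mf m0); last by apply/cube_ae; apply: aeW => x; exact: f0.
by rewrite /sql2 integral0_eq// => x _; rewrite normc0 expr0n.
Qed.

Lemma sql2_boxz D f : cmeas f -> bsupp D f ->
  (sql2 mu f = \sum_(m <- boxz D.+1) sql2 nu (fun x => f (vadd x (intvec m))))%E.
Proof.
move=> mf fD; rewrite sql2_cells// (@esum_boxz D.+1)//; first by move=> m; exact: sql2_ge0.
move=> m mN; apply: cube_sql2_0; first exact: cmeas_comp mf (measurable_vadd _).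
by move=> x cx; apply: (bsupp_boxz fD (cube_bound cx)); rewrite addn1.
Qed.

(** Parseval in [y] turns the fibre over [x] into the sum of [|f| ^ 2] over [x + Z^l]; integrating
    over [x] in the cube then covers the whole space. *)
Lemma zak_isometry D f : cmeas f -> bsupp D f ->
  (\int[nu]_x \int[nu]_y (normc (zak f x y) ^+ 2)%:E = sql2 mu f)%E.
Proof.
move=> mf fD; have mz := measurable_sqr_normc (zak_meas mf fD).
have mze : measurable_fun setT (fun z : euclid R l * euclid R l =>
    (normc (zak f z.1 z.2) ^+ 2)%:E) by exact/measurable_EFinP.
have mfm m : measurable_fun setT (fun x => (normc (f (vadd x (intvec m))) ^+ 2)%:E).
  by apply/measurable_EFinP/measurable_sqr_normc; exact: cmeas_comp mf (measurable_vadd _).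
have z0 (z : euclid R l * euclid R l) : (0 <= (normc (zak f z.1 z.2) ^+ 2)%:E)%E.
  by rewrite lee_fin sqr_ge0.
have mI := measurable_fun_fubini_tonelli_F (m2 := nu) _ mze z0.
transitivity (\int[nu]_x \sum_(m <- boxz D.+1) (normc (f (vadd x (intvec m))) ^+ 2)%:E)%E.
  apply: ge0_ae_eq_integral => //.
  - by apply: emeasurable_sum => m.
  - by move=> x _; apply: integral_ge0 => y _; rewrite lee_fin sqr_ge0.
  - by move=> x _; apply: sume_ge0 => m _; rewrite lee_fin sqr_ge0.
  - apply/cube_ae; apply: aeW => x cx _.
    by rewrite -[LHS]/(sql2 nu _) (zak_fiber fD cx) sumEFin.
rewrite ge0_integral_sum//; last by move=> m x _; rewrite lee_fin sqr_ge0.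
by rewrite (sql2_boxz mf fD).
Qed.

Lemma zak_gabor f m n x y :
  zak (gabor f (m, n)) x y = chr n x * ((chr m y)^*)%C * zak f x y.
Proof.
rewrite /zak mulr_fsumr (reindex_fsbigT (fun m' => addz m' m)).
  apply: eq_fsbigr => m' _; rewrite /gabor -[cis _]/(chr n (vadd x (intvec (addz m' m)))) -[X in subvec _ (intvec X)]/m chr_periodic chrD conjcM.
  rewrite (_ : subvec _ _ = vadd x (intvec m')); first by ring.
  by apply: euclid_ext => i; rewrite !ecoordE intrD; ring.
exists (fun m' => addz m' (oppz m)) => m'; apply: intvec_ext => i; rewrite !ecoordE; ring.
Qed.

Lemma bsupp_lincomb (I : eqType) (J : seq I) (c : I -> R[i]) (F : I -> euclid R l -> R[i]) D :
  (forall i, i \in J -> bsupp D (F i)) -> bsupp D (fun z => \sum_(i <- J) c i * F i z).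
Proof.
move=> FD z nz k; rewrite leNgt; apply: contraNN nz => zk.
rewrite big_seq big1// => i iJ; rewrite (_ : F i z = 0) ?mulr0//.
by apply/eqP; apply: contraTT zk => /(FD _ iJ)/(_ k); rewrite -leNgt.
Qed.

Lemma zak_lincomb (I : eqType) (J : seq I) (c : I -> R[i]) (F : I -> euclid R l -> R[i]) D x y :
  (forall i, i \in J -> bsupp D (F i)) ->
  zak (fun z => \sum_(i <- J) c i * F i z) x y = \sum_(i <- J) c i * zak (F i) x y.
Proof.
move=> FD; have [r xr] := nat_bound x.
rewrite (zakE _ (bsupp_lincomb (c := c) FD) xr (leqnn _)).
under eq_bigr do rewrite mulr_suml.
rewrite exchange_big/= big_seq [RHS]big_seq; apply: eq_bigr => i iJ.
rewrite (zakE _ (FD _ iJ) xr (leqnn _)) mulr_sumr.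
by apply: eq_bigr => m _; rewrite mulrA.
Qed.

Lemma bsupp_gabor D f (J : seq (ZZ * ZZ)) : bsupp D f ->
  exists D', forall i, i \in J -> bsupp D' (gabor f i).
Proof.
move=> fD; elim: J => [|[m n] J [D' JD]]; first by exists 0%N.
have [r mr] := nat_bound (intvec m).
exists (maxn (D + r) D') => i; rewrite inE => /orP[/eqP ->|iJ] z nz k; last first.
  by rewrite (le_trans (JD _ iJ _ nz k))// ler_nat leq_maxr.
have /fD /(_ k) : f (subvec z (intvec m)) != 0.
  by apply: contra_neq nz => fz; rewrite /gabor /= fz mulr0.
rewrite !ecoordE => h; have := mr k; rewrite ecoordE => h2.
rewrite (@le_trans _ _ (D + r)%:R) ?ler_nat ?leq_maxl// natrD.
rewrite (_ : ecoord z k = (ecoord z k - (tnth m k)%:~R) + (tnth m k)%:~R); last by ring.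
by rewrite (le_trans (ler_normD _ _))// lerD.
Qed.

Lemma gabor_meas f mn : cmeas f -> cmeas (gabor f mn).
Proof.
move=> mf; apply: cmeasM; first exact: chr_meas.
apply: (cmeas_comp mf); apply: measurable_euclid => i.
under eq_fun do rewrite ecoordE.
by apply: measurable_funB; [exact: measurable_ecoord|exact: measurable_cst].
Qed.

Definition zchr (mn : ZZ * ZZ) (z : euclid R l * euclid R l) : R[i] :=
  chr mn.2 z.1 * ((chr mn.1 z.2)^*)%C.

Lemma gabor_combo_zak D f (J : seq (ZZ * ZZ)) (c : ZZ * ZZ -> R[i]) : cmeas f -> bsupp D f ->
  (\int[nu]_x \int[nu]_y (normc (\sum_(i <- J) c i * zchr i (x, y)) ^+ 2
      * normc (zak f x y) ^+ 2)%:E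
   = sql2 mu (fun x => \sum_(i <- J) c i * gabor f i x)%R)%E.
Proof.
move=> mf fD; have [D' JD] := bsupp_gabor J fD.
rewrite -(zak_isometry (D := D')); last 2 first.
- by apply: cmeas_sum => i; apply: cmeasM; [exact: cmeas_cst|exact: gabor_meas].
- exact: bsupp_lincomb.
apply: eq_integral => x _; apply: eq_integral => y _.
rewrite (zak_lincomb c _ _ JD) -exprMn -normcM mulr_suml; congr ((normc _ ^+ 2)%:E).
by apply: eq_bigr => -[m n] _; rewrite zak_gabor mulrA.
Qed.

Definition ball_box (D : R) : set (euclid R l) :=
  [set x | forall i, (`[- D, D]%classic : set (measurableTypeR R)) (ecoord x i)].

Lemma ball_boxE D x : ball_box D x <-> forall i, `|ecoord x i| <= D.
Proof. by split=> h i; have := h i; rewrite /= in_itv/= ler_norml. Qed.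

Lemma ball_box_meas D : measurable (ball_box D).
Proof.
apply: (@mbox_measurable R l (fun=> `[- D, D]%classic : set (measurableTypeR R))) => i.
exact: measurable_itv.
Qed.

Lemma ball_box_integrable (D : nat) : mu.-integrable setT (EFin \o (\1_(ball_box D%:R) : euclid R l -> R)).
Proof.
have mS := ball_box_meas D%:R; set S := ball_box _ in mS *.
have Sfin : (mu S < +oo)%E.
  pose I : set (measurableTypeR R) := `[- D%:R : R, D%:R]%classic.
  have e : mu S = (\prod_(i < l) (@lebesgue_measure R) I)%E.
    by apply: (power_measure_box (@lebesgue_measure R) (A := fun=> I)) => i; exact: measurable_itv.
  rewrite e (_ : (\prod_(i < l) _)%E = (\prod_(i < l) ((D%:R + D%:R : R)%R%:E))%E).
    by rewrite prodEFin ltry.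
  apply: eq_bigr => i _; rewrite lebesgue_measure_itv/= lte_fin.
  have [_|] := ltP; first by rewrite -EFinD opprK.
  move=> nn; have n0 : D%:R <= 0 :> R by lra.
  by rewrite (_ : D%:R = 0 :> R) ?addr0//; apply/eqP; rewrite eq_le n0 ler0n.
apply/integrableP; split; first by apply/measurable_EFinP; exact: measurable_indic.
rewrite (eq_integral (fun x => (\1_S x)%:E)); first by rewrite integral_indic// setIT.
by move=> x _; rewrite /= ger0_norm// indicE.
Qed.

(** [|f| <= |f| ^ 2 + 1] on a box of finite measure that contains the support. *)
Lemma bsupp_cL1 D f : cL2 mu f -> bsupp D f -> cL1 mu f.
Proof.
move=> Lf fD; apply: cL1P; first exact: (cL2_meas Lf).
have iS := ball_box_integrable D; have iF := cL2_int Lf.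
have : mu.-integrable setT (fun x => (normc (f x))%:E).
  apply: (le_integrable measurableT _ _ (integrableD measurableT iF iS)).
    exact/measurable_EFinP/measurable_normc/(cL2_meas Lf).
  move=> x _; rewrite /= lee_fin; have i0 : 0 <= \1_(ball_box D%:R) x :> R by rewrite indicE.
  rewrite [leLHS]ger0_norm ?normc_ge0// [leRHS]ger0_norm ?addr_ge0 ?sqr_ge0//.
  have [->|fx] := eqVneq (f x) 0; first by rewrite normc0 addr_ge0 ?sqr_ge0.
  rewrite indicE mem_set /=; last by apply/ball_boxE; exact: fD fx.
  by have := sqr_ge0 (normc (f x) - 1); have := sqr_ge0 (normc (f x)); nra.
move=> /integrableP[_ h]; apply: le_lt_trans h; rewrite le_eqVlt; apply/orP; left.
by apply/eqP/eq_integral => x _; rewrite gee0_abs// lee_fin normc_ge0.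
Qed.

End compact_support.

(** * The Fourier transform *)

Lemma cint_transfer d1 d2 (X : measurableType d1) (Y : measurableType d2) (R : realType)
    (m1 : {measure set X -> \bar R}) (m2 : {measure set Y -> \bar R}) (phi : X -> Y) (G : Y -> R[i]) :
  (forall F : Y -> \bar R, measurable_fun setT F -> (forall y, (0 <= F y)%E) ->
     (\int[m1]_x F (phi x) = \int[m2]_y F y)%E) ->
  cmeas G -> cint m1 (fun x => G (phi x)) = cint m2 G.
Proof.
move=> H [mr mi].
have h (f : Y -> R) : measurable_fun setT f ->
    \int[m1]_x f (phi x) = \int[m2]_y f y.
  move=> mf; rewrite /Rintegral; congr fine.
  have mfe : measurable_fun setT (EFin \o f) by exact/measurable_EFinP.
  rewrite integralE [RHS]integralE; congr (_ - _)%E.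
  - rewrite -(H (fun y => ((EFin \o f)^\+)%E y))//; last exact: measurable_funepos.
    by apply: eq_integral => x _; rewrite !funeposE.
  - rewrite -(H (fun y => ((EFin \o f)^\-)%E y))//; last exact: measurable_funeneg.
    by apply: eq_integral => x _; rewrite !funenegE.
by apply: complex_ext; [exact: (h (fun y => complex.Re (G y)))|exact: (h (fun y => complex.Im (G y)))].
Qed.

(** * Plancherel's theorem for functions of bounded support *)

Section plancherel_compact.
Context {R : realType} {l : nat}.
Local Notation mu := (lebesgue_euclid R l).
Local Notation nu := (@cube_measure_restr R l).
Local Notation cube := (@cube R l).
Local Notation ZZ := (l.-tuple int).
Implicit Types (x y s xi : euclid R l) (m n : ZZ) (k : 'I_l) (f g : euclid R l -> R[i]).

Lemma cL1_cell f m : cL1 mu f -> cL1 nu (fun x => f (vadd x (intvec m))).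
Proof.
move=> Lf; have mf := cL1_meas Lf.
have mfm : measurable_fun setT (fun x => (normc (f x))%:E).
  exact/measurable_EFinP/measurable_normc.
apply: cL1P; first exact: cmeas_comp mf (measurable_vadd _).
have /integrableP[_ foo] := cL1_normc Lf.
apply: le_lt_trans foo; apply: (@le_trans _ _ (\int[mu]_x (normc (f x))%:E)%E); last first.
  by rewrite le_eqVlt; apply/orP; left; apply/eqP/eq_integral => x _; rewrite gee0_abs// lee_fin normc_ge0.
rewrite (integral_cells mfm); last by move=> x; rewrite lee_fin normc_ge0.
apply: esum_ge; exists [set m]; first by split => //; exact: finite_set1.
by rewrite fsbig_set1.
Qed.

Lemma cube_integral_eq (F G : euclid R l -> \bar R) : measurable_fun setT F ->
  measurable_fun setT G -> (forall x, cube x -> F x = G x) ->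
  (\int[nu]_x F x = \int[nu]_x G x)%E.
Proof.
move=> mF mG FG; apply: ae_eq_integral => //.
by apply/cube_ae; apply: aeW => x cx _; exact: FG.
Qed.

Let rint_cells D (h : euclid R l -> R) : mu.-integrable setT (fun x => (h x)%:E) ->
  (forall x, h x != 0 -> forall i, `|ecoord x i| <= D%:R) ->
  (forall m, nu.-integrable setT (fun x => (h (vadd x (intvec m)))%:E)) ->
  \int[mu]_x h x = \sum_(m <- boxz D.+1) \int[nu]_x h (vadd x (intvec m)).
Proof.
move=> ih hD ihm.
have pn (m' : {measure set (euclid R l) -> \bar R}) (u : euclid R l -> R) :
    m'.-integrable setT (fun x => (u x)%:E) ->
    \int[m']_x u x = fine (\int[m']_x (Num.max (u x) 0)%:E)%E -
      fine (\int[m']_x (Num.max (- u x) 0)%:E)%E.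
  move=> iu; rewrite /Rintegral integralE fineB; last 2 first.
  - exact: integrable_pos_fin_num.
  - exact: integrable_neg_fin_num.
  by congr (fine _ - fine _); apply: eq_integral => x _;
    rewrite ?funeposE ?funenegE -?EFinN -EFin_max.
have fp (m' : {measure set (euclid R l) -> \bar R}) (u : euclid R l -> R) :
    m'.-integrable setT (fun x => (u x)%:E) ->
    (\int[m']_x (Num.max (u x) 0)%:E)%E \is a fin_num.
  move=> iu; rewrite (_ : (\int[m']_x _)%E = (\int[m']_x ((fun x => (u x)%:E)^\+ x))%E).
    exact: integrable_pos_fin_num.
  by apply: eq_integral => x _; rewrite funeposE -EFin_max.
have cells (u : euclid R l -> R) : mu.-integrable setT (fun x => (u x)%:E) ->
    (forall x, u x != 0 -> forall i, `|ecoord x i| <= D%:R) ->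
    (forall m, nu.-integrable setT (fun x => (u (vadd x (intvec m)))%:E)) ->
    fine (\int[mu]_x (Num.max (u x) 0)%:E)%E =
    \sum_(m <- boxz D.+1) fine (\int[nu]_x (Num.max (u (vadd x (intvec m))) 0)%:E)%E.
  move=> iu uD ium.
  have mu0 : measurable_fun setT (fun x => Num.max (u x) 0).
    by apply: measurable_maxr => //; apply/measurable_EFinP; exact: measurable_int iu.
  have mu0E : measurable_fun setT (fun x => (Num.max (u x) 0)%:E) by exact/measurable_EFinP.
  have u0 x : (0 <= (Num.max (u x) 0)%:E)%E by rewrite lee_fin le_max lexx orbT.
  rewrite (integral_cells mu0E u0) (@esum_boxz _ _ D.+1); last 2 first.
  - by move=> m; apply: integral_ge0 => x _; exact: u0.
  - move=> m mN; rewrite (@cube_integral_eq _ (cst 0%E))//; first by rewrite integral0.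
      exact: measurableT_comp mu0E (measurable_vadd _).
    move=> x cx; rewrite (_ : u _ = 0) ?maxxx//.
    apply: (@complexI R); apply: (bsupp_boxz (f := fun x => (u x)%:C%C) (D := D) _ (cube_bound cx)).
      by move=> z; rewrite -(rmorph0 (real_complex R)) (inj_eq (@complexI R)); exact: uD.
    by rewrite addn1.
  by rewrite sum_fine// => m _; exact: fp.
rewrite pn// cells// (cells (fun x => - h x)); last 3 first.
- by apply: eq_integrable (integrableN ih) => // x _; rewrite EFinN.
- by move=> x; rewrite oppr_eq0; exact: hD.
- by move=> m; apply: eq_integrable (integrableN (ihm m)) => // x _; rewrite EFinN.
by rewrite -sumrB; apply: eq_bigr => m _; rewrite pn.
Qed.

Lemma cint_boxz D f : cL1 mu f -> bsupp D f ->
  cint mu f = \sum_(m <- boxz D.+1) cint nu (fun x => f (vadd x (intvec m))).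
Proof.
move=> Lf fD; have Lc m := cL1_cell m Lf.
have fr x : complex.Re (f x) != 0 -> forall i, `|ecoord x i| <= D%:R.
  by move=> h; apply: fD; apply: contra_neq h => ->.
have fi x : complex.Im (f x) != 0 -> forall i, `|ecoord x i| <= D%:R.
  by move=> h; apply: fD; apply: contra_neq h => ->.
apply: complex_ext; rewrite ?cRe_sum ?cIm_sum.
- by apply: rint_cells fr _ => [|m]; [case: Lf|case: (Lc m)].
- by apply: rint_cells fi _ => [|m]; [case: Lf|case: (Lc m)].
Qed.

Definition kern x y : R[i] := cis (- (2 * pi * dot x y)).

Lemma kern_meas1 y : cmeas (fun x => kern x y).
Proof.
apply: cmeas_cis; apply: measurable_funN; apply: measurable_funM; first exact: measurable_cst.
by under eq_fun do rewrite dotC; apply: measurable_dot; exact: measurable_id.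
Qed.

Lemma kern_meas : cmeas (fun z : euclid R l * euclid R l => kern z.1 z.2).
Proof.
apply: cmeas_cis; apply: measurable_funN; apply: measurable_funM; first exact: measurable_cst.
apply: measurable_sum => i; apply: measurable_funM.
- exact: (measurableT_comp (measurable_ecoord i) measurable_fst).
- exact: (measurableT_comp (measurable_ecoord i) measurable_snd).
Qed.

Lemma normc_kern x y : normc (kern x y) = 1.
Proof. exact: normc_cis. Qed.

Lemma kernDl x s y : kern (vadd x s) y = kern x y * kern s y.
Proof. by rewrite /kern dotDl -cisD; congr cis; ring. Qed.

Lemma kernDr x s y : kern x (vadd y s) = kern x y * kern x s.
Proof. by rewrite /kern dotDr -cisD; congr cis; ring. Qed.

Lemma kern_intvec m n : kern (intvec m) (intvec n) = 1.
Proof. by rewrite /kern cisN cis_dot_intvec conjc1. Qed.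

Lemma kern_chrl m y : kern (intvec m) y = ((chr m y)^*)%C.
Proof. by rewrite /kern cisN. Qed.

Lemma kern_chrr m x : kern x (intvec m) = ((chr m x)^*)%C.
Proof. by rewrite /kern cisN dotC. Qed.

Lemma zak_ae_cell D f y : cmeas f -> bsupp D f ->
  {ae nu, forall x, zak f x y = \sum_(m <- boxz D.+1) f (vadd x (intvec m)) * ((chr m y)^*)%C}.
Proof.
move=> mf fD; apply/cube_ae; apply: aeW => x cx.
by rewrite (zakE _ fD (cube_bound cx) (leqnn _)) addn1.
Qed.

Lemma zak_cL2 D f y : cL2 mu f -> bsupp D f -> cL2 nu (fun x => zak f x y).
Proof.
move=> Lf fD; have mf := cL2_meas Lf; have mz := zak_meas1 y mf fD; split=> //.
have L : cL2 nu (fun x => \sum_(m <- boxz D.+1) f (vadd x (intvec m)) * ((chr m y)^*)%C).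
  apply: cL2_sum => m; under eq_fun do rewrite mulrC.
  by apply: cL2Z; exact: cL2_cell.
by rewrite (ae_eq_sql2 mz (cL2_meas L) (zak_ae_cell y mf fD)); case: L.
Qed.

(** The factor [kern x y] undoes the quasi-periodicity in [x], and the integrals over the cells add
    up to the Fourier integral over the whole space: a fibrewise Poisson summation. *)
Lemma zak_coef D f y n : cL2 mu f -> bsupp D f ->
  ip nu (fun x => zak f x y * kern x y) (chr n) = fourierL1 f (vadd y (intvec n)).
Proof.
move=> Lf fD; have mf := cL2_meas Lf; have L1 := bsupp_cL1 Lf fD.
set G := fun x => f x * kern x (vadd y (intvec n)).
have mG : cmeas G by apply: cmeasM => //; exact: kern_meas1.
have LG : cL1 mu G.
  by apply: cL1_cond L1 => // x; rewrite normcM normc_kern mulr1.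
have GD : bsupp D G by move=> x Gx; apply: fD; apply: contra_neq Gx => h; rewrite /G h mul0r.
rewrite -[RHS]/(cint mu G) (cint_boxz LG GD) -cint_sum; last by move=> m; exact: cL1_cell.
apply: ae_eq_cint.
- apply: cmeasM; last by apply: cmeasJ; exact: chr_meas.
  by apply: cmeasM; [exact: zak_meas1 mf fD|exact: kern_meas1].
- by apply: cmeas_sum => m; exact: cmeas_comp mG (measurable_vadd _).
apply: filterS (zak_ae_cell y mf fD) => x ->.
rewrite !mulr_suml; apply: eq_bigr => m _.
rewrite /G !kernDl !kernDr kern_intvec kern_chrl kern_chrr; ring.
Qed.

Lemma fourier_meas f : cmeas f -> cmeas (fourierL1 f).
Proof.
move=> mf; apply: (@cmeas_cint _ _ _ _ R mu (fun z : euclid R l * euclid R l => f z.1 * kern z.1 z.2)).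
by apply: cmeasM; [exact: cmeas_comp mf measurable_fst|exact: kern_meas].
Qed.

Lemma high_freq_meas k f : cmeas f -> forall N : nat, measurable_fun setT
  (fun xi => (normc (fourierL1 f xi) ^+ 2 * (N%:R <= `|ecoord xi k|)%R%:R)%:E).
Proof.
move=> mf N; apply/measurable_EFinP; apply: measurable_funM.
  by apply: measurable_sqr_normc; exact: fourier_meas.
rewrite (_ : (fun xi => _) = (\1_[set xi : euclid R l | N%:R <= `|ecoord xi k|])); last first.
  apply/funext => xi; rewrite indicE; congr (nat_of_bool _)%:R.
  by apply/idP/idP; rewrite inE.
apply: measurable_indic.
rewrite (_ : [set xi | _] = (fun xi : euclid R l => `|ecoord xi k|) @^-1` `[N%:R, +oo[%classic); last first.
  by apply/seteqP; split => xi /=; rewrite in_itv/= andbT.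
rewrite -[X in measurable X]setTI.
have mk : measurable_fun setT (fun xi : euclid R l => `|ecoord xi k|).
  by apply: (measurableT_comp (f := fun t : R => `|t|)); [exact: normr_measurable|exact: measurable_ecoord].
exact: mk.
Qed.

Lemma fourier_fiber D f y : cL2 mu f -> bsupp D f ->
  (\esum_(n in [set: ZZ]) (normc (fourierL1 f (vadd y (intvec n))) ^+ 2)%:E =
   sql2 nu (fun x => zak f x y))%E.
Proof.
move=> Lf fD; have mf := cL2_meas Lf; have Lz := zak_cL2 y Lf fD.
have mzk : cmeas (fun x => zak f x y * kern x y).
  by apply: cmeasM; [exact: zak_meas1 mf fD|exact: kern_meas1].
have L : cL2 nu (fun x => zak f x y * kern x y).
  by apply: cL2_cond Lz => // x; rewrite normcM normc_kern mulr1.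
rewrite (_ : sql2 nu _ = sql2 nu (fun x => zak f x y * kern x y)).
  by rewrite -(parseval L); apply: eq_esum => n _; rewrite (zak_coef _ _ Lf fD).
by apply: eq_sql2 => x; rewrite normcM normc_kern mulr1.
Qed.

(* Parseval in [x] for every fixed [y], then integration over [y]. *)
Lemma plancherel_compact D f : cL2 mu f -> bsupp D f ->
  sql2 mu (fourierL1 f) = sql2 mu f.
Proof.
move=> Lf fD; have mf := cL2_meas Lf.
have mF := measurable_sqr_normc (fourier_meas mf).
have mFE : measurable_fun setT (fun x => (normc (fourierL1 f x) ^+ 2)%:E) by exact/measurable_EFinP.
have mz := measurable_sqr_normc (zak_meas mf fD).
have mze : measurable_fun setT (fun z : euclid R l * euclid R l =>
    (normc (zak f z.1 z.2) ^+ 2)%:E) by exact/measurable_EFinP.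
rewrite -(zak_isometry mf fD).
rewrite (fubini_tonelli (m1 := nu) (m2 := nu) _ mze); last by move=> z; rewrite lee_fin sqr_ge0.
rewrite sql2_cells; last exact: fourier_meas.
rewrite -integral_esum; last 2 first.
- by move=> m; apply: measurableT_comp mFE (measurable_vadd _).
- by move=> m x; rewrite lee_fin sqr_ge0.
by apply: eq_integral => y _; rewrite (fourier_fiber _ Lf fD).
Qed.

End plancherel_compact.

(** * Truncation to boxes *)

Section plancherel_L2.
Context {R : realType} {l : nat}.
Local Notation mu := (lebesgue_euclid R l).
Local Notation ZZ := (l.-tuple int).
Implicit Types (x y s xi : euclid R l) (m n : ZZ) (k : 'I_l) (f g u h : euclid R l -> R[i]).

Definition trunc D u x : R[i] := u x * (\1_(ball_box D) x)%:C%C.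

Lemma truncE D u x : trunc D u x = if x \in ball_box D then u x else 0.
Proof. by rewrite /trunc indicE; case: ifP => _; rewrite ?mulr1 ?mulr0. Qed.

Lemma trunc_meas D u : cmeas u -> cmeas (trunc D u).
Proof.
move=> mu'; apply: cmeasM => //; apply: cmeas_real; apply: measurable_indic.
exact: ball_box_meas.
Qed.

Lemma normc_trunc D u x : normc (trunc D u x) <= normc (u x).
Proof. by rewrite truncE; case: ifP; rewrite ?normc0 ?normc_ge0. Qed.

Lemma trunc_bsupp D u : bsupp D (trunc D%:R u).
Proof.
move=> x; rewrite truncE; case: ifP => [|_]; last by rewrite eqxx.
by rewrite inE => /ball_boxE.
Qed.

Lemma trunc_cL2 D u : cL2 mu u -> cL2 mu (trunc D u).
Proof.
by move=> Lu; apply: (cL2_cond _ _ Lu); [exact/trunc_meas/(cL2_meas Lu)|exact: normc_trunc].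
Qed.

Lemma trunc_cL1 D u : cL1 mu u -> cL1 mu (trunc D u).
Proof.
by move=> Lu; apply: (cL1_cond _ _ Lu); [exact/trunc_meas/(cL1_meas Lu)|exact: normc_trunc].
Qed.

Lemma sql2_trunc_le u (S : \bar R) : cmeas u ->
  (forall N : nat, sql2 mu (trunc N%:R u) <= S)%E -> (sql2 mu u <= S)%E.
Proof.
move=> mu' h.
pose G (N : nat) x := (normc (trunc N%:R u x) ^+ 2)%:E.
have GE x : \forall N \near \oo, G N x = (normc (u x) ^+ 2)%:E.
  have [r xr] := nat_bound x; exists r => // N /= rN.
  rewrite /G truncE mem_set//; apply/ball_boxE => i.
  by rewrite (le_trans (xr i))// ler_nat.
have Gn x : {homo G^~ x : a b / (a <= b)%N >-> (a <= b)%E}.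
  move=> a b ab; rewrite /G lee_fin !truncE.
  case: ifPn => [|_]; last by rewrite normc0 expr0n sqr_ge0.
  rewrite inE => /ball_boxE xa; rewrite mem_set//; apply/ball_boxE => i.
  by rewrite (le_trans (xa i))// ler_nat.
have mG N : measurable_fun setT (G N) by exact/measurable_EFinP/measurable_sqr_normc/trunc_meas.
have G0 N x : (0 <= G N x)%E by rewrite lee_fin sqr_ge0.
have := @cvg_monotone_convergence _ _ R mu setT measurableT G mG (fun N x _ => G0 N x) (fun x _ => Gn x).
rewrite (eq_integral (fun x => (normc (u x) ^+ 2)%:E)); last first.
  by move=> x _; apply/cvg_lim => //; apply: cvg_near_cst; exact: GE.
move=> cG; rewrite -[leLHS](cvg_lim _ cG)//.
apply: lime_le; first by apply/cvg_ex; eexists; exact: cG.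
by apply: nearW => N; exact: h.
Qed.

(** A truncation and its remainder have disjoint supports, so their squared norms add up. If all
    remainders were at least [e], all truncations would stay below the squared norm of [u] by [e],
    against monotone convergence. *)
Lemma sql2_trunc_close u (e : R) : cL2 mu u -> 0 < e ->
  exists N : nat, (sql2 mu (fun x => u x - trunc N%:R u x)%R < e%:E)%E.
Proof.
move=> Lu e0; have mu' := cL2_meas Lu.
apply: contrapT => /forallNP h.
have : (sql2 mu u <= (n2 mu u - e)%:E)%E.
  apply: sql2_trunc_le => // N; have := h N => /negP; rewrite -leNgt.
  have LT := trunc_cL2 N%:R Lu.
  rewrite (sql2E LT) (sql2E (cL2B Lu LT)) !lee_fin => h1.
  have : n2 mu u = n2 mu (trunc N%:R u) + n2 mu (fun x => u x - trunc N%:R u x); last by lra.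
  transitivity (n2 mu (fun x => trunc N%:R u x + (u x - trunc N%:R u x))).
    by congr n2; apply/funext => x; rewrite addrC subrK.
  rewrite n2D//; last exact: cL2B.
  rewrite (_ : ip _ _ _ = 0); first by rewrite mulr0 addr0.
  rewrite /ip -(cint0 mu); congr cint; apply/funext => x.
  by rewrite !truncE; case: ifP => _; rewrite ?subrr ?conjc0 ?mulr0 ?mul0r.
rewrite (sql2E Lu) lee_fin; lra.
Qed.

End plancherel_L2.

(** * The Fourier integral on the intersection of L^1 and L^2 *)

Section fourier_L1.
Context {R : realType} {l : nat}.
Local Notation mu := (lebesgue_euclid R l).
Local Notation ZZ := (l.-tuple int).
Implicit Types (x y s xi : euclid R l) (m n : ZZ) (k : 'I_l) (f g u h : euclid R l -> R[i]).

Lemma fourierE u y : fourierL1 u y = cint mu (fun x => u x * kern x y).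
Proof. by []. Qed.

Lemma kern_cL1 u y : cL1 mu u -> cL1 mu (fun x => u x * kern x y).
Proof.
move=> Lu; apply: (cL1_cond _ _ Lu) => [|x]; last by rewrite normcM normc_kern mulr1.
by apply: cmeasM; [exact: cL1_meas Lu|exact: kern_meas1].
Qed.

Lemma fourierB u h y : cL1 mu u -> cL1 mu h ->
  fourierL1 (fun x => u x - h x) y = fourierL1 u y - fourierL1 h y.
Proof.
move=> Lu Lh; rewrite !fourierE -cintB; [|exact: kern_cL1|exact: kern_cL1].
by congr cint; apply/funext => x; rewrite mulrBl.
Qed.

Lemma fourier_lincomb (I : Type) (J : seq I) (c : I -> R[i]) (F : I -> euclid R l -> R[i]) y :
  (forall i, cL1 mu (F i)) ->
  fourierL1 (fun x => \sum_(i <- J) c i * F i x) y = \sum_(i <- J) c i * fourierL1 (F i) y.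
Proof.
move=> LF; rewrite fourierE.
rewrite (eq_bigr (fun i => cint mu (fun x => c i * (F i x * kern x y)))); last first.
  by move=> i _; rewrite cintZ//; exact: kern_cL1.
rewrite -cint_sum; last by move=> i; apply: cL1Z; exact: kern_cL1.
by congr cint; apply/funext => x; rewrite mulr_suml; apply: eq_bigr => i _; rewrite mulrA.
Qed.

Lemma fourier_bounded u : cL1 mu u -> exists K : R, forall y, normc (fourierL1 u y) <= K.
Proof.
move=> Lu; pose S := \int[mu]_x normc (u x).
have b (v : euclid R l -> R) : mu.-integrable setT (EFin \o v) ->
    (forall x, `|v x| <= normc (u x)) -> `|\int[mu]_x v x| <= S.
  move=> iv vu; apply: (le_trans (le_normr_Rintegral _ iv)) => //.
  apply: le_Rintegral => //; last exact: cL1_normc.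
  exact: integrable_norm.
exists (S + S) => y; have [ir ii] := kern_cL1 y Lu.
rewrite (le_trans (normc_le _))//; apply: lerD; apply: b => //.
- by move=> x; rewrite (le_trans (abs_Re_le _))// normcM normc_kern mulr1.
- by move=> x; rewrite (le_trans (abs_Im_le _))// normcM normc_kern mulr1.
Qed.

Lemma trunc_fourier_cL2 (D : nat) u : cL1 mu u -> cL2 mu (trunc D%:R (fourierL1 u)).
Proof.
move=> Lu; have [K uK] := fourier_bounded Lu.
apply: (@cL2_bound _ _ _ mu _ (fun x => K ^+ 2 * \1_(ball_box D%:R) x)).
- by apply: trunc_meas; exact/fourier_meas/(cL1_meas Lu).
- by apply: eq_integrable (integrableZl measurableT (K ^+ 2) (ball_box_integrable D)).
- move=> x; rewrite truncE indicE; case: ifP => _; last by rewrite normc0 expr0n mulr0.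
  by rewrite mulr1 ler_sqr ?nnegrE ?normc_ge0// (le_trans _ (uK x)) ?normc_ge0.
Qed.

Lemma fourier_adjoint u h : cL1 mu u -> cL1 mu h ->
  ip mu (fourierL1 u) h = ip mu u (fun x => fourierL1 h (vopp x)).
Proof.
move=> Lu Lh; have mu' := cL1_meas Lu; have mh := cL1_meas Lh.
pose F (z : euclid R l * euclid R l) := u z.1 * (kern z.1 z.2 * ((h z.2)^*)%C).
have mF : cmeas F.
  apply: cmeasM; first exact: cmeas_comp mu' measurable_fst.
  apply: cmeasM; first exact: kern_meas.
  by apply: cmeasJ; exact: cmeas_comp mh measurable_snd.
have LF : cL1 (mu \x mu)%E F.
  apply: cL1P => //; rewrite fubini_tonelli1; last 2 first.
  - exact/measurable_EFinP/measurable_normc.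
  - by move=> z; rewrite lee_fin normc_ge0.
  have mhn : measurable_fun setT (fun y => (normc (h y))%:E) by exact/measurable_EFinP/measurable_normc.
  have mun : measurable_fun setT (fun y => (normc (u y))%:E) by exact/measurable_EFinP/measurable_normc.
  have [_ hoo] := integrableP _ _ _ (cL1_normc Lh).
  have [_ uoo] := integrableP _ _ _ (cL1_normc Lu).
  rewrite (eq_integral (fun x => (normc (u x))%:E * \int[mu]_y (normc (h y))%:E)%E); last first.
    move=> x _; rewrite /fubini_F -ge0_integralZl//; try by rewrite lee_fin normc_ge0.
      by apply: eq_integral => y _; rewrite /F !normcM normc_kern normc_conj mul1r.
    by move=> y _; rewrite lee_fin normc_ge0.
  rewrite ge0_integralZr//; last 2 first.
  - by move=> x _; rewrite lee_fin normc_ge0.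
  - by apply: integral_ge0 => x _; rewrite lee_fin normc_ge0.
  have e (v : euclid R l -> R[i]) : (\int[mu]_x `|(normc (v x))%:E| = \int[mu]_x (normc (v x))%:E)%E.
    by apply: eq_integral => x _; rewrite gee0_abs// lee_fin normc_ge0.
  rewrite e in hoo; rewrite e in uoo.
  have h0 (v : euclid R l -> R[i]) : (0 <= \int[mu]_x (normc (v x))%:E)%E.
    by apply: integral_ge0 => x _; rewrite lee_fin normc_ge0.
  by rewrite -ge0_fin_numE ?mule_ge0// fin_numM// ge0_fin_numE.
rewrite /ip; transitivity (cint (mu \x mu)%E F).
  rewrite (cint_fubini2 LF); congr cint; apply/funext => y.
  rewrite fourierE mulrC -cintZ; last exact: kern_cL1.
  by congr cint; apply/funext => x; rewrite /F /= [RHS]mulrA mulrC.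
rewrite (cint_fubini1 LF); congr cint; apply/funext => x.
rewrite fourierE -cintJ; last exact: kern_cL1.
rewrite -cintZ; last by apply: cL1J; exact: kern_cL1.
congr cint; apply/funext => y; rewrite /F /= conjcM; congr (_ * _); rewrite mulrC; congr (_ * _).
by rewrite /kern -cisN dotNr dotC; congr cis; ring.
Qed.

Lemma reflect_sql2 f : cmeas f -> sql2 mu (fun x => f (vopp x)) = sql2 mu f.
Proof.
move=> mf; rewrite /sql2 -[RHS](preserving_integral preserving_vopp)//.
- exact/measurable_EFinP/measurable_sqr_normc.
- by move=> x; rewrite lee_fin sqr_ge0.
Qed.

Lemma reflect_meas f : cmeas f -> cmeas (fun x => f (vopp x)).
Proof. by move=> mf; apply: cmeas_comp mf _; case: (@preserving_vopp R l). Qed.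

Lemma inv_fourier_cL2 D h : cL2 mu h -> bsupp D h -> cL2 mu (fun x => fourierL1 h (vopp x)).
Proof.
move=> Lh hD; have mh := fourier_meas (cL2_meas Lh).
split; first exact: reflect_meas.
by rewrite reflect_sql2// (plancherel_compact Lh hD); case: Lh.
Qed.

(** Applied with [h] a truncation of [fourierL1 u], it gives the contraction property; applied with
    [h] the compactly supported transform of the window, it identifies the window in the dual
    case. *)
Lemma n2_sub_inv_fourier D u h : cL1 mu u -> cL2 mu u -> cL2 mu h -> bsupp D h ->
  n2 mu (fun x => u x - fourierL1 h (vopp x)) =
  n2 mu u - 2 * complex.Re (ip mu (fourierL1 u) h) + n2 mu h.
Proof.
move=> L1u Lu Lh hD; rewrite n2B//; last exact: inv_fourier_cL2 Lh hD.
rewrite fourier_adjoint//; last exact: bsupp_cL1 Lh hD.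
by congr (_ + _); rewrite /n2 reflect_sql2 ?(plancherel_compact Lh hD)//; exact/fourier_meas/(cL2_meas Lh).
Qed.

(* Bessel's inequality: the inverse transform of a truncation of [fourierL1 u]
   plays the role of an orthogonal projection of [u]. *)
Lemma fourier_contraction u : cL1 mu u -> cL2 mu u -> (sql2 mu (fourierL1 u) <= sql2 mu u)%E.
Proof.
move=> L1u Lu; apply: sql2_trunc_le => [|N]; first exact/fourier_meas/(cL2_meas Lu).
set h := trunc _ _; have Lh : cL2 mu h by exact: trunc_fourier_cL2.
rewrite (sql2E Lh) (sql2E Lu) lee_fin.
have := n2_ge0 mu (fun x => u x - fourierL1 h (vopp x)).
rewrite (n2_sub_inv_fourier (D := N) L1u Lu Lh); last exact: trunc_bsupp.
rewrite (_ : ip _ _ _ = ip mu h h).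
  by rewrite ipxx//= => ?; lra.
rewrite /ip; congr cint; apply/funext => x.
by rewrite /h truncE; case: ifP => _ //; rewrite conjc0 !mulr0.
Qed.

Lemma fourier_cL2 u : cL1 mu u -> cL2 mu u -> cL2 mu (fourierL1 u).
Proof.
move=> L1u Lu; split; first exact/fourier_meas/(cL2_meas Lu).
by apply: le_lt_trans (fourier_contraction L1u Lu) _; case: Lu.
Qed.

Lemma n2_continuous (T : R) u : cL2 mu u -> 0 < T -> exists2 d : R, 0 < d &
  forall f, cL2 mu f -> n2 mu (fun x => f x - u x) < d -> `|n2 mu f - n2 mu u| < T.
Proof.
(* Young's inequality with parameter [t] costs [t * n2 mu u < T / 2] on [u]; then [d] is chosen such
   that the difference costs less than [T / 2]. *)
move=> Lu T0; pose t := T / (2 * (n2 mu u + 1)).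
have u0 := n2_ge0 mu u.
have t0 : 0 < t by rewrite divr_gt0// mulr_gt0//; lra.
have tu : t * n2 mu u < T / 2.
  rewrite /t; have -> : T / (2 * (n2 mu u + 1)) * n2 mu u = T / 2 * (n2 mu u / (n2 mu u + 1)).
    by field; lra.
  by rewrite gtr_pMr ?divr_gt0// ltr_pdivrMr ?mul1r; lra.
pose d := T / 2 / (1 + t^-1).
have ti : 0 < t^-1 by rewrite invr_gt0.
exists d; first by rewrite divr_gt0 ?divr_gt0//; lra.
move=> f Lf fd; have L := cL2B Lf Lu.
have young (a b : euclid R l -> R[i]) : cL2 mu a -> cL2 mu b ->
    n2 mu (fun x => a x + b x) <= (1 + t) * n2 mu a + (1 + t^-1) * n2 mu b.
  move=> La Lb; have := sql2_young mu t0 (cL2_meas La) (cL2_meas Lb).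
  by rewrite !sql2E//; exact: cL2D.
have dT : (1 + t^-1) * n2 mu (fun x => f x - u x) < T / 2.
  by rewrite mulrC -ltr_pdivlMr//; lra.
(* The first instance bounds [n2 mu f] from above; the second, for [u - (f - u)], bounds the cross
   term and so [n2 mu f] from below. *)
have e1 := young _ _ Lu L; have e2 := young _ _ Lu (cL2N L).
rewrite (_ : n2 mu (fun x => u x + (f x - u x)) = n2 mu f) in e1; last first.
  by congr n2; apply/funext => x; rewrite addrC subrK.
rewrite n2D// in e2; last exact: cL2N.
have eN : n2 mu (fun x => - (f x - u x)) = n2 mu (fun x => f x - u x).
  by rewrite /n2; congr fine; apply: eq_sql2 => x; rewrite normc_opp.
rewrite eN in e2.
have ipN : ip mu u (fun x => - (f x - u x)) = - ip mu u (fun x => f x - u x).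
  rewrite (_ : (fun x => - _) = fun x => (-1) * (f x - u x)); last first.
    by apply/funext => x; rewrite mulN1r.
  rewrite ipZr// (_ : ((-1)^*)%C = -1 :> R[i]) ?mulN1r//.
  by apply: complex_ext; rewrite /= ?oppr0.
rewrite ipN cReN in e2.
have e3 : n2 mu f = n2 mu u + 2 * complex.Re (ip mu u (fun x => f x - u x)) +
    n2 mu (fun x => f x - u x).
  by rewrite -n2D//; congr n2; apply/funext => x; rewrite addrC subrK.
have d0 := n2_ge0 mu (fun x => f x - u x).
by rewrite ltr_norml; apply/andP; split; lra.
Qed.

(** The two sides agree on truncations of [u], which have bounded support, and both pass to the
    limit, the left one by the contraction property. *)
Lemma plancherel_L12 u : cL1 mu u -> cL2 mu u -> n2 mu (fourierL1 u) = n2 mu u.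
Proof.
move=> L1u Lu; have LF := fourier_cL2 L1u Lu.
apply/eqP; rewrite -subr_eq0 -normr_eq0 eq_le normr_ge0 andbT.
apply/ler_addgt0Pl => e e0; rewrite addr0.
have e2 : 0 < e / 2 by rewrite divr_gt0.
have [d1 d10 h1] := n2_continuous Lu e2; have [d2 d20 h2] := n2_continuous LF e2.
have d0 : 0 < Num.min d1 d2 by rewrite lt_min d10.
have [N] := sql2_trunc_close Lu d0; set v := trunc _ _.
have Lv : cL2 mu v by exact: trunc_cL2.
have L1v : cL1 mu v by exact: trunc_cL1.
have LFv := fourier_cL2 L1v Lv.
have Luv := cL2B Lu Lv; have L1uv := cL1B L1u L1v.
rewrite (sql2E Luv) lte_fin lt_min => /andP[uv1 uv2].
have vE : n2 mu (fourierL1 v) = n2 mu v.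
  by rewrite /n2 (plancherel_compact Lv (@trunc_bsupp _ _ N u)).
have := h1 v Lv; rewrite (_ : n2 mu (fun x => v x - u x) = n2 mu (fun x => u x - v x)); last first.
  by rewrite /n2; congr fine; apply: eq_sql2 => x; rewrite -normc_opp opprB.
move=> /(_ uv1) k1.
have : n2 mu (fun x => fourierL1 v x - fourierL1 u x) <= n2 mu (fun x => u x - v x).
  rewrite -lee_fin -!sql2E//; last exact: cL2B.
  rewrite (_ : sql2 mu (fun x => fourierL1 v x - _) = sql2 mu (fourierL1 (fun x => u x - v x))).
    exact: fourier_contraction.
  by apply: eq_sql2 => x; rewrite fourierB// -normc_opp opprB.
move=> /le_lt_trans/(_ uv2)/(h2 _ LFv); rewrite vE => k2.
move: k1 k2; move: (n2 mu v) (n2 mu u) (n2 mu (fourierL1 u)) => a b c ab ac.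
rewrite (_ : c - b = (c - a) + (a - b)); last by ring.
rewrite (le_trans (ler_normD _ _))// [X in X + _]distrC.
by rewrite [e]splitr lerD// ltW.
Qed.

Lemma sql2_limit_unique (v : nat -> euclid R l -> R[i]) f g :
  (forall j, cmeas (v j)) -> cmeas f -> cmeas g ->
  sql2 mu (fun x => v j x - f x) @[j --> \oo] --> 0%E ->
  sql2 mu (fun x => v j x - g x) @[j --> \oo] --> 0%E ->
  {ae mu, forall x, f x = g x}.
Proof.
move=> mv mf mg vf vg.
suff : sql2 mu (fun x => f x - g x) = 0%E.
  by move=> /(sql2_eq0 (cmeasB mf mg)); apply: filterS => x /eqP; rewrite subr_eq0 => /eqP.
apply/eqP; rewrite eq_le sql2_ge0 andbT; apply/lee_addgt0Pr => e e0; rewrite add0e.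
have e4 : 0 < e / 4 by rewrite divr_gt0.
near \oo => j.
have h1 : (sql2 mu (fun x => v j x - f x)%R < (e / 4)%:E)%E by near: j; exact: cvge_eventually_lt.
have h2 : (sql2 mu (fun x => v j x - g x)%R < (e / 4)%:E)%E by near: j; exact: cvge_eventually_lt.
have := sql2_young mu ltr01 (cmeasB (mv j) mg) (cmeasN (cmeasB (mv j) mf)).
rewrite invr1 (_ : sql2 mu (fun x => - _) = sql2 mu (fun x => v j x - f x)); last first.
  by apply: eq_sql2 => x; rewrite normc_opp.
rewrite (_ : (fun x => _ + - _) = (fun x => f x - g x)); last first.
  by apply/funext => x; ring.
move=> /le_trans; apply.
rewrite (_ : e%:E = ((1 + 1)%:E * (e / 4)%:E + (1 + 1)%:E * (e / 4)%:E)%E); last first.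
  by rewrite -!EFinM -EFinD; congr EFin; field.
by apply: leeD; rewrite lee_pmul2l ?ltW// lte_fin; lra.
Unshelve. all: by end_near. Qed.

End fourier_L1.

(** * Compactly supported windows *)

(* For finitely supported coefficients the net of partial sums is eventually
   constant, so that the sum promised by [riesz_bounds] is the finite sum. *)
Lemma riesz_finite (R : realType) (l : nat) (A B : R) (I : choiceType)
    (e : I -> euclid R l -> R[i]) (J : seq I) (c : I -> R[i]) :
  riesz_bounds A B e -> (forall i, inL2 (e i)) -> uniq J ->
  A * (\sum_(i <- J) normc (c i) ^+ 2) <=
    n2 (lebesgue_euclid R l) (fun x => \sum_(i <- J) c i * e i x) <=
  B * (\sum_(i <- J) normc (c i) ^+ 2).
Proof.
move=> [_ _ rb] Le uJ; set mu := lebesgue_euclid R l.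
pose c' i := if i \in J then c i else 0.
have sc : sqsum c' = (\sum_(i <- J) normc (c i) ^+ 2)%:E.
  transitivity (\esum_(i in [set` J]) (normc (c i) ^+ 2)%:E)%E.
    rewrite /sqsum [RHS]esum_mkcond; apply: eq_esum => i _.
    rewrite /c' (_ : (i \in [set` J]) = (i \in J)); last by apply/idP/idP; rewrite inE.
    by case: ifP => // _; rewrite normc0 expr0n.
  rewrite esum_fset; [|exact: finite_seq|by move=> i _; rewrite lee_fin sqr_ge0].
  by rewrite -fsbig_seq// sumEFin.
have [|f [Lf sf fA fB]] := rb c'; first by rewrite sc ltry.
pose S x := \sum_(i <- J) c i * e i x.
have LS : cL2 mu S by apply: cL2_sum => i; apply: cL2Z; exact: Le.
have SE (K : {fset I}) x : {subset J <= K} -> \sum_(i <- enum_fset K) c' i * e i x = S x.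
  move=> JK; rewrite (bigID (mem J))/= [X in _ + X]big1 ?addr0; last first.
    by move=> i /negPf iJ; rewrite /c' iJ mul0r.
  rewrite -big_filter (perm_big J); last first.
    apply: uniq_perm => //; first by rewrite filter_uniq.
    move=> i; rewrite mem_filter /=; case: (boolP (i \in J)) => // iJ.
    by have := JK _ iJ.
  by apply: eq_big_seq => i iJ; rewrite /c' iJ.
have d0 : sql2 mu (fun x => S x - f x) = 0%E.
  have FF := @totally_filter I.
  apply: (@cvg_unique _ (@ereal_hausdorff R) _ (fmap_proper_filter _ FF) _ _ _ sf).
  apply: cvg_near_cst; exists [fset i in J]%fset => // K /= JK.
  apply: eq_sql2 => x; rewrite SE// => i iJ.
  by apply: (fsubsetP JK); rewrite !inE.
have mf : cmeas f by case: Lf.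
have e0 : sql2 mu S = sql2 mu f.
  apply: ae_eq_sql2 => //; first exact: cL2_meas LS.
  have := sql2_eq0 (cmeasB (cL2_meas LS) mf) d0.
  by apply: filterS => x /eqP; rewrite subr_eq0 => /eqP.
have e1 : sqnormL2 f = (n2 mu S)%:E by rewrite -sql2E// e0.
by move: fA fB; rewrite sc e1 !lee_fin => -> ->.
Qed.

Section frame_window.
Context {R : realType} {l : nat}.
Local Notation mu := (lebesgue_euclid R l).
Local Notation ZZ := (l.-tuple int).
Implicit Types (x y s xi : euclid R l) (m n : ZZ) (k : 'I_l) (f g u h : euclid R l -> R[i]).

(** The form in which the hypotheses are used from here on: the support condition holds at every
    point, and the Riesz inequalities concern finite sums, which involve no limit. *)
Definition frame_window (A B M : R) f : Prop :=
  [/\ cL2 mu f,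
      forall x, f x != 0 -> forall k, `|ecoord x k| < M &
      forall (J : seq (ZZ * ZZ)) (c : ZZ * ZZ -> R[i]), uniq J ->
        A * (\sum_(i <- J) normc (c i) ^+ 2) <=
          n2 mu (fun x => \sum_(i <- J) c i * gabor f i x) <=
        B * (\sum_(i <- J) normc (c i) ^+ 2)].

Definition open_box (M : R) : set (euclid R l) :=
  [set x | forall i, (`]- M, M[%classic : set (measurableTypeR R)) (ecoord x i)].

Lemma open_boxE M x : open_box M x <-> forall i, `|ecoord x i| < M.
Proof. by split=> h i; have := h i; rewrite /= in_itv/= ltr_norml. Qed.

Lemma open_box_trunc M g : cL2 mu g -> supported_in_cube M g ->
  exists f, [/\ cL2 mu f, forall x, f x != 0 -> forall k, `|ecoord x k| < M &
    {ae mu, forall x, g x = f x}].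
Proof.
move=> Lg gM; exists (fun x => g x * (\1_(open_box M) x)%:C%C).
have fE x : g x * (\1_(open_box M) x)%:C%C = if x \in open_box M then g x else 0.
  by rewrite indicE; case: ifP => _; rewrite ?mulr1 ?mulr0.
split.
- apply: (cL2_cond _ _ Lg) => [|x].
    apply: cmeasM; first exact: cL2_meas Lg.
    apply: cmeas_real; apply: measurable_indic.
    by apply: (@mbox_measurable R l (fun=> `]- M, M[%classic : set (measurableTypeR R))) => i; exact: measurable_itv.
  by rewrite fE; case: ifP; rewrite ?normc0 ?normc_ge0.
- by move=> x; rewrite fE; case: ifP => [|_]; [rewrite inE => /open_boxE|rewrite eqxx].
- apply: filterS gM => x gx; rewrite fE; case: ifPn => // /negP xM.
  apply: gx => h; apply: xM; rewrite inE; apply/open_boxE => i.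
  by rewrite ltr_norml; exact: h.
Qed.

Lemma gabor_cL2 f i : cL2 mu f -> cL2 mu (gabor f i).
Proof.
move=> Lf; split; first exact/gabor_meas/(cL2_meas Lf).
have -> : sql2 mu (gabor f i) = sql2 mu f.
  have mf := measurable_sqr_normc (cL2_meas Lf).
  rewrite /sql2 -[RHS](preserving_integral (preserving_translation (vopp (intvec i.1)))).
  - by apply: eq_integral => x _; rewrite /gabor normcM normc_cis mul1r subvecE.
  - exact/measurable_EFinP.
  - by move=> x; rewrite lee_fin sqr_ge0.
by case: Lf.
Qed.

Lemma gabor_ae f g : {ae mu, forall x, g x = f x} ->
  forall (J : seq (ZZ * ZZ)) (c : ZZ * ZZ -> R[i]),
  {ae mu, forall x, \sum_(i <- J) c i * gabor g i x = \sum_(i <- J) c i * gabor f i x}.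
Proof.
move=> gf J c; elim: J => [|i J ih]; first by apply: aeW => x; rewrite !big_nil.
have := preserving_ae (preserving_translation (vopp (intvec i.1))) gf.
move: ih; apply: filterS2 => x h1 h2; rewrite !big_cons h1; congr (_ * _ + _).
by rewrite /gabor !subvecE h2.
Qed.

Lemma gabor_ae_n2 f g (J : seq (ZZ * ZZ)) (c : ZZ * ZZ -> R[i]) : cL2 mu f -> cL2 mu g ->
  {ae mu, forall x, g x = f x} ->
  n2 mu (fun x => \sum_(i <- J) c i * gabor g i x) = n2 mu (fun x => \sum_(i <- J) c i * gabor f i x).
Proof.
move=> Lf Lg gf; rewrite /n2; congr fine; apply: ae_eq_sql2; last exact: gabor_ae.
- by apply: cmeas_sum => i; apply: cmeasM; [exact: cmeas_cst|exact/gabor_meas/(cL2_meas Lg)].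
- by apply: cmeas_sum => i; apply: cmeasM; [exact: cmeas_cst|exact/gabor_meas/(cL2_meas Lf)].
Qed.

Lemma supported_bsupp M f : (forall x, f x != 0 -> forall k, `|ecoord x k| < M) ->
  bsupp (Num.truncn M).+1 f.
Proof.
move=> fM x fx i; rewrite (le_trans (ltW (fM _ fx i)))//.
exact/ltW/truncnS_gt.
Qed.

(** The transforms of the approximants [u j] tend to [gh] by definition, and to [fourierL1 f] by the
    contraction property, as [u j] tends to [g], which is [f] almost everywhere. *)
Lemma supported_window A B M g gh : is_fourierL2 g gh -> riesz_bounds A B (gabor g) ->
  supported_in_cube M g ->
  exists2 f, frame_window A B M f & {ae mu, forall x, gh x = fourierL1 f x}.
Proof.
move=> [Lg Lgh [u [Lu ug uh]]] rb gM.
have [f [Lf fM gf]] := open_box_trunc Lg gM.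
have fD := supported_bsupp fM; have L1f := bsupp_cL1 Lf fD.
exists f.
  split=> // J c uJ; rewrite -(gabor_ae_n2 J c Lf Lg gf).
  by apply: (riesz_finite c rb _ uJ) => i; exact: gabor_cL2.
have mg := cL2_meas Lg; have mf := cL2_meas Lf.
apply: (@sql2_limit_unique _ _ (fun j => fourierL1 (u j))) => //.
- by move=> j; apply: fourier_meas; have [/cL1_meas] := Lu j.
- exact: cL2_meas Lgh.
- exact: fourier_meas.
- apply: (squeeze_cvge (f := fun=> 0%E) _ _ ug); last exact: cvg_cst.
  apply: nearW => j; rewrite sql2_ge0/=; have [L1u L2u] := Lu j.
  have Lv := cL2B L2u Lf; have L1v := cL1B L1u L1f.
  rewrite (eq_sql2 mu (G := fourierL1 (fun x => u j x - f x))); last first.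
    by move=> x; rewrite fourierB.
  apply: (le_trans (fourier_contraction L1v Lv)).
  rewrite (ae_eq_sql2 (G := fun x => u j x - g x) (cL2_meas Lv) (cmeasB (cL2_meas L2u) mg))//.
  by apply: filterS gf => x ->.
Qed.

Lemma fourier_gabor f m n xi : cL1 mu f ->
  fourierL1 (gabor f (m, n)) xi = kern (intvec m) xi * fourierL1 f (subvec xi (intvec n)).
Proof.
move=> Lf; rewrite !fourierE -cintZ; last exact: kern_cL1.
have mf := cL1_meas Lf.
have mG : cmeas (fun x => gabor f (m, n) x * kern x xi).
  by apply: cmeasM; [exact: gabor_meas|exact: kern_meas1].
rewrite -(cint_transfer (m1 := mu) (phi := vadd ^~ (intvec m)) _ mG); last first.
  by move=> F mF F0; apply: preserving_integral => //; exact: preserving_translation.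
congr cint; apply/funext => x; rewrite /gabor -[cis _]/(chr n (vadd x (intvec m))).
rewrite chr_periodic (_ : subvec _ _ = x); last by apply: euclid_ext => i; rewrite !ecoordE; ring.
rewrite kernDl subvecE kernDr (_ : kern x (vopp _) = chr n x); first by ring.
by rewrite /kern /chr dotNr dotC; congr cis; ring.
Qed.

(** The inverse transform turns a translation by [m] into a modulation by [m], and a modulation by
    [n] into a translation by [- n]; no phase appears between them, as the vectors are integral. *)
Definition swap (i : ZZ * ZZ) : ZZ * ZZ := (oppz i.2, i.1).
Definition unswap (i : ZZ * ZZ) : ZZ * ZZ := (i.2, oppz i.1).

Lemma swapK : cancel swap unswap.
Proof.
case=> m n; rewrite /swap /unswap/=; congr (_, _).
by apply: intvec_ext => i; rewrite !ecoordE opprK.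
Qed.

Lemma inv_fourier_gabor f i x : cL1 mu f ->
  fourierL1 (gabor f i) (vopp x) = gabor (fun z => fourierL1 f (vopp z)) (swap i) x.
Proof.
case: i => m n Lf; rewrite (fourier_gabor m n _ Lf); rewrite /gabor /swap.
have -> : kern (intvec m) (vopp x) = cis (2 * pi * dot (intvec m) x).
  by rewrite /kern dotNr; congr cis; ring.
congr (_ * _); congr (fourierL1 f _).
by apply: euclid_ext => i; rewrite /= !ecoordE rmorphN/=; ring.
Qed.

Lemma gabor_cL1 f i : cL1 mu f -> cL1 mu (gabor f i).
Proof.
move=> Lf; have mf := cL1_meas Lf; apply: cL1P; first exact: gabor_meas.
have [_ foo] := integrableP _ _ _ (cL1_normc Lf); apply: le_lt_trans foo.
have mF : measurable_fun setT (fun x => `|(normc (f x))%:E|%E).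
  by apply: measurableT_comp => //; exact/measurable_EFinP/measurable_normc.
rewrite -(preserving_integral (preserving_translation (vopp (intvec i.1))) mF)//.
rewrite le_eqVlt; apply/orP; left; apply/eqP/eq_integral => x _.
by rewrite /gabor normcM normc_cis mul1r subvecE gee0_abs// lee_fin normc_ge0.
Qed.

(* If [u] approximates [g], then [u] minus the inverse transform of [gh] has the
   same norm as [fourierL1 u - gh], so [g] is that inverse transform; the latter
   maps the Gabor system of [gh] to the one of [g], up to relabelling. *)
Lemma supported_window_dual A B M g gh : is_fourierL2 g gh -> riesz_bounds A B (gabor g) ->
  supported_in_cube M gh ->
  exists2 f, frame_window A B M f & {ae mu, forall x, g x = fourierL1 f (vopp x)}.
Proof.
move=> [Lg Lgh [u [Lu ug uh]]] rb gM.
have [f [Lf fM gf]] := open_box_trunc Lgh gM.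
have fD := supported_bsupp fM; have L1f := bsupp_cL1 Lf fD.
have LT := inv_fourier_cL2 Lf fD.
have mgh := cL2_meas Lgh; have mf := cL2_meas Lf.
have gT : {ae mu, forall x, g x = fourierL1 f (vopp x)}.
  apply: (sql2_limit_unique (v := u)) => //.
  - by move=> j; have [/cL1_meas] := Lu j.
  - exact: cL2_meas Lg.
  - exact: cL2_meas LT.
  move: uh; apply: cvg_trans; apply: near_eq_cvg; apply: nearW => j.
  have [L1u L2u] := Lu j; have LF := fourier_cL2 L1u L2u.
  have mF := cL2_meas LF.
  rewrite -[LHS]/(sql2 mu (fun x => fourierL1 (u j) x - gh x)).
  rewrite (ae_eq_sql2 (G := fun x => fourierL1 (u j) x - f x) (cmeasB mF mgh) (cmeasB mF mf)); last first.
    by apply: filterS gf => x ->.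
  rewrite (sql2E (cL2B LF Lf)) (sql2E (cL2B L2u LT)); congr EFin.
  by rewrite (n2_sub_inv_fourier L1u L2u Lf fD) n2B// plancherel_L12.
exists f => //; split=> // J c uJ.
have [D' JD] := bsupp_gabor J fD.
have LS : cL2 mu (fun x => \sum_(i <- J) c i * gabor f i x).
  by apply: cL2_sum => i; apply: cL2Z; exact: gabor_cL2.
have mFS := fourier_meas (cL2_meas LS).
have -> : n2 mu (fun x => \sum_(i <- J) c i * gabor f i x) =
    n2 mu (fun x => \sum_(i <- map swap J) c (unswap i) * gabor g i x).
  rewrite (gabor_ae_n2 _ _ LT Lg gT) /n2 -(plancherel_compact LS (bsupp_lincomb JD)).
  rewrite -(reflect_sql2 mFS); congr fine; apply: eq_sql2 => x.
  rewrite fourier_lincomb; last by move=> i; exact: gabor_cL1.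
  rewrite big_map; congr normc; apply: eq_bigr => i _.
  by rewrite swapK inv_fourier_gabor.
have -> : \sum_(i <- J) normc (c i) ^+ 2 = \sum_(i <- map swap J) normc (c (unswap i)) ^+ 2.
  by rewrite big_map; apply: eq_bigr => i _; rewrite swapK.
apply: (riesz_finite (c \o unswap) rb) => [i|]; first exact: gabor_cL2.
by rewrite map_inj_uniq//; exact: can_inj swapK.
Qed.

End frame_window.

(** * Pointwise bounds on the Zak transform *)

Section weighted_domination.
Context d (X : measurableType d) (R : realType).
Variable mu : {measure set X -> \bar R}.
Implicit Types (w : X -> R) (F G : X -> R[i]).

Definition wint w F : \bar R := (\int[mu]_x (normc (F x) ^+ 2 * w x)%:E)%E.

Let wint_meas w F : measurable_fun setT w -> cmeas F ->
  measurable_fun setT (fun x => (normc (F x) ^+ 2 * w x)%:E).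
Proof.
by move=> mw mf; apply/measurable_EFinP/measurable_funM => //; exact: measurable_sqr_normc.
Qed.

Lemma wint_ge0 w F : (forall x, 0 <= w x) -> (0 <= wint w F)%E.
Proof. by move=> w0; apply: integral_ge0 => x _; rewrite lee_fin mulr_ge0 ?sqr_ge0. Qed.

Lemma wint_young (e : R) w F G : 0 < e -> measurable_fun setT w -> (forall x, 0 <= w x) ->
  cmeas F -> cmeas G ->
  (wint w (fun x => F x + G x)%R <= (1 + e)%:E * wint w F + (1 + e^-1)%:E * wint w G)%E.
Proof.
move=> e0 mw w0 mF mG.
have e1 : 0 <= e^-1 by rewrite invr_ge0 ltW.
have k0 H x : (0 <= (normc (H x) ^+ 2 * w x)%:E)%E by rewrite lee_fin mulr_ge0 ?sqr_ge0.
have c1 : (0 <= (1 + e)%:E)%E by rewrite lee_fin addr_ge0// ltW.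
have c2 : (0 <= (1 + e^-1)%:E)%E by rewrite lee_fin addr_ge0.
have m1 := wint_meas mw mF; have m2 := wint_meas mw mG.
rewrite /wint -!ge0_integralZl// -ge0_integralD//; try by
  [move=> x _; exact: mule_ge0|exact: measurable_funeM].
apply: ge0_le_integral => //.
- by move=> x _; rewrite lee_fin mulr_ge0 ?sqr_ge0.
- exact: (wint_meas mw (cmeasD mF mG)).
- by apply: emeasurable_funD; exact: measurable_funeM.
- move=> x _; rewrite -!EFinM -EFinD lee_fin.
  by apply: (le_trans (ler_wpM2r (w0 x) (sqr_normcD_young (F x) (G x) e0))); rewrite mulrDl !mulrA.
Qed.

Lemma wint_le w1 w2 F : measurable_fun setT w1 -> measurable_fun setT w2 ->
  (forall x, 0 <= w1 x) -> (forall x, w1 x <= w2 x) -> cmeas F -> (wint w1 F <= wint w2 F)%E.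
Proof.
move=> m1 m2 w0 w12 mF; apply: ge0_le_integral => //.
- by move=> x _; rewrite lee_fin mulr_ge0 ?sqr_ge0.
- exact: (wint_meas m1 mF).
- exact: (wint_meas m2 mF).
- by move=> x _; rewrite lee_fin ler_wpM2l ?sqr_ge0.
Qed.

(** The inequality passes to limits in [L^2(w)] because [w] dominates both weights; the free
    parameter of Young's inequality is what preserves the constant [C]. *)
Lemma dense_domination (P : set (X -> R[i])) w w1 w2 (C : R) F : 0 <= C ->
  measurable_fun setT w -> measurable_fun setT w1 -> measurable_fun setT w2 ->
  (forall x, 0 <= w1 x <= w x) -> (forall x, 0 <= w2 x <= w x) ->
  (forall p, P p -> cmeas p /\ (wint w1 p <= C%:E * wint w2 p)%E) ->
  cmeas F -> (wint w2 F < +oo)%E ->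
  (forall e : R, 0 < e -> exists2 p, P p & (wint w (fun x => F x - p x)%R < e%:E)%E) ->
  (wint w1 F <= C%:E * wint w2 F)%E.
Proof.
move=> C0 mw m1 m2 h1 h2 PC mF Foo dP.
have p1 x : 0 <= w1 x by case/andP: (h1 x).
have p2 x : 0 <= w2 x by case/andP: (h2 x).
have q1 x : w1 x <= w x by case/andP: (h1 x).
have q2 x : w2 x <= w x by case/andP: (h2 x).
have w2E : wint w2 F = (fine (wint w2 F))%:E by rewrite fineK// ge0_fin_numE// wint_ge0.
set a := fine _ in w2E; have a0 : 0 <= a by rewrite fine_ge0// wint_ge0.
rewrite w2E; apply/lee_addgt0Pr => n n0.
(* As [t <= 1], the excess [(2 t + t ^ 2) C a] is at most [3 t C a <= n / 2]. *)
pose t := Num.min 1 (n / (6 * (C * a + 1))).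
have Ca0 : 0 <= C * a by exact: mulr_ge0.
have t0 : 0 < t by rewrite lt_min ltr01 divr_gt0// mulr_gt0//; lra.
have t1 : t <= 1 by rewrite ge_min lexx.
have ti0 : 0 < t^-1 by rewrite invr_gt0.
have tn : 3 * t * (C * a) <= n / 2.
  have : t <= n / (6 * (C * a + 1)) by rewrite ge_min lexx orbT.
  rewrite ler_pdivlMr ?mulr_gt0//; last by lra.
  by move=> h; have := mulr_ge0 (ltW t0) Ca0; nra.
(* The total factor of the approximation error after both uses of Young's inequality; the error may
   then take the other [n / 2]. *)
pose K := (1 + t) * C * (1 + t^-1) + (1 + t^-1).
have K0 : 0 < K by rewrite ltr_wpDl ?addr_gt0// !mulr_ge0// addr_ge0// ltW.
have e0 : 0 < n / 2 / K by rewrite !divr_gt0.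
have [p Pp pF] := dP _ e0; have [mp pC] := PC p Pp.
set e := n / 2 / K in e0 pF.
have md : cmeas (fun x => F x - p x) by exact: cmeasB.
have d1 : (wint w1 (fun x => F x - p x)%R <= e%:E)%E.
  by apply: le_trans (ltW pF); exact: wint_le.
have d2 : (wint w2 (fun x => - (F x - p x))%R <= e%:E)%E.
  apply: le_trans (ltW pF); rewrite (_ : wint w2 _ = wint w2 (fun x => F x - p x)%R).
    exact: wint_le.
  by apply: eq_integral => x _; rewrite normc_opp.
have y1 := wint_young t0 m1 p1 mp md.
have y2 := wint_young t0 m2 p2 mF (cmeasN md).
rewrite (_ : (fun x => p x + (F x - p x)) = F) in y1; last by apply/funext => x; ring.
rewrite (_ : (fun x => F x + - (F x - p x)) = p) in y2; last by apply/funext => x; ring.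
have z2 : (wint w2 p <= ((1 + t) * a + (1 + t^-1) * e)%:E)%E.
  apply: (le_trans y2); rewrite w2E [X in (_ <= X)%E]EFinD !EFinM; apply: leeD => //.
  by apply: lee_wpmul2l => //; rewrite lee_fin addr_ge0// ltW.
have z1 : (wint w1 p <= (C * ((1 + t) * a + (1 + t^-1) * e))%:E)%E.
  by apply: (le_trans pC); rewrite EFinM; apply: lee_wpmul2l.
apply: (@le_trans _ _ ((1 + t)%:E * (C * ((1 + t) * a + (1 + t^-1) * e))%:E + (1 + t^-1)%:E * e%:E)%E).
  apply: (le_trans y1); apply: leeD; apply: lee_wpmul2l => //;
    by rewrite lee_fin addr_ge0// ltW.
rewrite -!EFinM -!EFinD lee_fin.
have -> : (1 + t) * (C * ((1 + t) * a + (1 + t^-1) * e)) + (1 + t^-1) * e =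
  C * a + (2 * t + t ^+ 2) * (C * a) + K * e by rewrite /K; ring.
have -> : K * e = n / 2 by rewrite /e; field; lra.
have : t ^+ 2 <= t by rewrite expr2 ler_piMl// ltW.
move=> tt; have : (2 * t + t ^+ 2) * (C * a) <= 3 * t * (C * a) by apply: ler_wpM2r => //; lra.
by move: tn; lra.
Qed.

(** Tested on the set where the inequality fails, the hypothesis forces a nonnegative function to
    have integral at most 0; the finite integral of [w2] allows the subtraction. *)
Lemma ae_domination (w1 w2 : X -> R) (C : R) : measurable_fun setT w1 -> measurable_fun setT w2 ->
  (forall x, 0 <= w1 x) -> (forall x, 0 <= w2 x) -> 0 <= C ->
  (\int[mu]_x (w2 x)%:E < +oo)%E ->
  (forall E, measurable E -> (wint w1 (fun x => (\1_E x)%:C%C) <= C%:E * wint w2 (fun x => (\1_E x)%:C%C))%E) ->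
  {ae mu, forall x, w1 x <= C * w2 x}.
Proof.
move=> m1 m2 p1 p2 C0 i2 h.
pose E := [set x | C * w2 x < w1 x].
have mCw : measurable_fun setT (fun x => C * w2 x) by apply: measurable_funM => //; exact: measurable_cst.
have mE : measurable E.
  rewrite (_ : E = (fun x => w1 x - C * w2 x) @^-1` `]0, +oo[%classic); last first.
    by apply/seteqP; split => x; rewrite /E/= in_itv/= andbT subr_gt0.
  by rewrite -[X in measurable X]setTI; apply: measurable_funB.
have wE w : wint w (fun x => (\1_E x)%:C%C) = (\int[mu]_x (\1_E x * w x)%:E)%E.
  by apply: eq_integral => x _; rewrite normc_real indicE; case: (x \in E); rewrite ?normr1 ?normr0 ?expr1n ?expr0n.
have mi : measurable_fun setT (\1_E : X -> R) by exact: measurable_indic.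
pose D x := \1_E x * (w1 x - C * w2 x).
have D0 x : 0 <= D x.
  rewrite /D indicE; case: (boolP (x \in E)) => [|_]; last by rewrite mul0r.
  by rewrite inE /E/= mul1r subr_ge0 => /ltW.
have mD : measurable_fun setT (fun x => (D x)%:E).
  by apply/measurable_EFinP/measurable_funM => //; exact: measurable_funB.
have mG : measurable_fun setT (fun x => (\1_E x * (C * w2 x))%:E).
  by apply/measurable_EFinP/measurable_funM.
have G0 x : (0 <= (\1_E x * (C * w2 x))%:E)%E.
  by rewrite lee_fin !mulr_ge0// indicE.
have Goo : (\int[mu]_x (\1_E x * (C * w2 x))%:E < +oo)%E.
  apply: (@le_lt_trans _ _ (C%:E * \int[mu]_x (w2 x)%:E)%E).
    rewrite -ge0_integralZl//; last 2 first.
    - exact/measurable_EFinP.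
    - by move=> x _; rewrite lee_fin.
    apply: ge0_le_integral => //.
    - by apply: measurable_funeM; exact/measurable_EFinP.
    - move=> x _; rewrite -EFinM lee_fin indicE; case: (x \in E); rewrite ?mul1r// mul0r.
      by rewrite mulr_ge0.
  rewrite lte_mul_pinfty//.
have : (\int[mu]_x (D x)%:E = 0)%E.
  have := h E mE; rewrite !wE.
  rewrite -ge0_integralZl//; last 2 first.
  - by apply/measurable_EFinP/measurable_funM.
  - by move=> x _; rewrite lee_fin mulr_ge0// indicE.
  rewrite (eq_integral (fun x => (D x)%:E + (\1_E x * (C * w2 x))%:E)%E); last first.
    by move=> x _; rewrite -EFinD; congr EFin; rewrite /D; ring.
  rewrite [X in (_ <= X)%E -> _](eq_integral (fun x => (\1_E x * (C * w2 x))%:E)%E); last first.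
    by move=> x _; rewrite -EFinM; congr EFin; ring.
  rewrite ge0_integralD//; last by move=> x _; rewrite lee_fin.
  rewrite -[X in (_ <= X)%E -> _]add0e leeD2rE; last first.
    by rewrite ge0_fin_numE//; apply: integral_ge0.
  move=> DD; apply/eqP; rewrite eq_le DD/=.
  by apply: integral_ge0 => x _; rewrite lee_fin.
have [+ _] := ae_eq_integral_abs mu measurableT mD => + DD.
rewrite (_ : (\int[mu]_x `|(D x)%:E|)%E = 0%E); last first.
  by rewrite -[RHS]DD; apply: eq_integral => x _; rewrite gee0_abs// lee_fin.
move=> /(_ erefl); apply: filterS => x /(_ Logic.I)/= [] /eqP.
rewrite /D indicE; case: (boolP (x \in E)) => [|/negP xE _].
  by rewrite inE /E/= mul1r subr_eq0 => + /eqP e; rewrite e ltxx.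
by rewrite leNgt; apply/negP => xw; apply: xE; rewrite inE.
Qed.

End weighted_domination.

Section zak_bounds.
Context {R : realType} {l : nat}.
Local Notation mu := (lebesgue_euclid R l).
Local Notation nu := (@cube_measure_restr R l).
Local Notation cube := (@cube R l).
Local Notation ZZ := (l.-tuple int).
Local Notation XX := (euclid R l * euclid R l)%type.
Local Notation nn := (nu \x nu)%E.
Implicit Types (x y s xi : euclid R l) (m n : ZZ) (k : 'I_l) (f g : euclid R l -> R[i]).
Implicit Types (F G : XX -> \bar R) (z : XX).

(** It is 1 almost everywhere for [nn]; as a factor of a weight it provides, at every point, the
    fundamental domain that [character_dense] requires. *)
Definition cube2 z : R := \1_cube z.1 * \1_cube z.2.

Lemma cube2_ge0 z : 0 <= cube2 z. Proof. by rewrite mulr_ge0// indicE. Qed.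

Lemma cube2_meas : measurable_fun setT cube2.
Proof.
have mc : measurable_fun setT (\1_cube : euclid R l -> R).
  by apply: measurable_indic; exact: cube_measurable.
apply: measurable_funM.
- exact: (measurableT_comp mc measurable_fst).
- exact: (measurableT_comp mc measurable_snd).
Qed.

Lemma prod_integral F : measurable_fun setT F -> (forall z, 0 <= F z)%E ->
  (\int[nn]_z F z = \int[nu]_x \int[nu]_y F (x, y))%E.
Proof. by move=> mF F0; rewrite fubini_tonelli1. Qed.

Lemma cube2_integral F : measurable_fun setT F -> (forall z, 0 <= F z)%E ->
  (\int[nn]_z (F z * (cube2 z)%:E) = \int[nn]_z F z)%E.
Proof.
move=> mF F0; have mc : measurable_fun setT (fun z => (cube2 z)%:E) by apply/measurable_EFinP; exact: cube2_meas.
have mFc : measurable_fun setT (fun z => F z * (cube2 z)%:E)%E by exact: emeasurable_funM.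
have Fc0 z : (0 <= F z * (cube2 z)%:E)%E by rewrite mule_ge0// lee_fin cube2_ge0.
rewrite (prod_integral mFc Fc0) (prod_integral mF F0).
apply: cube_integral_eq.
- exact: (measurable_fun_fubini_tonelli_F (m2 := nu) _ mFc Fc0).
- exact: (measurable_fun_fubini_tonelli_F (m2 := nu) _ mF F0).
move=> x cx; apply: cube_integral_eq.
- by apply: measurableT_comp mFc _; exact: measurable_pair1.
- by apply: measurableT_comp mF _; exact: measurable_pair1.
by move=> y cy; rewrite /cube2 /= !indicE !mem_set// mulr1 mule1.
Qed.

Lemma zchr_meas i : cmeas (zchr i : XX -> R[i]).
Proof.
apply: cmeasM; first exact: cmeas_comp (chr_meas _) measurable_fst.
by apply: cmeasJ; exact: cmeas_comp (chr_meas _) measurable_snd.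
Qed.

Lemma normc_zchr i z : normc (zchr i z) = 1.
Proof. by rewrite /zchr normcM normc_conj !normc_chr mulr1. Qed.

Lemma cube2_total : (\int[nn]_z 1%:E = 1%:E)%E.
Proof.
have e : (\int[nu]_x 1%:E = 1%:E)%E.
  by rewrite integral_cst// mul1e; exact: cube_total.
by rewrite (prod_integral (F := fun=> 1%:E))//; under eq_integral do rewrite e.
Qed.

Lemma bounded_integral_prod (h : XX -> R) (b : R) : measurable_fun setT h ->
  (forall z, 0 <= h z <= b) -> (\int[nn]_z (h z)%:E < +oo)%E.
Proof.
move=> mh hb; have b0 : 0 <= b.
  by have /andP[h1 h2] := hb (point, point); exact: le_trans h1 h2.
apply: (@le_lt_trans _ _ (\int[nn]_z (b%:E * 1%:E))%E).
  apply: ge0_le_integral => //.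
  - by move=> z _; rewrite lee_fin; case/andP: (hb z).
  - exact/measurable_EFinP.
  - by move=> z _; rewrite mule1 lee_fin; case/andP: (hb z).
by rewrite ge0_integralZl// cube2_total mule1 ltry.
Qed.

Lemma zchr_L2 i : cL2 nn (zchr i).
Proof.
split; first exact: zchr_meas.
apply: (@bounded_integral_prod _ 1); first exact/measurable_sqr_normc/zchr_meas.
by move=> z; rewrite normc_zchr expr1n ler01 lexx.
Qed.

Lemma zchr_orth i j : ip nn (zchr i) (zchr j) = (i == j)%:R.
Proof.
rewrite /ip cint_fubini1; last by apply: cL2_mul; exact: zchr_L2.
case: i j => [m n] [m' n'].
transitivity (cint nu (fun x => (m == m')%:R * (chr n x * ((chr n' x)^*)%C))).
  congr cint; apply/funext => x; rewrite -conj_chr_orth mulrC /ip -cintZ; last first.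
    by apply: cL2_mul; exact: conj_chr_L2.
  congr cint; apply/funext => y.
  rewrite -[zchr (m, n) _]/(chr n x * ((chr m y)^*)%C) -[zchr (m', n') _]/(chr n' x * ((chr m' y)^*)%C).
  by rewrite !conjcM; ring.
rewrite cintZ; last by apply: cL2_mul; exact: chr_L2.
rewrite -/(ip nu (chr n) (chr n')) chr_orth xpair_eqE.
by case: (m == m'); rewrite ?mul1r ?mul0r.
Qed.

Lemma prod_gen_lower_boxes : @measurable _ XX =
  <<s lower_boxes (fun (a : 'I_l + 'I_l) (z : XX) =>
    match a with inl i => ecoord z.1 i | inr i => ecoord z.2 i end) >>.
Proof.
set xi := (fun a z => _).
apply/seteqP; split; last first.
  apply: smallest_sub; first exact: sigma_algebra_measurable.
  move=> _ [b ->]; rewrite (_ : [set x | _] = \big[setI/setT]_(a : 'I_l + 'I_l)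
      [set z | ((xi a z)%:E <= b a)%E]).
    apply: bigsetI_measurable => -[] i _; rewrite -[X in measurable X]setTI; apply: emeasurable_fun_le => //; apply/measurable_EFinP.
    - exact: (measurableT_comp (measurable_ecoord i) measurable_fst).
    - exact: (measurableT_comp (measurable_ecoord i) measurable_snd).
  rewrite -bigcap_seq; apply/seteqP; split => x /= Ax i; first by move=> _; exact: Ax.
  by apply: Ax; rewrite /= mem_index_enum.
have h (e : XX -> euclid R l) (B : set (euclid R l)) :
    (forall b : 'I_l -> \bar R, lower_boxes xi (e @^-1` [set x | forall i, ((ecoord x i)%:E <= b i)%E])) ->
    measurable B -> <<s lower_boxes xi >> (e @^-1` B).
  move=> eP.
  suff : <<s lower_boxes (fun i x => ecoord x i : R) >> `<=`
      [set B : set (euclid R l) | <<s lower_boxes xi >> (e @^-1` B)].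
    by rewrite -euclid_gen_lower_boxes => sub /sub.
  apply: smallest_sub.
    split => /=.
    - by rewrite preimage_set0; exact: sigma_algebra0.
    - by move=> A sA; rewrite setTD preimage_setC; exact: sigma_algebraC.
    - by move=> F sF; rewrite preimage_bigcup; exact: sigma_algebra_bigcup.
  by move=> _ [b ->]; apply: sub_sigma_algebra; exact: eP.
apply: smallest_sub; first exact: smallest_sigma_algebra.
move=> _ [] [B mB <-]; rewrite setTI; apply: h => // b.
- exists (fun a => match a with inl i => b i | inr _ => +oo%E end).
  apply/seteqP; split=> z /= zb; last by move=> i; exact: (zb (inl i)).
  by case=> i /=; [exact: zb|rewrite leey].
- exists (fun a => match a with inr i => b i | inl _ => +oo%E end).
  apply/seteqP; split=> z /= zb; last by move=> i; exact: (zb (inr i)).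
  by case=> i /=; [rewrite leey|exact: zb].
Qed.

Lemma zchr_dense (q : XX -> R) (P : XX -> R[i]) (e : R) : measurable_fun setT q ->
  (forall z, 0 <= q z) -> (\int[nn]_z (q z)%:E < +oo)%E ->
  cmeas P -> (forall z, normc (P z) <= 1) -> 0 < e ->
  exists J (c : ZZ * ZZ -> R[i]), uniq J /\
    (wint nn (fun z => (1 + q z)%R * cube2 z)%R (fun z => P z - \sum_(i <- J) c i * zchr i z)%R < e%:E)%E.
Proof.
move=> mq q0 qoo mP P1 e0.
pose w z := (1 + q z) * cube2 z.
have q1 z : 0 <= 1 + q z by rewrite addr_ge0.
have w0 z : 0 <= w z by rewrite mulr_ge0 ?cube2_ge0.
have mw : measurable_fun setT w.
  by apply: measurable_funM; [exact: measurable_funD|exact: cube2_meas].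
have iw : nn.-integrable setT (EFin \o w).
  apply/integrableP; split; first exact/measurable_EFinP.
  rewrite (eq_integral (fun z => ((1 + q z)%:E * (cube2 z)%:E)%E)) => [|z _]; last first.
    by rewrite /= ger0_norm.
  rewrite cube2_integral//; last by apply/measurable_EFinP; exact: measurable_funD.
  under eq_integral do rewrite EFinD.
  rewrite ge0_integralD//; [|by move=> z _; rewrite lee_fin|exact/measurable_EFinP].
  by rewrite cube2_total lte_add_pinfty// ltry.
(* The sign [~~ b] compensates the conjugate on the second factor of [zchr]. *)
pose u (a : 'I_l + 'I_l) (b : bool) : ZZ * ZZ := match a with
  inl i => (zeroz, unitz i b) | inr i => (unitz i (~~ b), zeroz) end.
have := @character_dense _ XX R nn w w0 iw ('I_l + 'I_l)%type _ prod_gen_lower_boxes _ _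
  (@zchr R l) (zeroz, zeroz) (fun i j => (addz i.1 j.1, addz i.2 j.2)) u zchr_meas _ _ _ P mP.
case/(_ _ _ _ _ _ e e0).
- move=> z wz; have : cube2 z != 0 by apply: contra_neq wz => h; rewrite /w h mulr0.
  rewrite /cube2 !indicE mulf_eq0 negb_or => /andP[].
  case: (boolP (z.1 \in cube)); rewrite ?eqxx// inE => c1 _.
  case: (boolP (z.2 \in cube)); rewrite ?eqxx// inE => c2 _.
  by case=> i; [exact: c1|exact: c2].
- by move=> z; rewrite /zchr !chr0 conjc1 mulr1.
- by move=> i j z; rewrite /zchr !chrD conjcM; ring.
- case=> i b z.
    rewrite -[LHS]/(chr (unitz i b) z.1 * ((chr zeroz z.2)^*)%C).
    by rewrite chr0 chr_unit conjc1 mulr1.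
  rewrite -[LHS]/(chr zeroz z.1 * ((chr (unitz i (~~ b)) z.2)^*)%C).
  by rewrite chr0 chr_unit mul1r -cisN; congr cis; case: b; rewrite /= ?expr0 ?expr1; ring.
- have mPw : measurable_fun setT (fun z => (normc (P z) ^+ 2 * w z)).
    by apply: measurable_funM => //; exact: measurable_sqr_normc.
  apply: (le_integrable measurableT _ _ iw); first exact/measurable_EFinP.
  have Pw0 z : 0 <= normc (P z) ^+ 2 * w z by rewrite mulr_ge0 ?sqr_ge0.
  move=> z _; rewrite /= lee_fin !ger0_norm//.
  by apply: ler_piMl => //; rewrite expr_le1//; exact: normc_ge0.
by move=> J [c [uJ h]]; exists J, c.
Qed.

(** The finite Riesz inequalities compare the means of [|p| ^ 2] and [|p| ^ 2 |H| ^ 2] for all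
    trigonometric polynomials [p] on the product of two cubes. By density for the weight
    [1 + |H| ^ 2] they hold for indicators, hence pointwise. *)
Lemma zak_bounds A B M f : 0 < A -> 0 <= B -> frame_window A B M f ->
  {ae nn, forall z, A <= normc (zak f z.1 z.2) ^+ 2 <= B}.
Proof.
move=> A0 B0 [Lf fM fAB]; have mf := cL2_meas Lf; have fD := supported_bsupp fM.
have mz := zak_meas mf fD; pose q z := normc (zak f z.1 z.2) ^+ 2.
have mq : measurable_fun setT q by exact: measurable_sqr_normc.
have q0 z : 0 <= q z by exact: sqr_ge0.
have qoo : (\int[nn]_z (q z)%:E < +oo)%E.
  have mqE : measurable_fun setT (fun z => (q z)%:E) by exact/measurable_EFinP.
  have q0E z : (0 <= (q z)%:E)%E by rewrite lee_fin.
  by rewrite (prod_integral mqE q0E) (zak_isometry mf fD); case: Lf.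
pose comb (J : seq (ZZ * ZZ)) (c : ZZ * ZZ -> R[i]) z := \sum_(i <- J) c i * zchr i z.
have mcomb J c : cmeas (comb J c).
  by apply: cmeas_sum => i; apply: cmeasM; [exact: cmeas_cst|exact: zchr_meas].
have Lcomb J c : cL2 nn (comb J c) by apply: cL2_sum => i; apply: cL2Z; exact: zchr_L2.
have w2E J c : uniq J -> wint nn (fun=> 1) (comb J c) = (\sum_(i <- J) normc (c i) ^+ 2)%:E.
  move=> uJ; rewrite -(n2_lincomb zchr_L2 zchr_orth c uJ) -(sql2E (Lcomb J c)).
  by apply: eq_integral => z _; rewrite mulr1.
have LG : forall (J : seq (ZZ * ZZ)) (c : ZZ * ZZ -> R[i]), cL2 mu (fun x => \sum_(i <- J) c i * gabor f i x).
  by move=> J c; apply: cL2_sum => i; apply: cL2Z; exact: gabor_cL2.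
have w1E J c : wint nn q (comb J c) = (n2 mu (fun x => \sum_(i <- J) c i * gabor f i x))%:E.
  have mW : measurable_fun setT (fun z => (normc (comb J c z) ^+ 2 * q z)%:E).
    by apply/measurable_EFinP/measurable_funM => //; exact: measurable_sqr_normc.
  have W0 z : (0 <= (normc (comb J c z) ^+ 2 * q z)%:E)%E by rewrite lee_fin mulr_ge0 ?sqr_ge0.
  by rewrite -(sql2E (LG J c)) -(gabor_combo_zak J c mf fD) /wint (prod_integral mW W0).
have cc (w : XX -> R) (P : XX -> R[i]) : measurable_fun setT w -> (forall z, 0 <= w z) -> cmeas P ->
    wint nn (fun z => w z * cube2 z) P = wint nn w P.
  move=> mw w0 mP; rewrite /wint -[RHS]cube2_integral.
  - by apply: eq_integral => z _; rewrite -EFinM mulrA.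
  - by apply/measurable_EFinP/measurable_funM => //; exact: measurable_sqr_normc.
  - by move=> z; rewrite lee_fin mulr_ge0 ?sqr_ge0.
(* Used with the weights [|H| ^ 2] and 1 for the upper bound, and with 1 and [|H| ^ 2] for the lower
   one. *)
have dom (w1 w2 : XX -> R) (C : R) : 0 <= C -> measurable_fun setT w1 -> measurable_fun setT w2 ->
    (forall z, 0 <= w1 z <= 1 + q z) -> (forall z, 0 <= w2 z <= 1 + q z) ->
    (\int[nn]_z (w2 z)%:E < +oo)%E ->
    (forall J c, uniq J -> wint nn w1 (comb J c) <= C%:E * wint nn w2 (comb J c))%E ->
    {ae nn, forall z, w1 z <= C * w2 z}.
  move=> C0 m1 m2 h1 h2 w2oo hC.
  have p1 z : 0 <= w1 z by case/andP: (h1 z).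
  have p2 z : 0 <= w2 z by case/andP: (h2 z).
  apply: ae_domination => // E mE; set F := fun z => _.
  have mF : cmeas F by apply: cmeas_real; exact: measurable_indic.
  have F1 z : normc (F z) <= 1.
    by rewrite /F normc_real indicE; case: (z \in E); rewrite ?normr1 ?normr0.
  rewrite -(cc w1)// -(cc w2)//.
  apply: (@dense_domination _ XX R nn [set p | exists2 J, uniq J & exists c, p = comb J c]
    (fun z => (1 + q z) * cube2 z)) => //.
  - by apply: measurable_funM; [exact: measurable_funD|exact: cube2_meas].
  - by apply: measurable_funM => //; exact: cube2_meas.
  - by apply: measurable_funM => //; exact: cube2_meas.
  - move=> z; have /andP[a b] := h1 z.
    by rewrite mulr_ge0 ?cube2_ge0//= ler_wpM2r ?cube2_ge0.
  - move=> z; have /andP[a b] := h2 z.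
    by rewrite mulr_ge0 ?cube2_ge0//= ler_wpM2r ?cube2_ge0.
  - move=> _ [J uJ [c ->]]; split=> //.
    by rewrite (cc w1)// (cc w2)//; exact: hC.
  - rewrite cc//; apply: le_lt_trans w2oo; apply: ge0_le_integral => //.
    + by move=> z _; rewrite lee_fin mulr_ge0 ?sqr_ge0.
    + by apply/measurable_EFinP/measurable_funM => //; exact: measurable_sqr_normc.
    + exact/measurable_EFinP.
    + by move=> z _; rewrite lee_fin; apply: ler_piMl => //; rewrite expr_le1//; exact: normc_ge0.
  - move=> e e0; have [J [c [uJ h]]] := zchr_dense mq q0 qoo mF F1 e0.
    by exists (comb J c) => //; exists J => //; exists c.
have up : {ae nn, forall z, q z <= B * 1}.
  apply: (dom q (fun=> 1) B) => //.
  - by move=> z; rewrite q0 lerDr ler01.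
  - by move=> z; rewrite ler01 lerDl q0.
  - by rewrite cube2_total ltry.
  - by move=> J c uJ; rewrite w2E// w1E -EFinM lee_fin; case/andP: (fAB J c uJ).
have lo : {ae nn, forall z, 1 <= A^-1 * q z}.
  apply: (dom (fun=> 1) q A^-1) => //.
  - by rewrite invr_ge0 ltW.
  - by move=> z; rewrite ler01 lerDl q0.
  - by move=> z; rewrite q0 lerDr ler01.
  - move=> J c uJ; rewrite w2E// w1E -EFinM lee_fin.
    by rewrite ler_pdivlMl//; case/andP: (fAB J c uJ).
move: up lo; apply: filterS2 => z; rewrite mulr1 => h1.
by rewrite ler_pdivlMl// mulr1 => h2; apply/andP; split.
Qed.

End zak_bounds.

(** * Low-pass filtering the Zak transform *)

Section smoothing.
Context {R : realType} {l : nat}.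
Local Notation mu := (lebesgue_euclid R l).
Local Notation nu := (@cube_measure_restr R l).
Local Notation cube := (@cube R l).
Local Notation ZZ := (l.-tuple int).
Local Notation XX := (euclid R l * euclid R l)%type.
Local Notation nn := (nu \x nu)%E.
Implicit Types (x y s xi : euclid R l) (m n : ZZ) (f g : euclid R l -> R[i]).
Variables (k : 'I_l) (Q N D : nat) (f : euclid R l -> R[i]).
Hypothesis Lf : cL2 mu f.
Hypothesis fD : bsupp D f.
Hypothesis N0 : (0 < N)%N.
Hypothesis NQ : (3 * N <= Q)%N.

Let mf : cmeas f := cL2_meas Lf.
Let Q0 : (0 < Q)%N. Proof. lia. Qed.
Let Qr0 : Q%:R != 0 :> R. Proof. by rewrite pnatr_eq0 -lt0n. Qed.

Definition fracp y : R := ecoord y k - (Num.floor (ecoord y k))%:~R.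

Definition back x (q : nat) : euclid R l := vadd x (kvec k (- (q%:R / Q%:R))).

(* [zak f x y] has frequencies [n + y] in [x], so the kernel in the direction [k]
   is modulated by the fractional part of [ecoord y k]. *)
Definition smooth x y : R[i] :=
  (Q%:R^-1)%:C%C * \sum_(q < Q) vdp Q N (fracp y) q * zak f (back x q) y.

Definition err x y : R[i] := zak f x y - smooth x y.

Lemma fracp_itv y : 0 <= fracp y <= 1.
Proof.
rewrite /fracp; have := floor_le_tmp (ecoord y k); have := floorD1_gt (ecoord y k).
by rewrite intrD => h1 h2; apply/andP; split; lra.
Qed.

Lemma fracp_cube y : cube y -> fracp y = ecoord y k.
Proof.
move=> /(_ k) h; rewrite /fracp (Num.Theory.floor_def (m := 0)) ?subr0//.
Qed.

Lemma fracp_addz y m : fracp (vadd y (intvec m)) = fracp y.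
Proof.
rewrite /fracp !ecoordE floorDrz ?intr_int// intrKfloor rmorphD/=; ring.
Qed.

Lemma back_addz x m q : back (vadd x (intvec m)) q = vadd (back x q) (intvec m).
Proof. exact: vaddAC. Qed.

Lemma backS x q : back x q.+1 = back (vadd x (kvec k (- Q%:R^-1))) q.
Proof.
apply: euclid_ext => i; rewrite !ecoordE; case: eqP => _; last by rewrite !addr0.
by rewrite -natr1; field.
Qed.

Lemma backQ x : back x Q = vadd x (intvec (unitz k true)).
Proof.
apply: euclid_ext => i; rewrite !ecoordE tnth_mktuple; case: eqP => // _.
by rewrite divff// expr1 rmorphN1.
Qed.

Lemma smooth_addx x y m : smooth (vadd x (intvec m)) y = chr m y * smooth x y.
Proof.
rewrite /smooth [RHS]mulrCA; congr (_ * _); rewrite mulr_sumr; apply: eq_bigr => q _.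
by rewrite back_addz zak_shiftx mulrCA.
Qed.

Lemma smooth_addy x y m : smooth x (vadd y (intvec m)) = smooth x y.
Proof.
by rewrite /smooth fracp_addz; congr (_ * _); apply: eq_bigr => q _; rewrite zak_shifty.
Qed.

Lemma err_addx x y m : err (vadd x (intvec m)) y = chr m y * err x y.
Proof. by rewrite /err zak_shiftx smooth_addx mulrBr. Qed.

Lemma err_addy x y m : err x (vadd y (intvec m)) = err x y.
Proof. by rewrite /err zak_shifty smooth_addy. Qed.

Lemma measurable_fracp : measurable_fun setT fracp.
Proof.
apply: measurable_funB; first exact: measurable_ecoord.
apply: (measurableT_comp (f := fun t : R => (Num.floor t)%:~R : R)); last exact: measurable_ecoord.
by apply: nondecreasing_measurable => // s t st; rewrite ler_int; exact: Num.Theory.le_floor.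
Qed.

Lemma back_meas q : measurable_fun setT (back ^~ q).
Proof. exact: measurable_vadd. Qed.

Lemma smooth_meas : cmeas (fun z : XX => smooth z.1 z.2).
Proof.
apply: cmeasM; first exact: cmeas_cst.
apply: cmeas_sum => q; apply: cmeasM.
  apply: cmeasM; first exact: cmeas_cst.
  apply: cmeas_sum => i; apply: cmeas_sum => j; apply: cmeas_cis.
  apply: measurable_funM; first exact: measurable_cst.
  apply: measurable_funM; last exact: measurable_cst.
  apply: measurable_funM; last exact: measurable_cst.
  apply: measurable_funD; first exact: measurable_cst.
  exact: (measurableT_comp measurable_fracp measurable_snd).
apply: (cmeas_comp (h := fun z : XX => (back z.1 q, z.2)) (zak_meas mf fD)).
apply: measurable_fun_pair; last exact: measurable_snd.
exact: (measurableT_comp (back_meas q) measurable_fst).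
Qed.

Lemma err_meas : cmeas (fun z : XX => err z.1 z.2).
Proof. by apply: cmeasB; [exact: zak_meas mf fD|exact: smooth_meas]. Qed.

(** The integrand of a Fourier coefficient in [x]. It is periodic in [x], so the translations by
    [back] do not change its integral. *)
Let twist y n x := zak f x y * kern x y * ((chr n x)^*)%C.

Let twist_addz y n m x : twist y n (vadd x (intvec m)) = twist y n x.
Proof.
rewrite /twist zak_shiftx kernDl kern_chrl chr_periodic.
rewrite [X in X * _](_ : _ = zak f x y * kern x y * (chr m y * ((chr m y)^*)%C)); last by ring.
by rewrite mul_conjc normc_chr expr1n mulr1.
Qed.

Let twist_meas y n : cmeas (twist y n).
Proof.
apply: cmeasM; last by apply: cmeasJ; exact: chr_meas.
by apply: cmeasM; [exact: zak_meas1 mf fD|exact: kern_meas1].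
Qed.

Let twist_L1 y n : cL1 nu (twist y n).
Proof.
have L : cL2 nu (fun x => zak f x y * kern x y).
  apply: (cL2_cond _ _ (zak_cL2 y Lf fD)) => [|x].
    by apply: cmeasM; [exact: zak_meas1 mf fD|exact: kern_meas1].
  by rewrite normcM normc_kern mulr1.
exact: (cL2_mul L (@chr_L2 R l n)).
Qed.

Let twist_back_L1 y n q : cL1 nu (fun x => twist y n (back x q)).
Proof.
have mt := twist_meas y n.
apply: cL1P; first exact: cmeas_comp mt (back_meas q).
have mtn : measurable_fun setT (fun x => (normc (twist y n x))%:E).
  exact/measurable_EFinP/measurable_normc.
rewrite (integral_periodic_shift (kvec k (- (q%:R / Q%:R))) mtn).
- have [_] := integrableP _ _ _ (cL1_normc (twist_L1 y n)); apply: le_lt_trans.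
  rewrite le_eqVlt; apply/orP; left; apply/eqP/eq_integral => x _.
  by rewrite gee0_abs// lee_fin normc_ge0.
- by move=> x; rewrite lee_fin normc_ge0.
- by move=> m x; rewrite twist_addz.
Qed.

Lemma err_cL2 y : cL2 nu (fun x => err x y).
Proof.
have Lz := zak_cL2 y Lf fD.
have mz := zak_meas1 y mf fD.
have msq := measurable_sqr_normc mz.
apply: cL2B => //; apply: cL2Z; apply: cL2_sum => q; apply: cL2Z.
split; first exact: (cmeas_comp mz (back_meas q)).
rewrite /sql2 (integral_periodic_shift (F := fun x => (normc (zak f x y) ^+ 2)%:E) (kvec k (- (q%:R / Q%:R)))).
- by case: Lz.
- exact/measurable_EFinP.
- by move=> x; rewrite lee_fin sqr_ge0.
- by move=> m x; rewrite zak_shiftx normcM normc_chr mul1r.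
Qed.

(** The filter is a Fourier multiplier: the translation by [q / Q] brings in a phase at the
    frequency [n_k + y_k], and [vdpP] sums these phases. The condition [cube y] identifies [fracp y]
    with [y_k]. *)
Lemma err_coef y n : cube y ->
  ip nu (fun x => err x y * kern x y) (chr n) =
  (1 - vdp_mult Q N (tnth n k))%:C%C * fourierL1 f (vadd y (intvec n)).
Proof.
move=> cy; rewrite -(zak_coef y n Lf fD).
have -> : ip nu (fun x => zak f x y * kern x y) (chr n) = cint nu (twist y n) by [].
pose c (q : nat) := (Q%:R^-1)%:C%C * (vdp Q N (fracp y) q *
  cis (- (2 * pi * (((tnth n k)%:~R + fracp y) * q%:R / Q%:R)))).
transitivity (cint nu (fun x => twist y n x - \sum_(q < Q) c q * twist y n (back x q))).
  congr cint; apply/funext => x; rewrite /err !mulrBl; congr (_ - _).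
  rewrite /smooth -!mulrA mulr_suml mulr_sumr; apply: eq_bigr => q _.
  rewrite /c /twist; pose v : euclid R l := kvec k (- (q%:R / Q%:R)).
  have -> : kern (back x q) y = kern x y * kern v y by rewrite kernDl.
  have -> : chr n (back x q) = chr n x * chr n v by rewrite /chr dotDr mulrDr cisD.
  have e : cis (- (2 * pi * (((tnth n k)%:~R + fracp y) * q%:R / Q%:R))) *
      (kern v y * ((chr n v)^*)%C) = 1.
    rewrite (fracp_cube cy) /chr -cisN /kern -!cisD -[RHS]cis0; congr cis.
    by rewrite dot_kvecl dot_kvecr ecoordE; ring.
  rewrite conjcM.
  set C := cis _ in e *; set K := kern v y in e *; set H := ((chr n v)^*)%C in e *.
  transitivity ((Q%:R^-1)%:C%C * (vdp Q N (fracp y) q * zak f (back x q) y * kern x y * ((chr n x)^*)%C) * (C * (K * H))).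
    by rewrite e mulr1 !mulrA.
  ring.
rewrite cintB//; last first.
  by apply: cL1_sum => q; apply: cL1Z; exact: twist_back_L1.
rewrite cint_sum; last by move=> q; apply: cL1Z; exact: twist_back_L1.
rewrite rmorphB/= mulrBl rmorph1 mul1r; congr (_ - _).
rewrite -(vdpP N Q0 (fracp y)) -mulrA mulr_suml mulr_sumr; apply: eq_bigr => q _.
rewrite cintZ; last exact: twist_back_L1.
rewrite (cint_periodic_shift (F := twist y n) (kvec k (- (q%:R / Q%:R)))) /c ?mulrA//.
Qed.

(** The multiplier [1 - vdp_mult] lies between 0 and 1 and vanishes for [|n_k| <= N]. *)
Lemma err_fiber y : cube y ->
  (sql2 nu (fun x => err x y) <=
   \esum_(n in [set: ZZ]) (normc (fourierL1 f (vadd y (intvec n))) ^+ 2 *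
      (N%:R <= `|ecoord (vadd y (intvec n)) k|)%R%:R)%:E)%E.
Proof.
move=> cy; have Le := err_cL2 y.
have L : cL2 nu (fun x => err x y * kern x y).
  apply: (cL2_cond _ _ Le) => [|x]; last by rewrite normcM normc_kern mulr1.
  by apply: cmeasM; [exact: cL2_meas Le|exact: kern_meas1].
rewrite (_ : sql2 nu _ = sql2 nu (fun x => err x y * kern x y)); last first.
  by apply: eq_sql2 => x; rewrite normcM normc_kern mulr1.
rewrite -(parseval L); apply: le_esum => n _; rewrite err_coef// lee_fin.
rewrite normcM normc_real exprMn mulrC ler_wpM2l ?sqr_ge0//.
have v0 := @vdp_mult_ge0 R Q N (tnth n k).
have v1 := @vdp_mult_le1 R Q N Q0 N0 NQ (tnth n k).
have [nN|nN] := leqP `|tnth n k| N.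
  by rewrite (vdp_mult1 Q0 N0 NQ)// subrr normr0 expr0n ler0n.
(* For negative [n_k], adding [y_k] moves the frequency towards 0 by less than 1; this is made up
   for by [|n_k| >= N + 1]. *)
rewrite (_ : (N%:R <= _) = true); last first.
  apply/idP; rewrite !ecoordE; have := cy k => /andP[y0 y1].
  have [n0|n0] := lerP 0 (tnth n k).
    have : (N%:R <= (tnth n k)%:~R :> R) by rewrite -[N%:R]/(N%:~R) ler_int; lia.
    by move=> h; have NN : 0 <= N%:R :> R by []; rewrite ger0_norm; lra.
  have : ((tnth n k)%:~R <= - (N%:R + 1) :> R).
    by rewrite -[N%:R]/(N%:~R) -(intrD _ N 1) -rmorphN ler_int; lia.
  by move=> h; have NN : 0 <= N%:R :> R by []; rewrite ler0_norm; lra.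
by rewrite expr_le1// ler_norml; apply/andP; split; lra.
Qed.

Lemma err_tail :
  (\int[nn]_z (normc (err z.1 z.2) ^+ 2)%:E <=
   \int[mu]_xi (normc (fourierL1 f xi) ^+ 2 * (N%:R <= `|ecoord xi k|)%R%:R)%:E)%E.
Proof.
have mE : measurable_fun setT (fun z : XX => (normc (err z.1 z.2) ^+ 2)%:E).
  by apply/measurable_EFinP/measurable_sqr_normc; exact: err_meas.
have E0 (z : XX) : (0 <= (normc (err z.1 z.2) ^+ 2)%:E)%E by rewrite lee_fin sqr_ge0.
pose G xi := normc (fourierL1 f xi) ^+ 2 * (N%:R <= `|ecoord xi k|)%R%:R.
have mG : measurable_fun setT (fun xi => (G xi)%:E) by exact: high_freq_meas.
have G0 xi : (0 <= (G xi)%:E)%E by rewrite lee_fin mulr_ge0 ?sqr_ge0.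
rewrite (prod_integral mE E0) (fubini_tonelli (m1 := nu) (m2 := nu) _ mE E0).
rewrite [leRHS](integral_cells mG G0).
have mGm n : measurable_fun setT (fun y => (G (vadd y (intvec n)))%:E).
  exact: (measurableT_comp mG (measurable_vadd _)).
rewrite -integral_esum//.
have mes : measurable_fun setT (fun y => \esum_(n in [set: ZZ]) (G (vadd y (intvec n)))%:E)%E.
  under eq_fun do rewrite esum_pickle//.
  rewrite (_ : (fun y => _) = (fun y => (\sum_(j <oo | j \in predT)
      oapp (fun n => (G (vadd y (intvec n)))%:E) 0%E (@pickle_inv ZZ j))%E)); last first.
    by apply/funext => y; apply: eq_eseriesl => j.
  apply: ge0_emeasurable_sum => [j y _ _|j _]; case: (pickle_inv j) => [n|]//=.
apply: (ae_ge0_le_integral measurableT).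
- by move=> y _; exact: sql2_ge0.
- exact: (measurable_fun_fubini_tonelli_G (m1 := nu) _ mE E0).
- by move=> y _; apply: esum_ge0.
- exact: mes.
- by apply/cube_ae; apply: aeW => y cy _; exact: err_fiber.
Qed.

(** As the Zak transform is bounded almost everywhere only, the bound is asked at the finitely many
    points [back x q], which will be grid points. *)
Lemma smooth_step (b : R) x y : (forall q, (q <= Q)%N -> normc (zak f (back x q) y) <= b) ->
  normc (smooth x y - smooth (vadd x (kvec k (- Q%:R^-1))) y) <= 64 * b * N%:R / Q%:R.
Proof.
move=> zb.
have e : zak f (back x Q) y = cis (- (2 * pi * fracp y)) * zak f (back x 0) y.
  rewrite backQ zak_shiftx chr_unit (_ : back x 0 = x); last first.
    apply: euclid_ext => i; rewrite !ecoordE; case: eqP => _; last by rewrite addr0.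
    by rewrite mul0r oppr0 addr0.
  congr (_ * _); rewrite /fracp expr1.
  rewrite (_ : - (2 * pi * (ecoord y k - _)) = - (2 * pi * ecoord y k) + 2 * pi * (Num.floor (ecoord y k))%:~R); last by ring.
  by rewrite cisD cis_int mulr1; congr cis; ring.
have eS : \sum_(q < Q) vdp Q N (fracp y) q * zak f (back (vadd x (kvec k (- Q%:R^-1))) q) y =
    \sum_(q < Q) vdp Q N (fracp y) q * zak f (back x q.+1) y.
  by apply: eq_bigr => q _; rewrite backS.
by rewrite /smooth eS; exact: (vdp_smooth_step Q0 N0 NQ (fracp_itv y) zb e).
Qed.

End smoothing.

Section zak_bandlimited.
Context {R : realType} {l : nat}.
Implicit Types (x y s xi : euclid R l) (m n : l.-tuple int) (f g : euclid R l -> R[i]).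
Variables (k : 'I_l) (Q N D r : nat) (f : euclid R l -> R[i]).
Hypothesis fD : bsupp D f.
Hypothesis N0 : (0 < N)%N.
Hypothesis NQ : (3 * N <= Q)%N.
Hypothesis DN : (D + r <= N)%N.

(* In the variable [y], [zak f x y] is a trigonometric polynomial of degree at
   most [N], which the kernel reproduces exactly. *)
Lemma zak_step (b : R) x y : (forall i, `|ecoord x i| <= r%:R) ->
  (forall q, (q <= Q)%N -> normc (zak f x (back k Q y q)) <= b) ->
  normc (zak f x y - zak f x (vadd y (kvec k (- Q%:R^-1)))) <= 64 * b * N%:R / Q%:R.
Proof.
move=> xr zb.
have Q0 : (0 < Q)%N by lia.
have Qr0 : Q%:R != 0 :> R by rewrite pnatr_eq0 -lt0n.
have rep (v : euclid R l) :
    (Q%:R^-1)%:C%C * \sum_(q < Q) vdp Q N 0 q * zak f x (back k Q v q) = zak f x v.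
  under eq_bigr do rewrite (zakE _ fD xr DN) mulr_sumr.
  rewrite exchange_big mulr_sumr (zakE _ fD xr DN) big_seq [RHS]big_seq.
  apply: eq_bigr => m; rewrite mem_boxz => /forallP mN.
  have mk : (`|- tnth m k| <= N)%N by rewrite abszN; exact: mN.
  have := @vdpP R Q N Q0 0 (- tnth m k).
  rewrite (@vdp_mult1 R Q N Q0 N0 NQ _ mk) -[(1%:C)%C]/(1 : R[i]) => e.
  have key (q : nat) : ((chr m (back k Q v q))^*)%C = ((chr m v)^*)%C *
      cis (- (2 * pi * (((- tnth m k)%:~R + 0) * q%:R / Q%:R))).
    have -> : chr m (back k Q v q) = chr m v * chr m (kvec k (- (q%:R / Q%:R))).
      by rewrite /chr dotDr mulrDr cisD.
    rewrite conjcM /chr -[X in _ * X]cisN dot_kvecr ecoordE rmorphN/=.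
    by congr (_ * cis _); ring.
  under eq_bigr => q _ do rewrite key.
  by rewrite -[RHS]mulr1 -e !mulr_sumr; apply: eq_bigr => q _; ring.
have e : zak f x (back k Q y Q) = cis (- (2 * pi * 0)) * zak f x (back k Q y 0).
  rewrite (backQ k N0 NQ) zak_shifty mulr0 oppr0 cis0 mul1r; congr (zak f x _).
  apply: euclid_ext => i; rewrite !ecoordE; case: eqP => _; last by rewrite addr0.
  by rewrite mul0r oppr0 addr0.
have s01 : 0 <= (0 : R) <= 1 by rewrite lexx ler01.
have eS : \sum_(q < Q) vdp Q N 0 q * zak f x (back k Q (vadd y (kvec k (- Q%:R^-1))) q) =
    \sum_(q < Q) vdp Q N 0 q * zak f x (back k Q y q.+1).
  by apply: eq_bigr => q _; rewrite (backS k N0 NQ).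
by rewrite -(rep y) -[X in _ - X]rep eS; exact: (vdp_smooth_step Q0 N0 NQ s01 zb e).
Qed.

End zak_bandlimited.

(** * Fourier mass at high frequencies *)

Section grid_error.
Context {R : realType} {l : nat}.
Implicit Types (x y s xi : euclid R l) (m n : l.-tuple int).
Variables (k : 'I_l) (N N' D q0 : nat) (f : euclid R l -> R[i]) (a b : R).
Hypothesis fD : bsupp D f.
Hypothesis N0 : (0 < N)%N.
Hypothesis DN : (D + 3 <= N')%N.
Hypothesis q08 : (4 <= q0)%N.
Hypothesis a0 : 0 < a.
Hypothesis q0ab : 256 * b <= a * q0%:R.
Let Q := (q0 * N)%N.
Let Q' := (q0 * N')%N.

Definition gridpt (K : nat) x (j : nat) : euclid R l := vadd x (kvec k (j%:R / K%:R)).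

Lemma gridpt_back (K : nat) x j q : (0 < K)%N -> (q <= j)%N -> back k K (gridpt K x j) q = gridpt K x (j - q).
Proof.
move=> K0 qj; have Kr0 : K%:R != 0 :> R by rewrite pnatr_eq0 -lt0n.
apply: euclid_ext => i; rewrite !ecoordE; case: eqP => _; last by rewrite !addr0.
by rewrite natrB//; field.
Qed.

Lemma gridptS (K : nat) x j : (0 < K)%N ->
  vadd (gridpt K x j.+1) (kvec k (- K%:R^-1)) = gridpt K x j.
Proof.
move=> K0; have Kr0 : K%:R != 0 :> R by rewrite pnatr_eq0 -lt0n.
apply: euclid_ext => i; rewrite !ecoordE; case: eqP => _; last by rewrite !addr0.
by rewrite -natr1; field.
Qed.

Lemma gridptD (K : nat) x j : (0 < K)%N ->
  gridpt K x (K + j) = vadd (gridpt K x j) (intvec (unitz k false)).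
Proof.
move=> K0; have Kr0 : K%:R != 0 :> R by rewrite pnatr_eq0 -lt0n.
apply: euclid_ext => i; rewrite !ecoordE tnth_mktuple; case: eqP => _; last by rewrite !addr0.
by rewrite natrD expr0; field.
Qed.

(** The unit cube and two further periods: this is the 3 in the hypothesis [D + 3 <= N']. *)
Lemma gridpt_bound (K : nat) x j : (0 < K)%N -> (j <= 2 * K)%N -> cube x ->
  forall i, `|ecoord (gridpt K x j) i| <= 3%:R.
Proof.
move=> K0 jK cx i; rewrite !ecoordE; have /andP[x0 x1] := cx i.
case: eqP => _; last by rewrite addr0 ger0_norm//; lra.
have K0' : 0 < K%:R :> R by rewrite ltr0n.
have h0 : 0 <= j%:R / K%:R :> R by rewrite divr_ge0.
have h2 : j%:R / K%:R <= 2 :> R by rewrite ler_pdivrMr// -natrM ler_nat.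
by rewrite ger0_norm; lra.
Qed.

(* Were all the errors small, then [zak f] would inherit small jumps in the
   direction of [x] from [smooth], contradicting its winding. *)
Lemma grid_err x y : cube x ->
  (forall j i, (j <= 2 * Q)%N -> (i <= 2 * Q')%N ->
     a <= normc (zak f (gridpt Q x j) (gridpt Q' y i)) <= b) ->
  exists j i, [/\ (j <= Q)%N, (i <= Q')%N &
     a / 16 <= normc (err k Q N f (gridpt Q x (Q + j)) (gridpt Q' y (Q' + i)))].
Proof.
move=> cx H; apply: contrapT => /forallNP nex.
have N'0 : (0 < N')%N by lia.
have Q0 : (0 < Q)%N by rewrite muln_gt0 N0 andbT; lia.
have Q'0 : (0 < Q')%N by rewrite muln_gt0 N'0 andbT; lia.
have NQ : (3 * N <= Q)%N by rewrite leq_mul2r; apply/orP; right; lia.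
have NQ' : (3 * N' <= Q')%N by rewrite leq_mul2r; apply/orP; right; lia.
have Q'4 : (4 <= Q')%N by rewrite /Q'; nia.
have e_small j i : (j <= Q)%N -> (i <= Q')%N ->
    normc (err k Q N f (gridpt Q x (Q + j)) (gridpt Q' y (Q' + i))) < a / 16.
  by move=> jQ iQ; rewrite ltNge; apply/negP => h; apply: (nex j); exists i.
have q0r : 0 < q0%:R :> R by rewrite ltr0n; lia.
(* The mesh [1 / (q0 n)] turns the bounds of [smooth_step] and [zak_step] into [64 b / q0], at most
   [a / 4] by the choice of [q0]. *)
have small (n : nat) : (0 < n)%N -> 64 * b * n%:R / (q0 * n)%:R <= a / 4.
  move=> n0; have nr : 0 < n%:R :> R by rewrite ltr0n.
  rewrite natrM (_ : 64 * b * n%:R / (q0%:R * n%:R) = 64 * b / q0%:R); last by field; rewrite !gt_eqF.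
  by rewrite ler_pdivrMr//; move: q0ab; lra.
(* Both indices start after one full period, since the filters look back over a whole period; the
   bounds are assumed from 0 up to two periods. *)
pose F j i := zak f (gridpt Q x (Q + j)) (gridpt Q' y (Q' + i)).
(* The [+ 1] is the offset [Q' / Q'] in the second variable. *)
apply: (@quasi_periodic_grid_jump R a (ecoord y k + 1) Q Q' F a0 Q'4).
- by move=> j i jQ iQ; have /andP[] := H (Q + j)%N (Q' + i)%N ltac:(lia) ltac:(lia).
- by move=> j jQ; rewrite /F [gridpt Q' y (Q' + Q')]gridptD// zak_shifty addn0.
- move=> i iQ; rewrite /F addn0 [gridpt Q x (Q + Q)]gridptD// zak_shiftx chr_unit; congr (cis _ * _).
  rewrite expr0 mul1r; congr (_ * _); rewrite !ecoordE eqxx natrD.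
  by field; rewrite pnatr_eq0 -lt0n.
split=> j i jQ iQ.
- have sm : normc (smooth k Q N f (gridpt Q x (Q + j.+1)) (gridpt Q' y (Q' + i)) -
      smooth k Q N f (gridpt Q x (Q + j)) (gridpt Q' y (Q' + i))) <= a / 4.
    apply: le_trans (small N N0).
    rewrite addnS -(gridptS x (Q + j) Q0).
    apply: (smooth_step N0 NQ) => q qQ; rewrite gridpt_back//; last by lia.
    by have /andP[] := H ((Q + j).+1 - q)%N (Q' + i)%N ltac:(lia) ltac:(lia).
  have e1 := e_small j.+1 i jQ iQ; have e2 := e_small j i (ltnW jQ) iQ.
  move: sm e1 e2; rewrite /F /err.
  set h1 := zak f _ _; set s1 := smooth _ _ _ _ _ _; set s2 := smooth _ _ _ _ _ _; set h2 := zak f _ _.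
  (* Two errors and one step of [smooth] add up to at most [3 a / 8]. *)
  move=> sm e1 e2; rewrite (_ : h1 - h2 = (h1 - s1) + ((s1 - s2) + - (h2 - s2))); last by ring.
  apply: (le_lt_trans (normcD _ _)).
  apply: (@le_lt_trans _ _ (a / 16 + (a / 4 + a / 16))); last by move: a0; lra.
  apply: lerD; first exact: ltW.
  apply: (le_trans (normcD _ _)); apply: lerD => //.
  by rewrite normc_opp ltW.
- apply: (@le_lt_trans _ _ (a / 4)); last by move: a0; lra.
  apply: le_trans (small N' N'0).
  rewrite /F addnS -(gridptS y (Q' + i) Q'0).
  apply: (zak_step fD N'0 NQ' DN); first by apply: gridpt_bound => //; lia.
  move=> q qQ; rewrite gridpt_back//; last by lia.
  by have /andP[] := H (Q + j)%N ((Q' + i).+1 - q)%N ltac:(lia) ltac:(lia).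
Qed.

End grid_error.

Section tail.
Context {R : realType} {l : nat}.
Local Notation mu := (lebesgue_euclid R l).
Local Notation nu := (@cube_measure_restr R l).
Local Notation cube := (@cube R l).
Local Notation ZZ := (l.-tuple int).
Local Notation XX := (euclid R l * euclid R l)%type.
Local Notation nn := (nu \x nu)%E.
Implicit Types (x y s xi : euclid R l) (m n : ZZ) (k : 'I_l) (f g : euclid R l -> R[i]).

Lemma measurable_pair_shift s1 s2 :
  measurable_fun setT (fun z : XX => (vadd z.1 s1, vadd z.2 s2)).
Proof.
apply: measurable_fun_pair.
- exact: (measurableT_comp (measurable_vadd s1) measurable_fst).
- exact: (measurableT_comp (measurable_vadd s2) measurable_snd).
Qed.

Lemma prod_periodic_shift (F : XX -> \bar R) s1 s2 : measurable_fun setT F ->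
  (forall z, 0 <= F z)%E ->
  (forall x y m, F (vadd x (intvec m), y) = F (x, y)) ->
  (forall x y m, F (x, vadd y (intvec m)) = F (x, y)) ->
  (\int[nn]_z F (vadd z.1 s1, vadd z.2 s2) = \int[nn]_z F z)%E.
Proof.
move=> mF F0 F1 F2.
have mF' : measurable_fun setT (fun z : XX => F (vadd z.1 s1, vadd z.2 s2)).
  exact: (measurableT_comp mF (measurable_pair_shift s1 s2)).
rewrite (prod_integral mF' (fun z => F0 _)) (prod_integral mF F0).
pose G x := (\int[nu]_y F (x, y))%E.
have mG : measurable_fun setT G by exact: (measurable_fun_fubini_tonelli_F (m2 := nu) _ mF F0).
have mFx x : measurable_fun setT (fun y => F (x, y)).
  by apply: (measurableT_comp mF); exact: measurable_pair1.
transitivity (\int[nu]_x G (vadd x s1))%E.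
  apply: eq_integral => x _.
  by rewrite (integral_periodic_shift (F := fun y => F (vadd x s1, y)) s2 (mFx _)).
rewrite (integral_periodic_shift s1 mG)// => [x|m x]; first exact: integral_ge0.
by apply: eq_integral => y _; rewrite F1.
Qed.

(** Translations do not preserve the measure on the cubes, but a periodic set has the same measure
    as its translates. *)
Lemma shift_ae (q : XX -> R) (a b : R) s1 s2 : measurable_fun setT q ->
  (forall x y m, q (vadd x (intvec m), y) = q (x, y)) ->
  (forall x y m, q (x, vadd y (intvec m)) = q (x, y)) ->
  {ae nn, forall z, a <= q z <= b} ->
  {ae nn, forall z, a <= q (vadd z.1 s1, vadd z.2 s2) <= b}.
Proof.
move=> mq q1 q2 [E0 [mE0 E00 qE0]].
pose E := ~` (q @^-1` `[a, b]%classic).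
have mE : measurable E by apply: measurableC; rewrite -[X in measurable X]setTI; exact: mq.
have EE z : E z <-> ~ (a <= q z <= b) by rewrite /E/= in_itv.
have nE : nn E = 0%E.
  apply/eqP; rewrite eq_le measure_ge0 andbT -E00 le_measure ?inE//.
pose T z : XX := (vadd z.1 s1, vadd z.2 s2).
have mT : measurable_fun setT T by exact: measurable_pair_shift.
have mTE : measurable (T @^-1` E) by rewrite -[X in measurable X]setTI; exact: mT.
exists (T @^-1` E); split => //.
have mi : measurable_fun setT (fun z => (\1_E z : R)%:E).
  by apply/measurable_EFinP; exact: measurable_indic.
have i0 z : (0 <= (\1_E z : R)%:E)%E by rewrite lee_fin indicE.
have := prod_periodic_shift s1 s2 mi i0.
rewrite (_ : (\int[nn]_z (\1_E z)%:E)%E = nn E); last by rewrite integral_indic// setIT.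
rewrite (_ : (\int[nn]_z (\1_E (vadd z.1 s1, vadd z.2 s2))%:E)%E = nn (T @^-1` E)); last first.
  by rewrite -[in RHS](setIT (T @^-1` E)) -integral_indic.
move=> -> //; first by move=> x y m; rewrite !indicE; congr ((nat_of_bool _)%:R%:E);
  apply/idP/idP; rewrite !inE => /EE h; apply/EE; move: h; rewrite q1.
by move=> x y m; rewrite !indicE; congr ((nat_of_bool _)%:R%:E);
  apply/idP/idP; rewrite !inE => /EE h; apply/EE; move: h; rewrite q2.
Qed.

Lemma cube2_total_measure : nn setT = 1%E.
Proof. by have := cube2_total (R := R) (l := l); rewrite integral_cst// mul1e. Qed.

Lemma cube_ae2 : {ae nn, forall z, cube z.1}.
Proof.
have mc := @cube_measurable R l.
pose E : set XX := ~` (fst @^-1` cube).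
have mE : measurable E.
  by apply: measurableC; rewrite -[X in measurable X]setTI; exact: measurable_fst.
exists E; split => //.
have mi : measurable_fun setT (fun z => (\1_E z : R)%:E).
  by apply/measurable_EFinP; exact: measurable_indic.
have i0 z : (0 <= (\1_E z : R)%:E)%E by rewrite lee_fin indicE.
rewrite -[LHS](_ : (\int[nn]_z (\1_E z)%:E)%E = _); last by rewrite integral_indic// setIT.
rewrite -(cube2_integral mi i0) integral0_eq// => z _.
rewrite /cube2 !indicE; case: (boolP (z.1 \in cube)); last by rewrite mul0r mule0.
rewrite inE => cz; rewrite memNset ?mul0e// => h; exact: h.
Qed.

Lemma ae_exists (P : XX -> Prop) : {ae nn, forall z, P z} -> exists z, P z.
Proof.
move=> [E [mE E0 PE]]; apply: contrapT => /forallNP h.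
have : nn setT = 0%E.
  apply/eqP; rewrite eq_le measure_ge0 andbT -E0 le_measure ?inE// => z _.
  by apply: PE; exact: h.
by rewrite cube2_total_measure => /eqP; rewrite onee_eq0.
Qed.

Lemma ae_all_ord (n : nat) (P : nat -> XX -> Prop) :
  (forall j, {ae nn, forall z, P j z}) -> {ae nn, forall z, forall j, (j < n)%N -> P j z}.
Proof.
move=> h; elim: n => [|n ih]; first exact: aeW.
move: ih (h n); apply: filterS2 => z h1 h2 j; rewrite ltnS leq_eqVlt => /orP[/eqP ->//|].
exact: h1.
Qed.

End tail.

Section tail_bound.
Context {R : realType}.

Definition tail l (k : 'I_l) (f : euclid R l -> R[i]) (N : nat) : \bar R :=
  (\int[lebesgue_euclid R l]_xi
    (normc (fourierL1 f xi) ^+ 2 * (N%:R <= `|ecoord xi k|)%R%:R)%:E)%E.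

(* [(q n + 1) (q n' + 1)] counts the points of the grid, at each of which the
   squared error is at most [t] on average; [256 = 16 ^ 2] comes from [grid_err]. *)
Lemma grid_count_bound (A M t q n n' : R) : 1 / 4 < M -> 1 <= q -> 1 <= n -> 1 <= n' ->
  n' <= 21 * M -> 0 <= t -> A / 256 <= (q * n + 1) * (q * n' + 1) * t ->
  A / (84 * 256 * q ^+ 2) / (M * n) <= t.
Proof.
move=> M4 q1 n1 n'1 nM t0 h.
have M0 : 0 < M by lra.
have q0 : 0 < q by lra.
have n0 : 0 < n by lra.
(* Each count loses a factor 2 for the added 1; together with [n' <= 21 * M] this gives
   [84 = 2 * 2 * 21]. *)
have b1 : q * n + 1 <= 2 * (q * n) by have := mulr_ege1 q1 n1; lra.
have b2 : q * n' + 1 <= 2 * (q * (21 * M)).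
  have := mulr_ege1 q1 n'1; have : q * n' <= q * (21 * M) by rewrite ler_wpM2l// ltW.
  lra.
have P0 : 0 < 84 * q ^+ 2 * (M * n) by rewrite !mulr_gt0// exprn_gt0.
rewrite (_ : A / (84 * 256 * q ^+ 2) / (M * n) = (A / 256) / (84 * q ^+ 2 * (M * n))); last first.
  by field; rewrite !gt_eqF.
rewrite ler_pdivrMr// (le_trans h)// [leRHS]mulrC ler_wpM2r//.
rewrite (_ : 84 * q ^+ 2 * (M * n) = 2 * (q * n) * (2 * (q * (21 * M)))); last by ring.
have p1 : 0 <= q * n + 1 by rewrite addr_ge0// mulr_ge0// ltW.
have p2 : 0 <= q * n' + 1 by rewrite addr_ge0// mulr_ge0 ?(ltW q0)// (le_trans ler01).
exact: ler_pM.
Qed.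

Section fixed_dimension.
Context {l : nat}.
Local Notation mu := (lebesgue_euclid R l).
Local Notation nu := (@cube_measure_restr R l).
Local Notation cube := (@cube R l).
Local Notation ZZ := (l.-tuple int).
Local Notation XX := (euclid R l * euclid R l)%type.
Local Notation nn := (nu \x nu)%E.
Implicit Types (x y s xi : euclid R l) (m n : ZZ) (k : 'I_l) (f g : euclid R l -> R[i]).
Variables (A B M : R) (f : euclid R l -> R[i]).
Hypothesis A0 : 0 < A.
Hypothesis AB : A <= B.
Hypothesis fw : frame_window A B M f.

Let Lf : cL2 mu f. Proof. by case: fw. Qed.
Let fM : forall x, f x != 0 -> forall k, `|ecoord x k| < M. Proof. by case: fw. Qed.
Let fD := supported_bsupp fM.
Let mf : cmeas f := cL2_meas Lf.

Lemma zak_shift_bounds s1 s2 : {ae nn, forall z,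
  Num.sqrt A <= normc (zak f (vadd z.1 s1) (vadd z.2 s2)) <= Num.sqrt B}.
Proof.
have B0 : 0 <= B := le_trans (ltW A0) AB.
have := shift_ae s1 s2 (measurable_sqr_normc (zak_meas mf fD)) _ _ (zak_bounds A0 B0 fw).
move=> /(_ _ _)/= h; apply: filterS (h _ _) => [z /andP[h1 h2]|x y m|x y m].
- have e : normc (zak f (vadd z.1 s1) (vadd z.2 s2)) =
      Num.sqrt (normc (zak f (vadd z.1 s1) (vadd z.2 s2)) ^+ 2).
    by rewrite sqrtr_sqr ger0_norm ?normc_ge0.
  by rewrite e !ler_wsqrtr.
- by rewrite zak_shiftx normcM normc_chr mul1r.
- by rewrite zak_shifty.
Qed.

(** At almost every point the Zak transform is nonzero both at [x] and half a unit further along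
    [k], so [f] is nonzero at two points whose [k]-th coordinates differ by at least 1/2; both lie
    in [(-M, M)]. *)
Lemma window_width k : 1 / 4 < M.
Proof.
have nz s1 s2 : {ae nn, forall z, zak f (vadd z.1 s1) (vadd z.2 s2) != 0}.
  apply: filterS (zak_shift_bounds s1 s2) => z /andP[h _].
  by apply: contraTneq h => ->; rewrite normc0 -ltNge sqrtr_gt0.
have [z [z1 z2]] : exists z : XX, zak f (vadd z.1 (kvec k 0)) (vadd z.2 (kvec k 0)) != 0 /\
    zak f (vadd z.1 (kvec k (1 / 2))) (vadd z.2 (kvec k 0)) != 0.
  by apply: ae_exists; apply: filterS2 (nz (kvec k 0) (kvec k 0)) (nz (kvec k (1 / 2)) (kvec k 0)) => z.
have ex x y : zak f x y != 0 -> exists m, f (vadd x (intvec m)) != 0.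
  move=> h; apply: contrapT => /forallNP fz; move/eqP: h; apply.
  rewrite /zak fsbig1// => m _; have /negP := fz m; rewrite negbK => /eqP ->.
  by rewrite mul0r.
have [m1 /fM /(_ k)] := ex _ _ z1; have [m2 /fM /(_ k)] := ex _ _ z2.
rewrite !ecoordE eqxx !ltr_norml => /andP[h1 h2] /andP[h3 h4].
have [mm|mm] := lerP (tnth m1 k) (tnth m2 k).
  have : ((tnth m1 k)%:~R <= (tnth m2 k)%:~R :> R) by rewrite ler_int.
  lra.
have : ((tnth m2 k)%:~R + 1 <= (tnth m1 k)%:~R :> R).
  by rewrite -[1 : R]/(1%:~R) -intrD ler_int lezD1.
lra.
Qed.

Lemma tail_lower k (q0 N : nat) : (4 <= q0)%N ->
  256 * Num.sqrt B <= Num.sqrt A * q0%:R -> (0 < N)%N ->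
  ((A / (84 * 256 * q0%:R ^+ 2) / (M * N%:R))%:E <= tail k f N)%E.
Proof.
move=> q04 q0AB N0.
set a := Num.sqrt A in q0AB; set b := Num.sqrt B in q0AB.
have a0 : 0 < a by rewrite sqrtr_gt0.
pose D := (Num.truncn M).+1; pose N' := (D + 3)%N.
pose Q := (q0 * N)%N; pose Q' := (q0 * N')%N.
have Q0 : (0 < Q)%N by rewrite muln_gt0 N0 andbT; lia.
have Q'0 : (0 < Q')%N by rewrite muln_gt0 andbT; lia.
have NQ : (3 * N <= Q)%N by rewrite leq_mul2r; apply/orP; right; lia.
have M4 := window_width k.
pose e (ji : 'I_Q.+1 * 'I_Q'.+1) (z : XX) : R :=
  normc (err k Q N f (gridpt k Q z.1 (Q + ji.1)) (gridpt k Q' z.2 (Q' + ji.2))) ^+ 2.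
(* The Zak bounds hold on the entire grid for almost every base point, as only finitely many null
   sets are involved; one error is then large by [grid_err]. *)
have good : {ae nn, forall z, a ^+ 2 / 256 <= \sum_ji e ji z}.
  have H : {ae nn, forall z, forall j, (j < (2 * Q).+1)%N -> forall i, (i < (2 * Q').+1)%N ->
      a <= normc (zak f (gridpt k Q z.1 j) (gridpt k Q' z.2 i)) <= b}.
    apply: (@ae_all_ord R l _ (fun j z => forall i, (i < (2 * Q').+1)%N ->
      a <= normc (zak f (gridpt k Q z.1 j) (gridpt k Q' z.2 i)) <= b)) => j.
    apply: (@ae_all_ord R l _ (fun i z =>
      a <= normc (zak f (gridpt k Q z.1 j) (gridpt k Q' z.2 i)) <= b)) => i.
    exact: zak_shift_bounds.
  move: H (@cube_ae2 R l); apply: filterS2 => z H cz.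
  have [j [i [jQ iQ h]]] := @grid_err R l k N N' D q0 f a b fD N0 (leqnn _) q04 a0 q0AB z.1 z.2 cz
    (fun j i jQ iQ => H j jQ i iQ).
  rewrite (bigD1 (inord j, inord i))//.
  apply: (@le_trans _ _ (e (inord j, inord i) z)); last first.
    by rewrite lerDl sumr_ge0// => ji _; exact: sqr_ge0.
  rewrite /e /= !inordK// (_ : a ^+ 2 / 256 = (a / 16) ^+ 2); last by field.
  by rewrite ler_sqr ?nnegrE ?normc_ge0// divr_ge0// ltW.
have mE := measurable_sqr_normc (err_meas k Q N Lf fD).
have mEE : measurable_fun setT (fun z : XX => (normc (err k Q N f z.1 z.2) ^+ 2)%:E) by exact/measurable_EFinP.
have E0 (z : XX) : (0 <= (normc (err k Q N f z.1 z.2) ^+ 2)%:E)%E by rewrite lee_fin sqr_ge0.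
have me ji : measurable_fun setT (fun z => (e ji z)%:E).
  exact: (measurableT_comp mEE (measurable_pair_shift (kvec k ((Q + ji.1)%:R / Q%:R))
    (kvec k ((Q' + ji.2)%:R / Q'%:R)))).
have e0 ji z : (0 <= (e ji z)%:E)%E by rewrite lee_fin sqr_ge0.
have ie ji : (\int[nn]_z (e ji z)%:E <= tail k f N)%E.
  apply: le_trans (err_tail k Lf fD N0 NQ).
  rewrite le_eqVlt; apply/orP; left; apply/eqP.
  apply: (prod_periodic_shift (F := fun z : XX => (normc (err k Q N f z.1 z.2) ^+ 2)%:E) _ _ mEE E0).
  - by move=> x y m; rewrite /= err_addx normcM normc_chr mul1r.
  - by move=> x y m; rewrite /= err_addy.
have t0 : (0 <= tail k f N)%E.
  by apply: integral_ge0 => xi _; rewrite lee_fin mulr_ge0 ?sqr_ge0.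
case E : (tail k f N) t0 ie => [t| |] // t0 ie; last by rewrite leey.
(* The product of the cubes has mass 1, and by periodicity each of the translated errors has an
   integral at most the tail. *)
have tot : a ^+ 2 / 256 <= (Q.+1 * Q'.+1)%:R * t.
  have [K KE] : exists K, K = a ^+ 2 / 256 by exists (a ^+ 2 / 256).
  have K0 : 0 <= K by rewrite KE; exact: divr_ge0 (sqr_ge0 _) (ler0n _ _).
  rewrite -KE in good *; rewrite -lee_fin.
  have -> : K%:E = (\int[nn]_z (K%:E * 1%:E))%E.
    by rewrite ge0_integralZl// cube2_total mule1.
  apply: (@le_trans _ _ (\int[nn]_z (\sum_ji (e ji z)%:E))%E).
    apply: ae_ge0_le_integral.
    - exact: measurableT.
    - by move=> z _; rewrite mule1 lee_fin.
    - by apply: measurable_cst.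
    - by move=> z _; apply: sume_ge0.
    - exact: emeasurable_sum.
    - by apply: filterS good => z h _; rewrite mule1 sumEFin lee_fin.
  rewrite ge0_integral_sum//.
  apply: (@le_trans _ _ (\sum_(ji : 'I_Q.+1 * 'I_Q'.+1) t%:E)%E); first exact: lee_sum.
  by rewrite sumEFin sumr_const card_prod !card_ord mulr_natl.
have tr : (Num.truncn M)%:R <= M by rewrite truncn_le// ltW//; move: M4; lra.
have aA : a ^+ 2 = A by rewrite sqr_sqrtr// ltW.
rewrite lee_fin; apply: (@grid_count_bound A M t q0%:R N%:R N'%:R M4).
- by rewrite ler1n (leq_trans _ q04).
- by rewrite ler1n.
- by rewrite ler1n /N' addn3.
(* [N'] is at most [M + 4], and [4 < 16 M] by [window_width]. *)
- by rewrite /N' /D natrD -natr1; move: tr M4; lra.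
- by rewrite -lee_fin.
- by move: tot; rewrite aA natrM -[Q.+1%:R]natr1 -[Q'.+1%:R]natr1 /Q /Q' !natrM.
Qed.

End fixed_dimension.

Lemma tail_bound (A B : R) : 0 < A -> A <= B -> exists2 C : R, 0 < C &
  forall l (k : 'I_l) (M : R) (f : euclid R l -> R[i]) (N : nat),
    frame_window A B M f -> (0 < N)%N -> ((C / (M * N%:R))%:E <= tail k f N)%E.
Proof.
move=> A0 AB; set a := Num.sqrt A; set b := Num.sqrt B.
have a0 : 0 < a by rewrite sqrtr_gt0.
(* At least 4, and large enough for [256 b <= a q0]; it depends on [A] and [B] only, hence so does
   the constant. *)
pose q0 := (Num.truncn (256 * b / a)).+4.
have q0ab : 256 * b <= a * q0%:R.
  rewrite -ler_pdivrMl// mulrC; apply: (@le_trans _ _ (Num.truncn (256 * b / a)).+1%:R).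
    exact/ltW/truncnS_gt.
  by rewrite ler_nat /q0; lia.
have q0r : 0 < q0%:R :> R by [].
exists (A / (84 * 256 * q0%:R ^+ 2)); first by rewrite divr_gt0 ?mulr_gt0 ?exprn_gt0.
by move=> l k M f N fw N0; apply: (tail_lower A0 AB fw).
Qed.

End tail_bound.

(** * Moments *)

Section dyadic.
Context {R : realType}.
Implicit Types (x t p s : R).

Lemma powR2E s : 2 `^ s = expR (s * ln 2) :> R.
Proof. by rewrite /powR pnatr_eq0. Qed.

Lemma ln2_le1 : ln 2 <= 1 :> R.
Proof. by rewrite (_ : 2 = 1 + 1 :> R)//; apply: le_ln1Dx; lra. Qed.

Lemma ln2_ge_half : 1 / 2 <= ln 2 :> R.
Proof.
have : ln (1 + (- (1 / 2))) <= - (1 / 2) :> R by apply: le_ln1Dx; lra.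
rewrite (_ : 1 + - (1 / 2) = 2^-1 :> R); last by field.
by rewrite lnV ?posrE//; lra.
Qed.

Lemma powR2_lower s : s <= 0 -> 1 + s <= 2 `^ s :> R.
Proof.
move=> s0; rewrite powR2E; apply: le_trans (expR_ge1Dx _).
by rewrite lerD2l; have := ln2_le1; nra.
Qed.

Lemma powR2_lower_pos s : 0 <= s -> 1 + s / 2 <= 2 `^ s :> R.
Proof.
move=> s0; rewrite powR2E; apply: le_trans (expR_ge1Dx _).
by rewrite lerD2l; have := ln2_ge_half; nra.
Qed.

Lemma telescope_pow x n : 0 < x ->
  \sum_(j < n.+1) (x ^+ j - x ^+ j / x) = x ^+ n - x^-1.
Proof.
move=> x0; elim: n => [|n ih]; first by rewrite big_ord_recr big_ord0/= add0r !expr0 mul1r.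
by rewrite big_ord_recr/= ih exprS mulrAC divff ?gt_eqF// mul1r; ring.
Qed.

(** The weights telescope: for [2 ^ j <= t < 2 ^ (j + 1)] and [j < n] the sum is [x ^ j - 1 / x],
    and it is 0 for [t < 1]. With [x = 2 ^ p] it is a step function below [t ^ p]. *)
Lemma dyadic_layer x t n : 1 <= x ->
  let S := \sum_(j < n) (x ^+ j - x ^+ j / x) * ((2 ^ j)%N%:R <= t)%R%:R in
  S = 0 \/ exists j, [/\ (j < n)%N, (2 ^ j)%N%:R <= t & S <= x ^+ j].
Proof.
move=> x1; have x0 : 0 < x by exact: lt_le_trans x1.
have a0 j : 0 <= x ^+ j - x ^+ j / x.
  by rewrite subr_ge0 ler_piMr ?exprn_ge0 ?(ltW x0)// invf_le1.
elim: n => [|n ih] /=; first by left; rewrite big_ord0.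
have [tn|tn] := boolP ((2 ^ n)%N%:R <= t); last first.
  rewrite big_ord_recr/= (negPf tn) mulr0 addr0.
  case: ih => [->|[j [jn tj Sj]]]; first by left.
  by right; exists j; split => //; exact: ltnW.
right; exists n; split => //.
apply: (@le_trans _ _ (\sum_(j < n.+1) (x ^+ j - x ^+ j / x))).
  by apply: ler_sum => j _; rewrite ler_piMr// lern1 leq_b1.
by rewrite telescope_pow// gerBl invr_ge0 ltW.
Qed.

End dyadic.

Section moments.
Context {R : realType} {l : nat}.
Local Notation mu := (lebesgue_euclid R l).
Implicit Types (x y s xi : euclid R l) (k : 'I_l) (f g h : euclid R l -> R[i]) (phi : R -> \bar R).

(** A common form of [moment] and [trunc_moment]. *)
Definition wmoment phi k h : \bar R :=
  (\int[mu]_x (phi `|ecoord x k|%R * (normc (h x) ^+ 2)%:E))%E.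

Let wmeas phi k h : measurable_fun setT phi -> cmeas h ->
  measurable_fun setT (fun x => phi `|ecoord x k|%R * (normc (h x) ^+ 2)%:E)%E.
Proof.
move=> mphi mh; apply: emeasurable_funM; last exact/measurable_EFinP/measurable_sqr_normc.
apply: (measurableT_comp mphi).
by apply: (measurableT_comp (f := fun t : R => `|t|)); [exact: normr_measurable|exact: measurable_ecoord].
Qed.

Lemma wmoment_ae phi k g h : measurable_fun setT phi -> (forall t, 0 <= phi t)%E ->
  cmeas g -> cmeas h -> {ae mu, forall x, g x = h x} -> wmoment phi k g = wmoment phi k h.
Proof.
move=> mphi phi0 mg mh gh; apply: ge0_ae_eq_integral => //.
- exact: wmeas.
- exact: wmeas.
- by move=> x _; rewrite mule_ge0// lee_fin sqr_ge0.
- by move=> x _; rewrite mule_ge0// lee_fin sqr_ge0.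
- by apply: filterS gh => x ->.
Qed.

Lemma wmoment_reflect phi k h : measurable_fun setT phi -> (forall t, 0 <= phi t)%E ->
  cmeas h -> wmoment phi k (fun x => h (vopp x)) = wmoment phi k h.
Proof.
move=> mphi phi0 mh.
rewrite -[RHS](preserving_integral preserving_vopp (wmeas k mphi mh)).
  by apply: eq_integral => x _; rewrite ecoordE normrN.
by move=> x; rewrite mule_ge0// lee_fin sqr_ge0.
Qed.

(** A discrete layer-cake estimate: each dyadic layer of the weight is integrated to one tail. *)
Lemma wmoment_lower phi k f (c : nat -> R) (n : nat) (t : R) :
  measurable_fun setT phi -> (forall t, 0 <= phi t)%E -> cmeas f ->
  (forall j, 0 <= c j) ->
  (forall t : R, 0 <= t -> ((\sum_(j < n) c j * ((2 ^ j)%N%:R <= t)%R%:R)%:E <= phi t)%E) ->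
  (forall N, (0 < N)%N -> ((t / N%:R)%:E <= tail k f N)%E) ->
  ((\sum_(j < n) c j * (t / (2 ^ j)%N%:R))%:E <= wmoment phi k (fourierL1 f))%E.
Proof.
move=> mphi phi0 mf c0 cphi ht.
have mind := high_freq_meas k mf.
have ind0 N xi : (0 <= (normc (fourierL1 f xi) ^+ 2 * (N%:R <= `|ecoord xi k|)%R%:R)%:E)%E.
  by rewrite lee_fin mulr_ge0 ?sqr_ge0.
rewrite -sumEFin.
apply: (@le_trans _ _ (\sum_(j < n) (c j)%:E * tail k f (2 ^ j))%E).
  apply: lee_sum => j _; rewrite EFinM; apply: lee_wpmul2l; first by rewrite lee_fin.
  by apply: ht; rewrite expn_gt0.
under eq_bigr => j _ do rewrite -ge0_integralZl ?lee_fin//.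
rewrite -ge0_integral_sum//; last 2 first.
- by move=> j; exact: measurable_funeM.
- by move=> j xi _; rewrite mule_ge0// lee_fin.
apply: ge0_le_integral => //.
- by move=> xi _; apply: sume_ge0 => j _; rewrite mule_ge0// lee_fin.
- by apply: emeasurable_sum => j; exact: measurable_funeM.
- exact: wmeas (fourier_meas mf).
- move=> xi _; apply: le_trans (lee_wpmul2r _ (cphi `|ecoord xi k| (normr_ge0 _))); last by rewrite lee_fin sqr_ge0.
  rewrite -EFinM mulr_suml -sumEFin; apply: lee_sum => j _.
  by rewrite -EFinM lee_fin le_eqVlt; apply/orP; left; apply/eqP; ring.
Qed.

End moments.

Section moment_bounds.
Context {R : realType} {l : nat}.
Local Notation mu := (lebesgue_euclid R l).
Implicit Types (x y s xi : euclid R l) (g h : euclid R l -> R[i]) (phi : R -> \bar R).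
Variables (k : 'I_l) (f : euclid R l -> R[i]) (C M : R).
Hypothesis mf : cmeas f.
Hypothesis C0 : 0 < C.
Hypothesis M0 : 0 < M.
Hypothesis tailf : forall N, (0 < N)%N -> ((C / (M * N%:R))%:E <= tail k f N)%E.

Let tailf' N : (0 < N)%N -> ((C / M / N%:R)%:E <= tail k f N)%E.
Proof. by move=> N0; have := tailf N0; rewrite invfM mulrA. Qed.

(** Layer [j] has weight [b ^ j (1 - 1 / b)] and a tail of at least [C / (M 2 ^ j)], whence the
    ratio [b / 2]: for [b = 2 ^ p] it is 1 if [p = 1], and [2 ^ (p - 1) < 1] if [p < 1]. *)
Let dyadic_moment phi (b : R) n : measurable_fun setT phi -> (forall t, 0 <= phi t)%E -> 1 <= b ->
  (forall t j, 0 <= t -> (j < n)%N -> (2 ^ j)%N%:R <= t -> ((b ^+ j)%:E <= phi t)%E) ->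
  ((C / M * (1 - b^-1) * \sum_(j < n) (b / 2) ^+ j)%:E <= wmoment phi k (fourierL1 f))%E.
Proof.
move=> mphi phi0 b1 bphi; have b0 : 0 < b by exact: lt_le_trans b1.
have := @wmoment_lower _ _ phi k f (fun j => b ^+ j - b ^+ j / b) n (C / M) mphi phi0 mf _ _ tailf'.
rewrite (_ : \sum_(j < n) _ = C / M * (1 - b^-1) * \sum_(j < n) (b / 2) ^+ j).
  apply=> [j|t t0].
    by rewrite subr_ge0 ler_piMr ?exprn_ge0 ?(ltW b0)// invf_le1.
  have [->|[j [jn tj Sj]]] := dyadic_layer t n b1; first exact: phi0.
  by apply: le_trans (bphi t j t0 jn tj); rewrite lee_fin.
rewrite mulr_sumr; apply: eq_bigr => j _; rewrite natrX exprMn exprVn.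
by field; rewrite !gt_eqF// exprn_gt0.
Qed.

Let phi_trunc (p : R) (T : \bar R) (t : R) : \bar R := mine (t `^ p)%:E T.

Let phi_trunc_meas p T : measurable_fun setT (phi_trunc p T).
Proof.
apply: measurable_mine; last exact: measurable_cst.
by apply/measurable_EFinP; exact: measurable_powR.
Qed.

Let phi_trunc_ge0 p T t : (0 <= T)%E -> (0 <= phi_trunc p T t)%E.
Proof. by move=> T0; rewrite /phi_trunc le_min T0 lee_fin powR_ge0. Qed.

(** For [s = 1 / p - 1] the inequality [1 + s <= 2 ^ s] shows that the quotient
    [(1 - 2 ^ s) / (- s)] is at most 1. The part [|xi_k| >= 1], where the weight is at least 1, is
    therefore enough. *)
Lemma trunc_moment_superlinear p (T : \bar R) : 1 < p -> (2%:E <= T)%E ->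
  ((C / 8 * (1 - 2 `^ (p^-1 - 1)) / (M * (1 - p^-1)))%:E <= wmoment (phi_trunc p T) k (fourierL1 f))%E.
Proof.
move=> p1 T2; have T0 : (0 <= T)%E by apply: le_trans T2; rewrite lee_fin.
have p0 : 0 < p by lra.
have ip : p^-1 < 1 by rewrite invf_lt1.
have h := @wmoment_lower _ _ (phi_trunc p T) k f (fun=> 1) 1 (C / M) (@phi_trunc_meas p T)
  (fun t => phi_trunc_ge0 p t T0) mf (fun=> ler01) _ tailf'.
apply: le_trans (h _).
  rewrite big_ord1 mul1r expn0 divr1 lee_fin.
  have b := powR2_lower (s := p^-1 - 1) ltac:(lra).
  rewrite invfM mulrA ler_pdivrMr ?subr_gt0//.
  have CM : 0 < C / M by rewrite divr_gt0.
  rewrite (_ : C / 8 * (1 - 2 `^ (p^-1 - 1)) / M = C / M * ((1 - 2 `^ (p^-1 - 1)) / 8)); last by ring.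
  by rewrite ler_pM2l//; lra.
move=> t t0; rewrite big_ord1 mul1r expn0.
have [t1|t1] := boolP (1 <= t); last exact: phi_trunc_ge0.
rewrite /phi_trunc le_min lee_fin; apply/andP; split.
  by rewrite (le_trans t1)// le1r_powR// ltW.
by apply: le_trans T2; rewrite lee_fin ler_nat.
Qed.

(** Each of the dyadic scales [1, 2, ..., 2 ^ n] contributes the same amount [C / (2 M)]. *)
Lemma trunc_moment_linear_pow (T : \bar R) n : ((2 ^+ n)%:E <= T)%E ->
  ((C / M / 2 * n.+1%:R)%:E <= wmoment (phi_trunc 1 T) k (fourierL1 f))%E.
Proof.
move=> T2; have T0 : (0 <= T)%E by apply: le_trans T2; rewrite lee_fin exprn_ge0.
have b12 : 1 <= 2 :> R by lra.
have := @dyadic_moment (phi_trunc 1 T) 2 n.+1 (@phi_trunc_meas 1 T) (fun t => phi_trunc_ge0 1 t T0) b12.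
rewrite divff// (eq_bigr (fun=> 1)) => [|j _]; last by rewrite expr1n.
rewrite sumr_const card_ord (_ : C / M * _ * _ = C / M / 2 * n.+1%:R); last by field; rewrite gt_eqF.
apply=> t j t0 jn tj; rewrite /phi_trunc powRr1// le_min !lee_fin -natrX tj/=.
apply: le_trans T2; rewrite lee_fin natrX ler_weXn2l//; lra.
Qed.

Lemma trunc_moment_linear (T : \bar R) : (2%:E <= T)%E ->
  ((C / 8 / M)%:E * lne T <= wmoment (phi_trunc 1 T) k (fourierL1 f))%E.
Proof.
have CM : 0 < C / M by rewrite divr_gt0.
case: T => [T||//]; last first.
  (* Without truncation all scales count, so the moment is infinite. *)
  move=> _; apply: (@le_trans _ _ +oo%E); first by rewrite leey.
  rewrite leye_eq; apply/eqP/eq_infty => A.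
  have /(_ (Num.truncn (A / (C / M / 2))))  := @trunc_moment_linear_pow +oo%E _.
  move=> /(_ (leey _)); apply: le_trans; rewrite lee_fin.
  rewrite mulrC -ler_pdivrMr ?divr_gt0//.
  exact/ltW/truncnS_gt.
rewrite lee_fin => T2; have T0 : 0 < T by lra.
have -> : lne T%:E = (ln T)%:E by rewrite /= leNgt T0.
rewrite -EFinM.
(* Then [2 ^ n <= T <= 2 ^ (n + 1)], and [ln 2 <= 1] gives [ln T <= n + 1], the number of scales. *)
pose n := trunc_log 2 (Num.truncn T).
have tT : (0 < Num.truncn T)%N by rewrite truncn_gt0; lra.
have /andP[n1 n2] := trunc_log_bounds (isT : 1 < 2)%N tT.
have h1 : ((2 ^+ n)%:E <= T%:E)%E.
  rewrite lee_fin -natrX; apply: (@le_trans _ _ (Num.truncn T)%:R); first by rewrite ler_nat.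
  by rewrite truncn_le// ltW.
apply: le_trans (trunc_moment_linear_pow h1); rewrite lee_fin.
have T3 : T <= 2 ^+ n.+1.
  by apply: (le_trans (ltW (truncnS_gt T))); rewrite -natrX ler_nat.
have lnT : ln T <= n.+1%:R.
  apply: (@le_trans _ _ (ln (2 ^+ n.+1))).
    by rewrite ler_ln ?posrE ?exprn_gt0.
  by rewrite lnXn// -[leLHS]mulr_natr ler_piMl// ln2_le1.
rewrite (_ : C / 8 / M = C / M / 8); last by ring.
have n0 : 0 <= n.+1%:R :> R by [].
apply: (@le_trans _ _ (C / M / 8 * n.+1%:R)).
  by rewrite ler_wpM2l// divr_ge0// ltW.
rewrite ler_wpM2r//; lra.
Qed.

(** The factor 8 arises here: [1 - 1 / b >= p / 4] for [b = 2 ^ p], the geometric sum is at least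
    half of [1 / (1 - r)] once [r ^ n <= 1 / 2], and [1 - r <= 1 - p]. The product [p / (8 (1 - p))]
    is [1 / (8 (1 / p - 1))]. *)
Lemma moment_sublinear p : 0 < p -> p < 1 ->
  ((C / 8 / (M * (p^-1 - 1)))%:E <= wmoment (fun t => (t `^ p)%:E) k (fourierL1 f))%E.
Proof.
move=> p0 p1; set b := 2 `^ p : R.
have CM : 0 < C / M by rewrite divr_gt0.
have b1 : 1 + p / 2 <= b by apply: powR2_lower_pos; exact: ltW.
have b2 : b <= 2 by rewrite ler1_powR//; lra.
have b0 : 0 < b by lra.
pose r := b / 2.
have rE : r = 2 `^ (p - 1).
  by rewrite /r powRD ?powRN ?powRr1//; apply/implyP => _; rewrite pnatr_eq0.
have rp : p <= r by rewrite rE; have := powR2_lower (s := p - 1) ltac:(lra); lra.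
have r1 : r < 1.
  rewrite rE powR2E expR_lt1 pmulr_llt0; first by lra.
  by rewrite (lt_le_trans _ ln2_ge_half)//; lra.
have [n rn] : exists n, r ^+ n <= 1 / 2.
  have /cvgrPdist_lt : (r ^+ n @[n --> \oo] --> (0 : R)).
    by apply: cvg_expr; rewrite ger0_norm//; lra.
  move=> /(_ (1 / 2) ltac:(lra)) [n _ /(_ n (leqnn n))] /= h.
  exists n; move: h; rewrite sub0r normrN ger0_norm; last by rewrite exprn_ge0//; lra.
  exact: ltW.
have := @dyadic_moment (fun t => (t `^ p)%:E) b n.
move=> /(_ _ _ _ _)/= h; apply: le_trans (h _ _ _ _).
- have S : \sum_(j < n) r ^+ j = (1 - r ^+ n) / (1 - r).
    have := subrX1 r n; rewrite -/r => e.
    apply: (mulfI (_ : 1 - r != 0)); first by rewrite subr_eq0 gt_eqF.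
    rewrite mulrCA divff ?mulr1; last by rewrite subr_eq0 gt_eqF.
    by rewrite -[LHS]opprK -mulNr opprB -e opprB.
  rewrite -/r S lee_fin.
  have ib : p / 4 <= 1 - b^-1.
    rewrite (_ : 1 - b^-1 = (b - 1) / b); last by field; rewrite gt_eqF.
    by rewrite ler_pdivlMr//; nra.
  have g : 1 / 2 / (1 - p) <= (1 - r ^+ n) / (1 - r).
    by apply: ler_pM; [lra|rewrite invr_ge0; lra|lra|rewrite lef_pV2 ?posrE; lra].
  rewrite (_ : C / 8 / (M * (p^-1 - 1)) = C / M * (p / 4) * (1 / 2 / (1 - p))); last first.
    by field; rewrite !gt_eqF//; lra.
  apply: ler_pM => //; last by rewrite ler_wpM2l// ltW.
  + by rewrite mulr_ge0 ?(ltW CM)//; lra.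
  + by rewrite divr_ge0; lra.
- by apply/measurable_EFinP; exact: measurable_powR.
- by move=> t; rewrite lee_fin powR_ge0.
- lra.
- move=> t j t0 _ tj; rewrite lee_fin.
  apply: (@le_trans _ _ ((2 ^ j)%N%:R `^ p)); last by rewrite ge0_ler_powR ?nnegrE// ltW.
  by rewrite natrX -[2 ^+ j]powR_mulrn// -powRrM mulrC powRrM powR_mulrn// powR_ge0.
Qed.

(** The function [h] will be the transform of [f] up to a null set and, in the dual case, a
    reflection; neither changes the weighted moments. *)
Lemma moment_bounds_of_tail p (T : \bar R) h : 0 < p -> (2%:E <= T)%E ->
  (forall phi, measurable_fun setT phi -> (forall t, 0 <= phi t)%E ->
     wmoment phi k h = wmoment phi k (fourierL1 f)) ->
  moment_bounds (C / 8) M p T k h.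
Proof.
move=> p0 T2 hf; have T0 : (0 <= T)%E by apply: le_trans T2; rewrite lee_fin.
have tr q : trunc_moment q T k h = wmoment (phi_trunc q T) k (fourierL1 f).
  by rewrite -hf// => t; exact: phi_trunc_ge0.
split=> [p1|p1|p1].
- by rewrite tr; exact: trunc_moment_superlinear.
- by rewrite p1 tr; exact: trunc_moment_linear.
- rewrite (_ : moment p k h = wmoment (fun t => (t `^ p)%:E) k h).
    rewrite hf; [exact: moment_sublinear|by apply/measurable_EFinP; exact: measurable_powR|].
    by move=> t; rewrite lee_fin powR_ge0.
  by apply: eq_integral => x _; rewrite -EFinM.
Qed.

End moment_bounds.

Theorem theorem5p3 (R : realType) (A B : R) :
  exists2 C : R, 0 < C &
  forall (l : nat) (p M : R) (g gh : euclid R l -> R[i]),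
    0 < p -> 0 < M -> inL2 g -> is_fourierL2 g gh ->
    riesz_basis (gabor g) -> riesz_bounds A B (gabor g) ->
  forall (k : 'I_l) (T : \bar R), (2%:E <= T)%E ->
    (supported_in_cube M g -> moment_bounds C M p T k gh) /\
    (supported_in_cube M gh -> moment_bounds C M p T k g).
Proof.
(* Unless [0 < A <= B], no system has these bounds, and any constant will do. *)
have [/andP[A0 AB]|nAB] := boolP ((0 < A) && (A <= B)); last first.
  exists 1 => // l p M g gh _ _ _ _ _ [A0 AB _].
  by move: nAB; rewrite A0 AB.
have [C C0 tailC] := tail_bound A0 AB.
exists (C / 8); first by rewrite divr_gt0.
move=> l p M g gh p0 M0 Lg Fg _ rb k T T2; have [_ Lgh _] := Fg.
split=> [gM|ghM].
- have [f fw ghf] := supported_window Fg rb gM.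
  have mf : cmeas f by case: fw => /cL2_meas.
  apply: (moment_bounds_of_tail mf C0 M0 (fun N => @tailC l k M f N fw)) => // phi mphi phi0.
  by apply: wmoment_ae => //; [exact: cL2_meas Lgh|exact: fourier_meas].
- have [f fw gf] := supported_window_dual Fg rb ghM.
  have mf : cmeas f by case: fw => /cL2_meas.
  apply: (moment_bounds_of_tail mf C0 M0 (fun N => @tailC l k M f N fw)) => // phi mphi phi0.
  have mF := fourier_meas mf.
  (* The reflection preserves [|x_k|], on which alone the weight depends. *)
  rewrite (wmoment_ae k mphi phi0 (cL2_meas Lg) (reflect_meas mF) gf).
  exact: wmoment_reflect.
Qed.
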